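(* If $G$ is an $(\alpha_1,\Delta)$-metric graph with $m$ edges, then a central vertex of $G$ can be computed in $O(m)$ time.
   Context: All graphs are finite, connected, unweighted, undirected, simple; $d(u,v)$ is the shortest-path distance. $I(u,v)=\{x: d(u,x)+d(x,v)=d(u,v)\}$. A graph is $\alpha_1$-metric if for all vertices $u,v,w,x$: whenever $v\in I(u,w)$, $w\in I(v,x)$ and $v,w$ are adjacent, then $d(u,x)\ge d(u,v)+d(v,x)-1$. A graph is $(\alpha_1,\Delta)$-metric if it is $\alpha_1$-metric and satisfies the triangle condition: for all vertices $u,v,w$ with $u,v$ adjacent and $d(u,w)=d(v,w)=k$, there is a common neighbor $x$ of $u$ and $v$ with $d(x,w)=k-1$. $e(v)=\max_u d(u,v)$, $rad(G)=\min_v e(v)$; a central vertex is a vertex $v$ with $e(v)=rad(G)$. *)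

(* Defs.v *)
From mathcomp Require Import all_boot.
Set Implicit Arguments. Unset Strict Implicit. Unset Printing Implicit Defensive.

(* A simple graph on a finite vertex type T is a symmetric irreflexive
   relation e : rel T (hypotheses stated in the theorem). *)

Section Graph.
Variables (T : finType) (e : rel T).

Fixpoint ball (u : T) (k : nat) : {set T} :=
  if k is k'.+1 then ball u k' :|: [set v | [exists w in ball u k', e w v]]
  else [set u].

(* shortest-path distance: least k with v in ball u k (correct for connected
   graphs, where every vertex lies in ball u (#|T| - 1)). *)
Definition dist (u v : T) : nat := find (fun k => v \in ball u k) (iota 0 #|T|).

Definition in_interval (u v x : T) : bool := dist u x + dist x v == dist u v.

Definition alpha1_metric : Prop :=
  forall u v w x : T,
    in_interval u w v -> in_interval v x w -> e v w ->
    dist u v + dist v x - 1 <= dist u x.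

Definition triangle_condition : Prop :=
  forall u v w : T, e u v -> dist u w = dist v w ->
    exists x : T, [/\ e u x, e v x & (dist x w).+1 = dist u w].

Definition alpha1_Delta_metric : Prop := alpha1_metric /\ triangle_condition.

Definition ecc (v : T) : nat := \max_(u : T) dist u v.

Definition central (v : T) : Prop := forall u : T, ecc v <= ecc u.

Definition nedges : nat :=
  #|[set [set p.1; p.2] | p in [set p : T * T | e p.1 p.2]]|.

End Graph.

Inductive instr : Type :=
| IConst of nat & nat
| IAdd of nat & nat & nat
| ISub of nat & nat & nat
| ILoad of nat & nat
| IStore of nat & nat
| IJz of nat & nat
| IHalt.

Definition state := (nat * (nat -> nat))%type.

Definition upd (M : nat -> nat) (r x : nat) : nat -> nat :=
  fun i => if i == r then x else M i.

Definition step (P : seq instr) (s : state) : state :=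
  let: (pc, M) := s in
  match nth IHalt P pc with
  | IConst r c => (pc.+1, upd M r c)
  | IAdd r a b => (pc.+1, upd M r (M a + M b))
  | ISub r a b => (pc.+1, upd M r (M a - M b))
  | ILoad r a => (pc.+1, upd M r (M (M a)))
  | IStore a b => (pc.+1, upd M (M a) (M b))
  | IJz a l => (if M a == 0 then l else pc.+1, M)
  | IHalt => s
  end.

Definition run (P : seq instr) (k : nat) (s : state) : state := iter k (step P) s.

Definition halted (P : seq instr) (s : state) : bool :=
  if nth IHalt P s.1 is IHalt then true else false.

(* Graph on vertices 0..n-1.  Memory layout:
     M[0] = n;
     M[1+v] = start address of the adjacency list of v (v = 0..n),
              M[1+n] = end address of the last list;
     M[n+2 ..] = concatenated adjacency lists (each list in arbitrary order,
                 without repetitions);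
     all other cells are 0. *)
Definition layout (n : nat) (adj : 'I_n -> seq 'I_n) : seq nat :=
  let sizes := [seq size (adj v) | v <- enum 'I_n] in
  n :: [seq (n + 2) + sumn (take k sizes) | k <- iota 0 n.+1]
    ++ flatten [seq map val (adj v) | v <- enum 'I_n].

Definition encodes (n : nat) (e : rel 'I_n) (M : nat -> nat) : Prop :=
  exists adj : 'I_n -> seq 'I_n,
    (forall v, uniq (adj v) /\ forall w, (w \in adj v) = e v w) /\
    (forall i, M i = nth 0 (layout adj) i).

(* Main.v *)
(* Disks are convex and there is no induced C4, so the neighbours of [v] that are
   closer to a vertex [f] farthest from [v] form a clique [K].  If some neighbour
   of [v] has a smaller eccentricity, then so has every [u] in [K] that realizes
   the distance to [K] for the most vertices at distance [ecc v - 1] from [K].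
   These numbers take linear time: every vertex [z] outside [K] has a gate, adjacent
   to exactly the members of [K] nearest to [z], and a gate of [z] is found among
   the gates of the parents of [z] in a breadth-first search from [K].

   The middle of a double sweep has eccentricity at most rad + 13, so 13 descents
   lead to a vertex [v] without better neighbours.  If [v] is still not central,
   take [u] in [K] as above, [z] farthest from [u] and [y] farthest from [z]: in the
   slice of the vertices at distance [ecc v - 1] from both [z] and [y], a vertex [s]
   of maximum degree is adjacent to all the others, and [s] or the vertex obtained
   from [s] by one descent is central. *)

(* A vertex [v] without better neighbours exceeds the radius by at most 1. Put [k = ecc v]. If [u],
   of maximal coverage, still misses some vertex [z], then some vertex is at distance at least
   [2k - 2] from [z], so every eccentricity is at least [k - 1]. A vertex of eccentricity [k - 1]
   must then be halfway between [z] and a vertex farthest from it, that is, in the slice.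

   The 13 comes from slices having diameter at most 2, which makes triangles thin up to an error of
   4. The midpoint of any shortest path ending in the last vertex of the double sweep uses this
   twice, with 1 lost by rounding; the middle vertex of the sweep uses it once more: 4 + 4 + 1 + 4.

   On the machine side, the input occupies the low cells, where the working registers should be, so
   it has to be moved away first. The algorithm itself is written in a small structured language
   with a clock, whose compiled code takes at most its own length in machine steps per tick.
   Connectedness bounds the number of vertices by the number of edges plus 1. *)
Require Import Defs.
From mathcomp Require Import all_boot zify.
Set Implicit Arguments. Unset Strict Implicit. Unset Printing Implicit Defensive.

(* Boolean hypotheses other than (in)equalities make [lia] explode. *)
Ltac dlia :=
  repeat match goal with
  | H : is_true ?b |- _ =>
      lazymatch b with
      | leq _ _ => fail | eq_op _ _ => fail
      | negb (leq _ _) => fail | negb (eq_op _ _) => fail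
      | _ => clear H end
  end; lia.

(** * Distances in (alpha1,Delta)-metric graphs *)

Section Distance.
Variables (T : finType) (e : rel T).
Hypothesis sym_e : symmetric e.
Hypothesis irr_e : irreflexive e.
Hypothesis conn_e : forall u v, connect e u v.
Local Notation d := (dist e).

(** * Shortest-path distance *)

Lemma ballS u k v :
  (v \in ball e u k.+1) = (v \in ball e u k) || [exists w in ball e u k, e w v].
Proof. by rewrite /= inE inE. Qed.

Lemma ball_path u p : path e u p -> last u p \in ball e u (size p).
Proof.
elim/last_ind: p => [|p x IH]; first by rewrite inE.
rewrite rcons_path last_rcons size_rcons => /andP[/IH pP ex].
by rewrite ballS; apply/orP; right; apply/existsP; exists (last u p); rewrite pP.
Qed.

Lemma ball_mono u i j v : i <= j -> v \in ball e u i -> v \in ball e u j.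
Proof.
move=> /subnKC <-; elim: (j - i) => [|k IH] vi; first by rewrite addn0.
by rewrite addnS ballS IH.
Qed.

(** A duplicate-free path has fewer than [#|T|] edges, so by connectedness the search in [dist]
    succeeds and never returns its default [#|T|]. *)
Lemma ballE u v k : (v \in ball e u k) = (d u v <= k).
Proof.
have [K KT vK] : exists2 K, K < #|T| & v \in ball e u K.
  have /connectP[p pp ->] := conn_e u v.
  case: (shortenP pp) => p' pp' up' _; exists (size p'); last exact: ball_path.
  by rewrite -[(size p').+1]/(size (u :: p')) -(card_uniqP up') max_card.
have hasv : has (fun k => v \in ball e u k) (iota 0 #|T|).
  by apply/hasP; exists K; rewrite ?mem_iota.
have dT : d u v < #|T| by rewrite -[X in _ < X](size_iota 0) -has_find.
apply/idP/idP => [vk|].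
  rewrite leqNgt; apply/negP => kd.
  by have := before_find 0 kd; rewrite nth_iota ?vk // (ltn_trans kd).
move=> dk; apply: ball_mono dk _.
by have := nth_find 0 hasv; rewrite nth_iota.
Qed.

Lemma dist_eq0 u v : (d u v == 0) = (u == v).
Proof. by rewrite -leqn0 -ballE inE eq_sym. Qed.

Lemma distxx u : d u u = 0. Proof. by apply/eqP; rewrite dist_eq0. Qed.

Lemma dist_leS u v k :
  reflect (d u v <= k \/ exists2 w, d u w <= k & e w v) (d u v <= k.+1).
Proof.
rewrite -(ballE u v k.+1) ballS; apply: (iffP orP); rewrite ballE.
  case; [by left | move=> /existsP[w /andP[]]; rewrite ballE => ? ?]; right; by exists w.
case; [by left | case=> w dw ew; right; apply/existsP; exists w]; by rewrite ballE dw.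
Qed.

Lemma edge_dist u v : e u v = (d u v == 1).
Proof.
apply/idP/eqP => [euv|duv].
  apply/eqP; rewrite eqn_leq; apply/andP; split.
    by apply/dist_leS; right; exists u; rewrite ?distxx.
  by rewrite lt0n dist_eq0; apply/eqP => uv; rewrite uv irr_e in euv.
have /dist_leS[|[w]] : d u v <= 1 by rewrite duv.
  by rewrite duv.
by rewrite leqn0 dist_eq0 => /eqP ->.
Qed.

Lemma dist_triangle w u v : d u v <= d u w + d w v.
Proof.
move: {2}(d w v) (leqnn (d w v)) => j; elim: j v => [|j IH] v.
  by rewrite leqn0 dist_eq0 => /eqP ->; rewrite distxx addn0.
case: (ltngtP (d w v) j.+1) => // [|dwv _]; first by rewrite ltnS => /IH.
have /dist_leS[|[x dx exv]] : d w v <= j.+1 by rewrite dwv.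
  by move/IH.
rewrite dwv addnS; apply/dist_leS; right; exists x => //.
by apply: leq_trans (IH _ dx) _; rewrite leq_add2l.
Qed.

Lemma dist_sym u v : d u v = d v u.
Proof.
suff le x y : d x y <= d y x by apply/eqP; rewrite eqn_leq !le.
move: {2}(d y x) (leqnn (d y x)) => j; elim: j x => [|j IH] x.
  by rewrite leqn0 dist_eq0 => /eqP ->; rewrite distxx.
case: (ltngtP (d y x) j.+1) => // [|dyx _]; first by rewrite ltnS => /IH.
have /dist_leS[|[w dw ewx]] : d y x <= j.+1 by rewrite dyx.
  by move/IH.
have exw : d x w <= 1 by move: ewx; rewrite sym_e edge_dist => /eqP ->.
by have := dist_triangle w x y; have := IH _ dw; lia.
Qed.

Lemma dist_pred u v k : d u v = k.+1 -> exists2 w, d u w = k & e w v.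
Proof.
move=> duv; have /dist_leS[|[w dw ew]] : d u v <= k.+1 by rewrite duv.
  by rewrite duv ltnn.
exists w => //; move: (ew); rewrite edge_dist => /eqP.
by have := dist_triangle w u v; lia.
Qed.

Lemma geodesic u v i : i <= d u v -> exists2 w, d u w = i & d w v + i = d u v.
Proof.
move=> le_i; have [j] : exists j, d u v = i + j by exists (d u v - i); lia.
elim: j v {le_i} => [|j IH] v; first by exists v; rewrite ?distxx; lia.
rewrite addnS => duv; have [w dw ew] := dist_pred duv.
have [x dx dxw] := IH w dw; exists x => //.
move: ew; rewrite edge_dist => /eqP ewv.
by have := dist_triangle w x v; have := dist_triangle x u v; lia.
Qed.

Lemma edge_neq u v : e u v -> u <> v.
Proof. by move=> euv uv; rewrite uv irr_e in euv. Qed.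

Lemma dist1P u v : d u v <= 1 -> u = v \/ e u v.
Proof.
rewrite edge_dist; case: (ltngtP (d u v) 1) => //; last by right.
by rewrite ltnS leqn0 dist_eq0 => /eqP; left.
Qed.

Lemma edge_dist_le u v w : e u v -> d u w <= (d v w).+1.
Proof. by rewrite edge_dist => /eqP; have := dist_triangle v u w; lia. Qed.

Lemma leq_ecc u v : d u v <= ecc e v.
Proof. exact: (leq_bigmax u (F := fun u => d u v)). Qed.

Lemma ecc_leP v k : reflect (forall u, d u v <= k) (ecc e v <= k).
Proof.
by apply: (iffP (bigmax_leqP _ _ _)) => [H u|H u _]; apply: H.
Qed.

(** Sending each vertex other than [r] to the edge towards a neighbour closer to [r] is injective:
    two vertices sharing that edge would each be closer to [r] than the other. *)
Lemma card_leq_nedges : #|T| <= (nedges e).+1.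
Proof.
case: (pickP (mem T)) => [r _|T0]; last by rewrite eq_card0.
pose par v := odflt v [pick w | (d r w).+1 == d r v & e w v].
have parP v : v != r -> (d r (par v)).+1 = d r v /\ e (par v) v.
  move=> vr; rewrite /par; case: pickP => [w /andP[/eqP]|] //.
  case dv: (d r v) => [|k]; first by move/eqP: dv; rewrite dist_eq0 eq_sym (negPf vr).
  by have [w dw ew] := dist_pred dv => /(_ w); rewrite dw eqxx ew.
rewrite -cardsT (cardsD1 r) inE add1n ltnS.
pose f v := [set par v; v].
rewrite -(card_in_imset (f := f)).
  apply/subset_leq_card/subsetP => _ /imsetP[v + ->].
  rewrite !inE andbT => /parP[_ ev]; apply/imsetP; exists (par v, v) => //.
  by rewrite inE.
move=> v w; rewrite !inE !andbT => /parP[dv _] /parP[dw _] /setP fvw.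
have /orP[/eqP wv|/eqP //] : (w == par v) || (w == v).
  by have := fvw w; rewrite !inE eqxx orbT.
have /orP[/eqP vw|/eqP //] : (v == par w) || (v == w).
  by have := fvw v; rewrite !inE eqxx orbT => <-.
by rewrite -wv in dv; rewrite -vw in dw; lia.
Qed.

Lemma card_arcs : #|[set p : T * T | e p.1 p.2]| <= 2 * nedges e.
Proof.
rewrite /nedges; set A := [set p | _]; pose f (p : T * T) := [set p.1; p.2].
rewrite -[f @: A]/(f @: A) -sum1_card (partition_big_imset f) /= mulnC -sum_nat_const.
apply: leq_sum => _ /imsetP[[a b] _ ->]; rewrite sum1_card.
apply: leq_trans (_ : #|[set (a, b); (b, a)]| <= _); last by rewrite cards2; case: (_ != _).
apply/subset_leq_card/subsetP => -[x y]; rewrite unfold_in /= => /andP[xyA /eqP/setP fE].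
have /= exy : e x y by move: xyA; rewrite inE.
have := fE a; have := fE b; have := fE x; have := fE y.
rewrite !inE !eqxx ?orbT /=.
have := edge_neq exy.
move=> xy /esym/orP[]/eqP ya /esym/orP[]/eqP xa; subst; rewrite ?eqxx ?orbT //.
Qed.

(** * Convexity of disks and absence of induced four-cycles *)

Hypothesis alpha1 : alpha1_metric e.
Hypothesis triangle : triangle_condition e.

Lemma alpha1_gluing u v w x : e v w -> d u w = (d u v).+1 -> d v x = (d w x).+1 ->
  d u v + d v x <= (d u x).+1.
Proof.
move=> evw uw vx; move: (evw); rewrite edge_dist => /eqP dvw.
have := @alpha1 u v w x; rewrite /in_interval dvw => H.
by have := H ltac:(lia) ltac:(lia) evw; lia.
Qed.

(** Follow the geodesic from [x]. If its first step [w] leaves the disk, then [d v x = k], and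
    gluing along the edge [x w] gives [k + d x y <= d v y + 1]. So [d x y <= 1] and [w = y], which
    is in the disk. *)
Lemma disk_convex k v x y z :
  d x z + d z y = d x y -> d v x <= k -> d v y <= k -> d v z <= k.
Proof.
move: {2}(d x z) (erefl (d x z)) => j; elim: j x => [|j IH] x dxz xzy vx vy.
  by move/eqP: dxz; rewrite dist_eq0 => /eqP <-.
have [w dxw dwz] : exists2 w, d x w = 1 & d w z + 1 = d x z.
  by apply: geodesic; rewrite dxz.
have exw : e x w by rewrite edge_dist dxw.
have dwy : d x y = (d w y).+1 by have := dist_triangle z w y; have := dist_triangle w x y; lia.
have wzy : d w z + d z y = d w y by lia.
have [vw|vw] := leqP (d v w) k; first by apply: IH vw vy; lia.
have vxw : d v w = (d v x).+1 by have := dist_triangle x v w; lia.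
have rise := alpha1_gluing exw vxw dwy.
have : d w y = 0 by lia.
by move/eqP; rewrite dist_eq0 => /eqP wy; rewrite -wy in vy; lia.
Qed.

Lemma mid_dist a b c : e a b -> e b c -> a <> c -> ~~ e a c -> d a c = 2.
Proof.
rewrite !edge_dist => /eqP ab /eqP bc ac; have := dist_triangle b a c.
have : d a c != 0 by rewrite dist_eq0; apply/eqP.
by lia.
Qed.

(** At distance 2, [p] and [q] would have [s] between them, and convexity would put [s] in the disk
    of radius [j] around [v]. *)
Lemma common_closer_nbr v j s p q :
  e s p -> e s q -> d v p <= j -> d v q <= j -> j < d v s -> d p q <= 1.
Proof.
rewrite !edge_dist => /eqP sp /eqP sq vp vq vs; rewrite leqNgt; apply/negP => pq.
have spq : d p s + d s q = d p q by have := dist_triangle s p q; rewrite (dist_sym p s); lia.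
by have := disk_convex spq vp vq; lia.
Qed.

(** If [b] and [x] are not adjacent, [c] lies between them, hence in the unit disk of [a], which is
    convex. *)
Lemma C4_chord a b c x : e a b -> e b c -> e c x -> e x a -> a <> c -> b <> x ->
  e a c \/ e b x.
Proof.
move=> ab bc cx xa ac bx; case bxE: (e b x); [by right | left].
have dbx : d b x = 2 by apply: (mid_dist bc cx bx); rewrite bxE.
move: ab bc cx xa; rewrite !edge_dist => /eqP ab /eqP bc /eqP cx /eqP xa.
have bcx : d b c + d c x = d b x by lia.
have := @disk_convex 1 a b x c bcx ltac:(lia) ltac:(rewrite dist_sym; lia).
by move/(dist1P) => [] // ; rewrite edge_dist => /eqP ->.
Qed.

(** * Gates of cliques *)

Definition clique (K : {set T}) := forall u w, u \in K -> w \in K -> d u w <= 1.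

Lemma cliqueP K u w : clique K -> u \in K -> w \in K -> u <> w -> e u w.
Proof. by move=> clK uK wK uw; case: (dist1P (clK _ _ uK wK)). Qed.

(** Among the vertices at distance [j] from [z], take [g] adjacent to the most members of [K]. If
    [g] misses [s], the triangle condition for [s] and a neighbour [s1] of [g] gives [g'] adjacent
    to both. By maximality [g'] misses some neighbour [s2] of [g], and then [g], [g'], [s], [s2]
    form an induced four-cycle. *)
Lemma clique_gate K z j : clique K -> K != set0 -> (forall s, s \in K -> d z s = j.+1) ->
  exists2 g, d z g = j & forall s, s \in K -> e g s.
Proof.
move=> clK /set0Pn[s0 s0K] dK.
pose deg g := #|[set s in K | e g s]|.
have [g0 dg0 eg0] := dist_pred (dK _ s0K).
case: (@arg_maxnP _ g0 (fun g => d z g == j) deg); first by rewrite dg0.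
move=> g /eqP dg gmax; exists g => // s sK; apply: contraT => ngs.
have [s1 s1K gs1] : exists2 s1, s1 \in K & e g s1.
  have : 0 < deg g.
    by apply: leq_trans (gmax g0 _); rewrite ?dg0 // card_gt0; apply/set0Pn; exists s0; rewrite inE s0K.
  by rewrite card_gt0 => /set0Pn[s1]; rewrite inE => /andP[]; exists s1.
have ss1 : e s s1 by apply: (cliqueP clK) => // ss1; rewrite ss1 gs1 in ngs.
have dss1 : d s z = d s1 z by rewrite !(dist_sym _ z) !dK.
have [g' [sg' s1g' dg']] := triangle ss1 dss1.
have {}dg' : d z g' = j by move: dg'; rewrite dist_sym [d s z]dist_sym (dK _ sK) => -[].
have /existsP[s2 /and3P[s2K gs2 ng's2]] : [exists s2, [&& s2 \in K, e g s2 & ~~ e g' s2]].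
  apply: contraT => /existsPn none; have : deg g < deg g'.
    apply/proper_card/properP; split.
      apply/subsetP => s2; rewrite !inE => /andP[s2K gs2]; rewrite s2K.
      by have := none s2; rewrite s2K gs2 /= negbK.
    by exists s; rewrite !inE sK ?(negPf ngs) // sym_e.
  by rewrite ltnNge => /negP; case; apply: gmax; rewrite dg'.
have s12 : e s s2 by apply: (cliqueP clK) => // ss2; rewrite ss2 gs2 in ngs.
have gg' : e g g'.
  have : d g g' <= 1.
    apply: (@common_closer_nbr z j s1); rewrite ?dg ?dg' ?(dK _ s1K) //.
    by rewrite sym_e.
  by case/dist1P => // gE; rewrite gE sym_e sg' in ngs.
case: (@C4_chord g g' s s2); rewrite ?(negPf ngs) ?(negPf ng's2) //.
- by rewrite sym_e.
- by rewrite sym_e.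
- by move=> gs; have := dK _ sK; rewrite -gs dg => /n_Sn.
- by move=> gs; have := dK _ s2K; rewrite -gs dg' => /n_Sn.
Qed.

Lemma edge_dist1 u v : e u v -> d u v = 1.
Proof. by rewrite edge_dist => /eqP. Qed.

(** * Slices of intervals: convexity, diameter, dominating vertex *)

Definition slice x y i j : {set T} := [set a | (d x a == i) && (d y a == j)].

Lemma slice_below x y i j a b t : i + j = d x y -> a \in slice x y i j ->
  b \in slice x y i j -> d a t + d t b = d a b -> i <= d x t.
Proof.
move=> ij; rewrite !inE => /andP[/eqP xa /eqP ya] /andP[/eqP xb /eqP yb] atb.
have := disk_convex (v := y) atb (k := j); rewrite ya yb leqnn => /(_ isT isT).
by have := dist_triangle t x y; rewrite (dist_sym y t); dlia.
Qed.

Lemma slice_convex x y i j a b t : i + j = d x y -> a \in slice x y i j ->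
  b \in slice x y i j -> d a t + d t b = d a b -> t \in slice x y i j.
Proof.
move=> ij aS bS atb; have xt := slice_below ij aS bS atb.
move: aS bS; rewrite !inE => /andP[/eqP xa /eqP ya] /andP[/eqP xb /eqP yb].
have := disk_convex (v := y) atb (k := j); rewrite ya yb leqnn => /(_ isT isT) yt.
have := disk_convex (v := x) atb (k := i); rewrite xa xb leqnn => /(_ isT isT) xt'.
by have := dist_triangle t x y; rewrite (dist_sym t y); dlia.
Qed.

(* If [a], [b], [c], [f] is a geodesic inside a slice, then climbing two levels
   towards [x] from each end makes the two shortest paths meet along an edge,
   which forces [d a f >= 4]. *)
Lemma slice_no_P4 x y i j a b c f : i + j = d x y ->
  a \in slice x y i j -> b \in slice x y i j -> c \in slice x y i j ->
  f \in slice x y i j -> e a b -> e b c -> e c f -> d a f <> 3.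
Proof.
move=> ij aS bS cS fS ab bc cf af.
have Sx t : t \in slice x y i j -> d x t = i by rewrite inE => /andP[/eqP].
have Sy t : t \in slice x y i j -> d y t = j by rewrite inE => /andP[_ /eqP].
have [[dab dbc] dcf] := (edge_dist1 ab, edge_dist1 bc, edge_dist1 cf).
have dac : d a c = 2.
  by have := dist_triangle c a f; have := dist_triangle b a c; dlia.
have dbf : d b f = 2.
  by have := dist_triangle b a f; have := dist_triangle c b f; dlia.
have up s t : s \in slice x y i j -> t \in slice x y i j -> e s t ->
    exists p, [/\ e p s, e p t, (d x p).+1 = i & d y p <= j.+1].
  move=> sS tS st; have [|p [sp tp dp]] := triangle (w := x) st.
    by rewrite !(dist_sym _ x) !Sx.
  exists p; rewrite (sym_e p s) (sym_e p t); split => //.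
    by rewrite dist_sym dp dist_sym Sx.
  by have := dist_triangle s y p; rewrite (Sy s sS) (edge_dist1 sp) addn1.
(* [p], [q], [o] are apexes over the three edges, one level closer to [x]; [p1] and [p2] are apexes
   over [p q] and [q o], two levels closer. *)
have [p [pa pb xp yp]] := up a b aS bS ab.
have [q [qb qc xq yq]] := up b c bS cS bc.
have [o [oc of' xo yo]] := up c f cS fS cf.
have below s t r : s \in slice x y i j -> t \in slice x y i j -> (d x r).+1 = i ->
    d s r + d r t <> d s t.
  by move=> sS tS xr srt; have := slice_below ij sS tS srt; dlia.
have npc : ~~ e p c.
  apply/negP => pc; apply: (below a c p) => //.
  by rewrite dist_sym (edge_dist1 pa) (edge_dist1 pc).
have nob : ~~ e o b.
  apply/negP => ob; apply: (below b f o) => //.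
  by rewrite dist_sym (edge_dist1 ob) (edge_dist1 of').
have pq : e p q.
  have : d p q <= 1.
    apply: (@common_closer_nbr x i.-1 b); rewrite 1?sym_e ?(Sx b bS) //; dlia.
  by case/dist1P => // pq; rewrite pq qc in npc.
have qo : e q o.
  have : d q o <= 1.
    apply: (@common_closer_nbr x i.-1 c); rewrite 1?sym_e ?(Sx c cS) //; dlia.
  by case/dist1P => // qo; rewrite -qo qb in nob.
have [dpa dof] := (edge_dist1 pa, edge_dist1 of').
have dpo : d p o = 2.
  apply: (mid_dist pq qo) => [po|]; first by rewrite po oc in npc.
  apply/negP => po; have := below a f p aS fS xp; rewrite (dist_sym a p) dpa.
  have := dist_triangle o p f; rewrite (edge_dist1 po).
  by have := dist_triangle p a f; rewrite (dist_sym a p); dlia.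
have [p1 [pp1 qp1 xp1]] : exists r, [/\ e p r, e q r & (d r x).+1 = d p x].
  by apply: triangle => //; rewrite !(dist_sym _ x); dlia.
have [p2 [qp2 op2 xp2]] : exists r, [/\ e q r, e o r & (d r x).+1 = d q x].
  by apply: triangle => //; rewrite !(dist_sym _ x); dlia.
rewrite !(dist_sym _ x) in xp1 xp2.
(* The disk of radius [j + 1] around [y] contains [p] and [o] but neither [p1] nor [p2]. *)
have far r : (d x r).+2 = i -> j.+2 <= d y r.
  by move=> xr; have := dist_triangle r x y; rewrite (dist_sym r y); dlia.
have np1o : ~~ e p1 o.
  apply/negP => p1o; have := far p1 ltac:(dlia).
  have : d p p1 + d p1 o = d p o by rewrite (edge_dist1 pp1) (edge_dist1 p1o).
  by move/disk_convex => /(_ j.+1 y yp yo); dlia.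
have np2p : ~~ e p2 p.
  apply/negP => p2p; have := far p2 ltac:(dlia).
  have : d p p2 + d p2 o = d p o by rewrite (dist_sym p p2) (edge_dist1 p2p) (dist_sym p2 o) (edge_dist1 op2).
  by move/disk_convex => /(_ j.+1 y yp yo); dlia.
have p12 : e p1 p2.
  have : d p1 p2 <= 1 by apply: (@common_closer_nbr x i.-2 q) => //; dlia.
  by case/dist1P => // p12; rewrite p12 sym_e op2 in np1o.
(* A vertex two levels up that is at distance 2 from one end would provide a
   shortcut of length at most 3 through the previous level. *)
have shortcut s t r z : s \in slice x y i j -> t \in slice x y i j -> d s t = 3 ->
    (d x r).+1 = i -> d y r <= j.+1 -> e r t -> e r z -> (d x z).+2 = i -> d s z <> 2.
  move=> sS tS st xr yr rt rz xz sz.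
  have [m sm mz] : exists2 m, d s m = 1 & d m z + 1 = d s z by apply: geodesic; rewrite sz.
  have xm : (d x m).+1 = i.
    have := dist_triangle m x z; have := dist_triangle z x m.
    have := dist_triangle m x s; rewrite (dist_sym m s) (dist_sym z m) (Sx s sS).
    have := dist_triangle s x m; rewrite (Sx s sS); dlia.
  have ym : d y m <= j.+1 by have := dist_triangle s y m; rewrite (Sy s sS); dlia.
  have : d m r <= 1.
    apply: (@common_closer_nbr y j.+1 z) => //; last exact: far.
      by rewrite sym_e edge_dist; apply/eqP; dlia.
    by rewrite sym_e.
  have := below s t m sS tS xm; have := dist_triangle m s t.
  by have := dist_triangle r m t; rewrite (edge_dist1 rt); dlia.
have dfa : d f a = 3 by rewrite dist_sym.
have ap2 : d a p2 = 3.
  have := shortcut a f o p2 aS fS af xo yo of' op2 ltac:(dlia).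
  have := dist_triangle p2 x a; rewrite (Sx a aS) (dist_sym p2 a).
  have := dist_triangle p a p2; rewrite (dist_sym a p) dpa.
  by have := dist_triangle p1 p p2; rewrite (edge_dist1 pp1) (edge_dist1 p12); dlia.
have fp1 : d f p1 = 3.
  have := shortcut f a p p1 fS aS dfa xp yp pa pp1 ltac:(dlia).
  have := dist_triangle p1 x f; rewrite (Sx f fS) (dist_sym p1 f).
  have := dist_triangle o f p1; rewrite (dist_sym f o) dof.
  have := dist_triangle p2 o p1; rewrite (edge_dist1 op2) (dist_sym p2) (edge_dist1 p12).
  by dlia.
have ap1 : d a p1 = 2.
  have := dist_triangle p1 a p2; rewrite (edge_dist1 p12) ap2.
  by have := dist_triangle p a p1; rewrite (dist_sym a p) dpa (edge_dist1 pp1); dlia.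
have p2f : d p2 f = 2.
  have := dist_triangle p2 f p1; rewrite (dist_sym p2 p1) (edge_dist1 p12) fp1.
  rewrite (dist_sym p2 f).
  by have := dist_triangle o f p2; rewrite (dist_sym f o) dof (edge_dist1 op2); dlia.
(* Gluing along [p1 p2] would give [2 + 3 <= d a f + 1 = 4]. *)
have := @alpha1_gluing a p1 p2 f p12 ltac:(dlia) ltac:(rewrite dist_sym; dlia).
by rewrite (dist_sym p1) ap1 fp1 af.
Qed.

(** By convexity, two vertices farther apart would put the first four vertices of a geodesic into
    the slice. *)
Lemma slice_diam x y i j a b : i + j = d x y ->
  a \in slice x y i j -> b \in slice x y i j -> d a b <= 2.
Proof.
move=> ij aS bS; rewrite leqNgt; apply/negP => ab.
have [f af fb] : exists2 f, d a f = 3 & d f b + 3 = d a b by apply: geodesic.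
have fS : f \in slice x y i j by apply: (slice_convex ij aS bS); dlia.
have [c ac cf] : exists2 c, d a c = 2 & d c f + 2 = d a f by apply: geodesic; rewrite af.
have cS : c \in slice x y i j by apply: (slice_convex ij aS fS); dlia.
have [t at' tc] : exists2 t, d a t = 1 & d t c + 1 = d a c by apply: geodesic; rewrite ac.
have tS : t \in slice x y i j by apply: (slice_convex ij aS cS); dlia.
by apply: (slice_no_P4 ij aS tS cS fS _ _ _ af); rewrite edge_dist; apply/eqP; dlia.
Qed.

(** Without such a [g], every neighbour of [s] in [S] other than [h] is a neighbour of [h], and [h]
    also sees [s] and [t], so its degree would be larger. *)
Lemma max_degree_nbr (S : {set T}) s h t : s \in S -> h \in S -> t \in S ->
  #|[set w in S | e h w]| <= #|[set w in S | e s w]| ->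
  e s h -> e h t -> ~~ e s t -> s != t ->
  exists g, [/\ g \in S, e s g, g != h & ~~ e h g].
Proof.
move=> sS hS tS deg sh ht nst st.
have /existsP[g /and4P[gS sg gh ng]] : [exists g, [&& g \in S, e s g, g != h & ~~ e h g]].
  apply: contraT => /existsPn none; move: deg; rewrite leqNgt => /negP[].
  rewrite [X in _ < X](cardsD1 t) inE tS ht add1n ltnS.
  rewrite (cardsD1 h) inE hS sh add1n [X in _ < X](cardsD1 s) !inE sS (sym_e h) sh st add1n ltnS.
  apply/subset_leq_card/subsetP => g; rewrite !inE.
  case/and3P=> gh gS sg; have := none g.
  rewrite gS sg gh /= negbK => ->; rewrite andbT /=; apply/andP; split.
    by apply: contraTneq sg => ->; rewrite irr_e.
  by apply: contraNneq nst => <-.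
by exists g.
Qed.

(** For [t] at distance 2 from [s], a common neighbour [h], the vertex [g] of [max_degree_nbr] and a
    common neighbour [h'] of [s], [g], [t] yield two triangles, [t h h'] and [s g h']. Their gates
    [p] and [q], one level closer to [x], are adjacent because both are below [h'], and convexity of
    the slice forbids the edges [p s] and [q h]: the cycle [p q s h] is induced. *)
Lemma slice_universal x y i j s : i + j = d x y -> s \in slice x y i j ->
  (forall t, t \in slice x y i j ->
    #|[set w in slice x y i j | e t w]| <= #|[set w in slice x y i j | e s w]|) ->
  forall t, t \in slice x y i j -> d s t <= 1.
Proof.
move=> ij sS smax t tS; rewrite leqNgt; apply/negP => st1.
have Sx u : u \in slice x y i j -> d x u = i by rewrite inE => /andP[/eqP].
have st : d s t = 2 by have := slice_diam ij sS tS; dlia.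
have nst : ~~ e s t by rewrite edge_dist st.
have [h sh ht] : exists2 h, d s h = 1 & d h t + 1 = d s t by apply: geodesic; rewrite st.
have hS : h \in slice x y i j by apply: (slice_convex ij sS tS); dlia.
have {}sh : e s h by rewrite edge_dist sh.
have {}ht : e h t by rewrite edge_dist; apply/eqP; dlia.
have [g [gS sg gh ng]] := max_degree_nbr sS hS tS (smax h hS) sh ht nst
  ltac:(by apply/eqP => stE; rewrite stE distxx in st).
have ngt : ~~ e g t.
  apply/negP => gt; case: (@C4_chord g s h t); rewrite ?(sym_e g s) ?(sym_e t g) //.
  - by apply/eqP.
  - by move=> sE; rewrite sE distxx in st.
  - by rewrite sym_e (negPf ng).
  - by rewrite (negPf nst).
have gt : d g t = 2.
  have := slice_diam ij gS tS; have : d g t != 1 by rewrite -edge_dist.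
  have : d g t != 0 by rewrite dist_eq0; apply: contraNneq nst => <-.
  by dlia.
have [h' [sh' gh' h't]] := triangle sg (etrans st (esym gt)).
have {}h't : e h' t by rewrite edge_dist; apply/eqP; move: h't; rewrite st => -[].
have hh' : e h h'.
  case: (@C4_chord s h t h'); rewrite ?(sym_e h' s) ?(sym_e t h') //.
  - by move=> sE; rewrite sE distxx in st.
  - by move=> hE; rewrite hE sym_e gh' in ng.
  - by rewrite (negPf nst).
have h'S : h' \in slice x y i j.
  by apply: (slice_convex ij sS tS); rewrite (edge_dist1 sh') (edge_dist1 h't).
(* At level 0 there is nothing closer to [x], but there the slice has at most the one vertex [x]. *)
case: i ij sS smax tS Sx hS gS h'S => [|i] ij sS smax tS Sx hS gS h'S.
  move/eqP: (Sx s sS); move/eqP: (Sx t tS); rewrite !dist_eq0 => /eqP xt /eqP xs.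
  by rewrite -xs -xt distxx in st.
have tri a b c : a \in slice x y i.+1 j -> b \in slice x y i.+1 j ->
    c \in slice x y i.+1 j -> e a b -> e a c -> e b c ->
    exists2 p, d x p = i & [/\ e p a, e p b & e p c].
  move=> aS bS cS ab ac bc; case: (@clique_gate [set a; b; c] x i).
  - by move=> u w; rewrite !inE -!orbA => /or3P[]/eqP-> /or3P[]/eqP->;
      rewrite ?distxx // 1?dist_sym edge_dist1 // 1?sym_e.
  - by apply/set0Pn; exists a; rewrite !inE eqxx.
  - by move=> u; rewrite !inE -orbA => /or3P[]/eqP->; rewrite Sx.
  - move=> p xp pK; exists p => //.
    by split; apply: pK; rewrite !inE eqxx ?orbT.
have [p xp [pt ph ph']] := tri t h h' tS hS h'S
  ltac:(by rewrite sym_e) ltac:(by rewrite sym_e) hh'.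
have [q xq [qs qg qh']] := tri s g h' sS gS h'S sg sh' gh'.
have below a b r : a \in slice x y i.+1 j -> b \in slice x y i.+1 j -> d x r = i ->
    e r a -> e r b -> d a b <> 2.
  move=> aS bS xr ra rb ab.
  have := @slice_below x y i.+1 j a b r ij aS bS.
  by rewrite dist_sym (edge_dist1 ra) (edge_dist1 rb) ab xr ltnn => /(_ erefl).
have nps : ~~ e p s by apply/negP => ps; exact: (below s t p).
have nqh : ~~ e q h.
  apply/negP => qh; apply: (below g h q) => //.
  by apply: (@mid_dist g s h); rewrite ?(sym_e g) //; apply/eqP.
have pq : e p q.
  have : d p q <= 1.
    by apply: (@common_closer_nbr x i h'); rewrite 1?sym_e ?xp ?xq ?(Sx h').
  by case/dist1P => // pq; rewrite pq qs in nps.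
case: (@C4_chord p q s h); rewrite ?(sym_e h p) ?(negPf nps) ?(negPf nqh) //.
- by move=> ps; have := Sx s sS; rewrite -ps xp => /n_Sn.
- by move=> qh; have := Sx h hS; rewrite -qh xq => /n_Sn.
Qed.

(** * Distance to a clique, projections and their gates *)

Definition setdist (K : {set T}) z :=
  d (odflt z [pick u in K | [forall w in K, d u z <= d w z]]) z.

Lemma setdistP (K : {set T}) z : K != set0 ->
  (exists2 u, u \in K & setdist K z = d u z) /\ forall u, u \in K -> setdist K z <= d u z.
Proof.
move=> /set0Pn[u0 u0K]; rewrite /setdist; case: pickP => [u /andP[uK /forall_inP umin] | /=].
  by split; [exists u | move=> w /umin].
have [u uK umin] := @arg_minnP _ u0 [in K] (fun u => d u z) u0K.
by move=> /(_ u) /negbT; rewrite negb_and uK /= => /negP[]; apply/forall_inP.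
Qed.

(** All that breadth-first search needs to know about the function it computes. One search procedure
    thus serves both for [d x], from a single vertex, and for [setdist K]. *)
Definition layering (K : {set T}) (f : T -> nat) :=
  [/\ forall w, (f w == 0) = (w \in K), forall u w, e u w -> f w <= (f u).+1 &
      forall w k, f w = k.+1 -> exists2 u, e u w & f u = k].

Lemma setdist_layering K : K != set0 -> layering K (setdist K).
Proof.
move=> K0; split=> [w|u w uw|w k wk].
- have [[u uK dw] min] := setdistP w K0; apply/eqP/idP => [w0|wK].
    by move/eqP: dw; rewrite w0 eq_sym dist_eq0 => /eqP <-.
  by have := min w wK; rewrite distxx; dlia.
- have [[x xK ux] _] := setdistP u K0; have [_ min] := setdistP w K0.
  have := min x xK; have := dist_triangle u x w; rewrite (edge_dist1 uw); dlia.
- have [[x xK dw] _] := setdistP w K0; rewrite wk in dw.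
  have [u xu uw] := dist_pred (esym dw); exists u => //.
  have [_ minu] := setdistP u K0; have [[y yK yu] _] := setdistP u K0.
  have [_ /(_ y yK)] := setdistP w K0; have := minu x xK.
  by have := dist_triangle u y w; rewrite (edge_dist1 uw); dlia.
Qed.

Lemma clique_setdist K u z : clique K -> u \in K -> setdist K z <= d u z <= (setdist K z).+1.
Proof.
move=> clK uK; have [|[w wK dw] min] := @setdistP K z; first by apply/set0Pn; exists u.
by rewrite min // dw; have := dist_triangle w u z; have := clK _ _ uK wK; dlia.
Qed.

(* The projection of [z] on [K] contains those of its parents, and by
   [clique_gate] equals one of them. *)
Lemma parent_gate K G z p : clique K -> K != set0 -> 1 < setdist K z ->
  (forall w, e w z -> setdist K z = (setdist K w).+1 ->
     forall u, u \in K -> e u (G w) = (d u w == setdist K w)) ->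
  e p z -> setdist K z = (setdist K p).+1 ->
  (forall w, e w z -> setdist K z = (setdist K w).+1 ->
     #|[set u in K | e (G w) u]| <= #|[set u in K | e (G p) u]|) ->
  forall u, u \in K -> e u (G p) = (d u z == setdist K z).
Proof.
move=> clK K0 z1 gateG pz zp pmax.
pose Pr w := [set u in K | d u w == setdist K w].
have PrG w : e w z -> setdist K z = (setdist K w).+1 -> [set u in K | e (G w) u] = Pr w.
  by move=> wz zw; apply/setP => u; rewrite !inE; case uK: (u \in K); rewrite //= sym_e gateG.
have sub w : e w z -> setdist K z = (setdist K w).+1 -> Pr w \subset Pr z.
  move=> wz zw; apply/subsetP => u; rewrite !inE => /andP[uK /eqP uw]; rewrite uK /=.
  have /andP[le _] := clique_setdist z clK uK; rewrite eqn_leq le andbT.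
  by have := dist_triangle w u z; rewrite (edge_dist1 wz); dlia.
(* Take a common gate [g] of the projection of [z] and let [w] be the first step from [z] to [g].
   Going through [g], it is one step closer than [z] to the whole projection. *)
have [w [wz zw Pw]] : exists w, [/\ e w z, setdist K z = (setdist K w).+1 & Pr w = Pr z].
  have zE : setdist K z = (setdist K z).-1.+1 by dlia.
  have [||s|g zg gK] := @clique_gate (Pr z) z (setdist K z).-1.
  - by move=> u w; rewrite !inE => /andP[uK _] /andP[wK _]; apply: clK.
  - have [[u uK du] _] := setdistP z K0.
    by apply/set0Pn; exists u; rewrite inE uK du eqxx.
  - by rewrite inE => /andP[_ /eqP]; rewrite dist_sym -zE.
  have [w zw wg] : exists2 w, d z w = 1 & d w g + 1 = d z g by apply: geodesic; dlia.
  have wz : e w z by rewrite sym_e edge_dist zw.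
  have Prw u : u \in Pr z -> d u w <= (setdist K z).-1.
    move=> /gK; rewrite sym_e => /edge_dist1 ug; have := dist_triangle g u w.
    by rewrite (dist_sym g w); dlia.
  have zlew : setdist K z <= (setdist K w).+1.
    have [[u uK ->] _] := setdistP w K0; have [_ min] := setdistP z K0.
    by have := min u uK; have := dist_triangle w u z; rewrite (dist_sym w z); dlia.
  have [[u0 u0K du0] _] := setdistP z K0.
  have u0z : u0 \in Pr z by rewrite inE u0K du0 eqxx.
  have wlez := Prw _ u0z; have [_ min] := setdistP w K0.
  have zwE : setdist K z = (setdist K w).+1 by have := min u0 u0K; dlia.
  exists w; split => //; apply/eqP; rewrite eqEsubset sub //=; apply/subsetP => u uz.
  have uK : u \in K by move: uz; rewrite inE => /andP[].
  rewrite inE uK eqn_leq min //= andbT; apply: leq_trans (Prw u uz) _.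
  by rewrite zwE.
have PzP : Pr p = Pr z.
  apply/eqP; rewrite eqEcard sub //= -Pw -!PrG //; exact: pmax.
move=> u uK; rewrite (gateG p pz zp u uK).
by move/setP/(_ u): PzP; rewrite !inE uK.
Qed.

(** * One descent: the neighbour of maximal coverage *)

Section Improve.
Variables (v f : T) (k : nat).
Hypotheses (vf : d v f = k) (eccv : ecc e v = k) (k_gt1 : 1 < k).
Let K := [set u | e v u && ((d u f).+1 == k)].

Lemma closer_clique : clique K.
Proof.
move=> u w; rewrite !inE => /andP[vu /eqP uf] /andP[vw /eqP wf].
by apply: (@common_closer_nbr f k.-1 v) => //; rewrite dist_sym; dlia.
Qed.

(** Members of a clique see [z] at distance [setdist K z] or one more. Hence they can differ on
    whether [z] is within [k - 1] only when [setdist K z] is [k - 1], and only such [z] are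
    counted. *)
Definition coverage u := #|[set z | (setdist K z == k.-1) && (d u z == k.-1)]|.

(** Otherwise everything covered by [u] would be covered by [w], which also covers [z], against
    maximality. *)
Lemma coverage_max u z : u \in K -> (forall w, w \in K -> coverage w <= coverage u) ->
  k <= d u z -> forall w, w \in K -> d w z < k ->
  exists z', d u z' < k /\ k <= d w z'.
Proof.
move=> uK umax uz w wK wz.
have far x y : x \in K -> k.-1 < setdist K y -> k <= d x y.
  by move=> xK; have /andP[le _] := clique_setdist y closer_clique xK; dlia.
have near x y : x \in K -> setdist K y < k.-1 -> d x y < k.
  by move=> xK; have /andP[_ le] := clique_setdist y closer_clique xK; dlia.
have zE : setdist K z = k.-1.
  apply/eqP; rewrite eqn_leq; apply/andP; split; rewrite leqNgt; apply/negP => lt.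
    by have := far w z wK lt; rewrite leqNgt wz.
  by have := near u z uK lt; rewrite ltnNge uz.
have cov x y : x \in K -> setdist K y = k.-1 -> (d x y == k.-1) = (d x y < k).
  move=> xK yE; have /andP[le _] := clique_setdist y closer_clique xK.
  by apply/idP/idP; dlia.
have /existsP[z' /and3P[/eqP zE' uz' wz']] :
    [exists z', [&& setdist K z' == k.-1, d u z' == k.-1 & d w z' != k.-1]].
  apply: contraT => /existsPn none; have := umax w wK.
  rewrite leqNgt => /negP[]; apply/proper_card/properP; split.
    apply/subsetP => y; rewrite !inE => /andP[yE uy]; have := none y.
    by rewrite yE uy /= negbK.
  exists z; rewrite !inE zE eqxx /= cov //.
  by rewrite -leqNgt.
exists z'; rewrite -(cov u) // uz'; split => //.
by rewrite cov // -leqNgt in wz'.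
Qed.

(** A better neighbour [w] must approach [f], so it lies in [K]. As it misses nothing, a vertex
    missed by [u] would contradict [coverage_max]. *)
Lemma improve_ecc u w : u \in K -> (forall w, w \in K -> coverage w <= coverage u) ->
  e v w -> ecc e w < k -> ecc e u < k.
Proof.
move=> uK umax vw wk.
have wlt z : d w z < k by apply: leq_ltn_trans wk; rewrite dist_sym leq_ecc.
have wK : w \in K.
  have := edge_dist_le f vw; have := wlt f; rewrite inE vw vf /=; dlia.
suff : ecc e u <= k.-1 by dlia.
apply/ecc_leP => z; rewrite dist_sym leqNgt; apply/negP => uz.
have [|z' [_ wz']] := coverage_max uK umax (z := z) _ wK (wlt z); first by dlia.
by have := wlt z'; rewrite ltnNge wz'.
Qed.

(** In each case gluing along an edge at [u] loses only 1. If [u] is farther from [z] than [v], glue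
    along [v u] towards [f]. If not, the triangle condition gives [w] closer to [z]: glue along
    [w u] towards [f] when [w] is outside [K], and otherwise towards the vertex [z'] that [u] covers
    and [w] does not. *)
Lemma improve_far u z : u \in K -> (forall w, w \in K -> coverage w <= coverage u) ->
  k <= d u z -> exists y, (2 * k).-2 <= d z y.
Proof.
move=> uK umax uz; have := uK; rewrite inE => /andP[vu /eqP uf].
have vz : d v z <= k by rewrite -eccv dist_sym leq_ecc.
have duv := edge_dist1 vu.
have uzv : d u z <= (d v z).+1 by have := dist_triangle v u z; rewrite (dist_sym u v); dlia.
have [uz1|uz1] := eqVneq (d u z) (d v z).+1.
  exists f; have := @alpha1_gluing z v u f vu ltac:(by rewrite !(dist_sym z)) ltac:(by rewrite vf uf).
  by rewrite (dist_sym z v); dlia.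
have [uzE vzE] : d u z = k /\ d v z = k by dlia.
have [w [vw uw wz]] := triangle vu (etrans vzE (esym uzE)).
have zuw : d z u = (d z w).+1 by rewrite !(dist_sym z) wz; dlia.
have wu : e w u by rewrite sym_e.
have [wk|wk] := eqVneq (d w f).+1 k.
  have wK : w \in K by rewrite inE vw wk eqxx.
  have [|z' [uz' wz']] := coverage_max uK umax uz wK; first by dlia.
  exists z'; have := @alpha1_gluing z w u z' wu zuw.
  have := dist_triangle u w z'; rewrite (edge_dist1 wu) (dist_sym z w).
  by move=> le /(_ ltac:(dlia)); dlia.
exists f; have := @alpha1_gluing z w u f wu zuw.
have := edge_dist_le f vw; have := dist_triangle u w f; rewrite (edge_dist1 wu) vf.
by rewrite (dist_sym z w) => le1 le2 /(_ ltac:(dlia)); dlia.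
Qed.

End Improve.

(** * Thin triangles and the double sweep *)

Lemma thin_triangle v x y m : d x m + d m y = d x y ->
  d v m + d x m <= d v x + 4 \/ d v m + d m y <= d v y + 4.
Proof.
move=> xmy; pose close := d v m + d x m <= d v x + 4 \/ d v m + d m y <= d v y + 4.
(* Walk from [m] towards [v]. A step either stays in the slice of [m] or moves away from [x] or [y];
   in the last case gluing along it bounds the detour through [p], at the cost of 1 plus the at most
   2 steps already made. *)
have step k p : 0 < k -> d v p = k -> d v m <= k.+2 ->
    p \in slice x y (d x m) (d y m) ->
    close \/ exists q, [/\ e p q, d v q = k.-1 & q \in slice x y (d x m) (d y m)].
  case: k => // k _ vp vm; rewrite inE => /andP[/eqP xp /eqP yp].
  have [q vq qp] := dist_pred vp; have pq : e p q by rewrite sym_e.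
  have vpq : d p v = (d q v).+1 by rewrite !(dist_sym _ v) vq.
  have rise w : d w q <= (d w p).+1.
    by have := dist_triangle p w q; rewrite (edge_dist1 pq); dlia.
  have [wx|wx] := eqVneq (d x q) (d x p).+1.
    left; left; have := alpha1_gluing pq wx vpq.
    by rewrite xp (dist_sym p) vp (dist_sym x v); dlia.
  have [wy|wy] := eqVneq (d y q) (d y p).+1.
    left; right; have := alpha1_gluing pq wy vpq.
    by rewrite yp (dist_sym p) vp (dist_sym y v) (dist_sym y m); dlia.
  right; exists q; split => //; rewrite inE.
  have := rise x; have := rise y; have := dist_triangle q x y.
  by rewrite (dist_sym q y) -xmy (dist_sym m y); dlia.
have mS : m \in slice x y (d x m) (d y m) by rewrite inE !eqxx.
have [small|big] := leqP (d v m) 2.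
  left; have := dist_triangle v x m; rewrite (dist_sym x v); dlia.
(* Three steps inside the slice would end at distance 3 from [m], but the slice has diameter at most
   2. *)
have [//|[p [mp vp pS]]] := step (d v m) m ltac:(dlia) erefl ltac:(dlia) mS.
have [//|[q [pq vq qS]]] := step (d v m).-1 p ltac:(dlia) vp ltac:(dlia) pS.
have [//|[r [qr vr rS]]] := step (d v m).-2 q ltac:(dlia) vq ltac:(dlia) qS.
have := @slice_diam x y (d x m) (d y m) m r; rewrite (dist_sym y m) => /(_ xmy).
rewrite (dist_sym m y) mS rS => /(_ isT isT).
have := dist_triangle r v m; rewrite (dist_sym r m); dlia.
Qed.

(** The distance [d b y] is at most twice any eccentricity. The remaining slack is 9, from the bound
    on the distances to [y], plus 4 from the thin triangle [z], [b], [y]. *)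
Lemma double_sweep a b y m c : (forall z, d a z <= d a b) -> (forall z, d b z <= d b y) ->
  d b m + d m y = d b y -> d b m <= (d m y).+1 -> d m y <= (d b m).+1 ->
  ecc e m <= ecc e c + 13.
Proof.
move=> amax bmax bmy bm my.
have cy : d b y <= 2 * ecc e c.
  have := dist_triangle c b y; have := leq_ecc b c; have := leq_ecc y c.
  by rewrite (dist_sym y c); dlia.
(* With [t] in the middle of [z y], thinness seen from [a] and the choice of [b] give
   [d z t <= d t b + 4]; seen from [b], thinness gives [d t b + d z t <= d b y + 4]. Adding up and
   rounding gives 8 + 1. *)
have diam z : d z y <= d b y + 9.
  have [t zt tE] : exists2 t, d z t = (d z y)./2 & d t y + (d z y)./2 = d z y.
    by apply: geodesic; dlia.
  have zty : d z t + d t y = d z y by dlia.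
  have tb := thin_triangle b zty; have ta := thin_triangle a zty.
  have := dist_triangle t a b; rewrite (dist_sym t b).
  have := amax z; have := amax y; have := bmax z; dlia.
apply/ecc_leP => z; have := diam z; have := thin_triangle z bmy.
by have := bmax z; rewrite (dist_sym b z); dlia.
Qed.

(** * From a local minimum of the eccentricity to a central vertex *)

Definition closer v f := [set u | e v u && ((d u f).+1 == ecc e v)].

(** The contract of one descent. It is conditional because the coverage argument requires
    eccentricity above 1; at most 1, [v] is already central. *)
Definition improver v u := 1 < ecc e v -> exists f,
  [/\ d v f = ecc e v, u \in closer v f &
      forall w, w \in closer v f ->
        coverage v f (ecc e v) w <= coverage v f (ecc e v) u].

Definition stuck v := forall w, e v w -> ecc e v <= ecc e w.

Lemma central_of_ecc_le1 v : ecc e v <= 1 -> central e v.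
Proof.
move=> v1 w; rewrite leqNgt; apply/negP => wv.
have w0 x : x = w by apply/eqP; rewrite -dist_eq0 -leqn0; have := leq_ecc x w; dlia.
by rewrite (w0 v) ltnn in wv.
Qed.

Lemma improver_stuck v u : improver v u -> ecc e v <= ecc e u -> stuck v.
Proof.
move=> vu le_vu w vw; have [v1|v1] := leqP (ecc e v) 1; first exact: central_of_ecc_le1.
have [f [vf uK umax]] := vu v1; rewrite leqNgt; apply/negP => wv.
by have := improve_ecc vf erefl v1 uK umax vw wv; rewrite ltnNge le_vu.
Qed.

(** Membership of [s] in the slice is only assumed when the slice is nonempty: if [v] is central the
    slice may be empty, and the program then selects an arbitrary vertex. *)
Lemma final_stage v u z y s u2 : stuck v -> improver v u ->
  (forall w, d u w <= d u z) -> (forall w, d z w <= d z y) ->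
  (let S := slice z y (ecc e v).-1 (ecc e v).-1 in
   forall t, t \in S -> s \in S /\
     #|[set w in S | e t w]| <= #|[set w in S | e s w]|) ->
  improver s u2 ->
  [\/ central e v, central e s | central e u2].
Proof.
move=> vstuck vu uz zy smax su2.
have [c _ cmin] := @arg_minnP T v xpredT (ecc e) isT.
have [vc|cv] := leqP (ecc e v) (ecc e c).
  by apply: Or31 => w; apply: leq_trans vc (cmin w isT).
have k_gt1 : 1 < ecc e v.
  by rewrite ltnNge; apply/negP => /central_of_ecc_le1/(_ c); rewrite leqNgt cv.
have [f [vf uK umax]] := vu k_gt1.
have vu' : ecc e v <= d u z.
  have : ecc e u <= d u z by apply/ecc_leP => w; rewrite dist_sym.
  by apply/leq_trans/vstuck; move: uK; rewrite inE => /andP[].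
have [y' y'far] := improve_far vf erefl k_gt1 uK umax vu'.
have cdist w : d c w <= (ecc e v).-1 by rewrite dist_sym; have := leq_ecc w c; dlia.
(* [y'] gives the lower bound, and passing through [c], whose eccentricity is smaller, the upper
   one. Equality forces [c] into the slice, hence to within distance 1 of [s]. *)
have zy2 : d z y = (ecc e v).-1 + (ecc e v).-1.
  by have := zy y'; have := dist_triangle c z y; have := cdist z; have := cdist y;
    rewrite (dist_sym z c); dlia.
have cS : c \in slice z y (ecc e v).-1 (ecc e v).-1.
  have := cdist z; have := cdist y; have := dist_triangle c z y.
  by rewrite inE (dist_sym z c) (dist_sym y c); dlia.
have [sS _] := smax c cS.
have sc := slice_universal (esym zy2) sS (fun t tS => (smax t tS).2) cS.
have [sle|slt] := leqP (ecc e s) (ecc e c).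
  by apply: Or32 => w; apply: leq_trans sle (cmin w isT).
have sk : ecc e s = ecc e v.
  have : ecc e s <= ecc e v.
    apply/ecc_leP => w; have := dist_triangle c s w; have := cdist w.
    by rewrite (dist_sym w s); dlia.
  have : (ecc e v).-1 <= ecc e c.
    by have := leq_ecc z c; move: cS; rewrite inE => /andP[/eqP -> _].
  by dlia.
have esc : e s c by case/dist1P: sc => // sc; rewrite sc ltnn in slt.
have [g [sg u2K u2max]] := su2 ltac:(by rewrite sk).
have u2s := improve_ecc sg erefl ltac:(by rewrite sk) u2K u2max esc slt.
apply: Or33 => w; apply: leq_trans (cmin w isT).
have : (ecc e v).-1 <= ecc e c.
  by have := leq_ecc z c; move: cS; rewrite inE => /andP[/eqP -> _].
by dlia.
Qed.

End Distance.

(** * A structured language over the RAM *)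

Inductive expr : Type :=
| Var of nat
| Cst of nat
| Plus of expr & expr
| Minus of expr & expr
| Get of nat & expr.

Inductive cmd : Type :=
| Skip
| Let of nat & expr
| Put of nat & expr & expr
| Seq of cmd & cmd
| If of expr & cmd & cmd
| For of expr & cmd.

(** [time] counts executed commands and loop iterations. Evaluating an expression is not charged
    separately, since its compiled length is fixed by the program. *)
Record store := Store { vars : nat -> nat; arrs : nat -> nat -> nat; time : nat }.

Definition tick (s : store) := Store (vars s) (arrs s) (time s).+1.

Fixpoint eval (V : nat -> nat) (A : nat -> nat -> nat) (a : expr) : nat :=
  match a with
  | Var x => V x
  | Cst c => c
  | Plus a b => eval V A a + eval V A b
  | Minus a b => eval V A a - eval V A b
  | Get j a => A j (eval V A a)
  end.

Fixpoint sem (c : cmd) (s : store) : store :=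
  match c with
  | Skip => tick s
  | Let x a => Store (upd (vars s) x (eval (vars s) (arrs s) a)) (arrs s) (time s).+1
  | Put j a b =>
      Store (vars s)
        (fun j' =>
           if j' == j
           then upd (arrs s j) (eval (vars s) (arrs s) a) (eval (vars s) (arrs s) b)
           else arrs s j')
        (time s).+1
  | Seq c1 c2 => sem c2 (sem c1 s)
  | If a c1 c2 => if eval (vars s) (arrs s) a != 0 then sem c1 (tick s) else sem c2 (tick s)
  | For a c => iter (eval (vars s) (arrs s) a) (fun s => sem c (tick s)) (tick s)
  end.

Lemma iter_ind (A : Type) (I : nat -> A -> Prop) f n a :
  I 0 a -> (forall i b, i < n -> I i b -> I i.+1 (f b)) -> I n (iter n f a).
Proof.
move=> I0 IS; suff: forall i, i <= n -> I i (iter i f a) by exact.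
by elim=> [|i IH] //= lt; apply: IS => //; apply: IH; apply: ltnW.
Qed.

Lemma time_sem c s : time s <= time (sem c s).
Proof.
elim: c s => //= [c1 IH1 c2 IH2 s|a c1 IH1 c2 IH2 s|a c IH s].
- exact: leq_trans (IH1 s) (IH2 _).
- by case: ifP => _; apply: leq_trans (leqnSn _) _; [apply: IH1 (tick s) | apply: IH2 (tick s)].
- apply: (@iter_ind _ (fun _ s' => time s <= time s')) => [|i s' _ le]; first exact: leqnSn.
  exact: leq_trans (leq_trans le (leqnSn _)) (IH (tick s')).
Qed.

(* Memory map: cells 0..31 hold the variables, 32 the constant 0, 33 the base
   address B of the arrays, 34..37 the counters of the nested loops, 38..47 the
   temporaries; entry i of array j < 16 is cell B + 16 * i + j. *)
Definition zero_reg := 32.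
Definition base_reg := 33.
Definition loop_reg d := 34 + d.
Definition tmp t := 38 + t.
Definition nregs := 48.

(** Interleaving the arrays gives each of them unbounded length at a fixed offset. Without a
    multiplication instruction, the stride 16 is produced by sixteen additions. *)
Definition address j t :=
  [:: IConst (tmp t.+1) j; IAdd (tmp t.+1) (tmp t.+1) base_reg]
  ++ nseq 16 (IAdd (tmp t.+1) (tmp t.+1) (tmp t))
  ++ [:: IAdd (tmp t) (tmp t.+1) zero_reg].

Arguments address : simpl never.

Fixpoint compile_expr (a : expr) (t : nat) : seq instr :=
  match a with
  | Var x => [:: IAdd (tmp t) x zero_reg]
  | Cst c => [:: IConst (tmp t) c]
  | Plus a b => compile_expr a t ++ compile_expr b t.+1 ++ [:: IAdd (tmp t) (tmp t) (tmp t.+1)]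
  | Minus a b => compile_expr a t ++ compile_expr b t.+1 ++ [:: ISub (tmp t) (tmp t) (tmp t.+1)]
  | Get j a => compile_expr a t ++ address j t ++ [:: ILoad (tmp t) (tmp t)]
  end.

(** Jump targets are absolute, hence the start address [o]; [d] is the nesting depth of loops and
    selects the counter cell. [IJz zero_reg] is the unconditional jump. *)
Fixpoint compile (c : cmd) (d o : nat) : seq instr :=
  match c with
  | Skip => [::]
  | Let x a => compile_expr a 0 ++ [:: IAdd x (tmp 0) zero_reg]
  | Put j a b =>
      compile_expr a 0 ++ address j 0 ++ compile_expr b 1 ++ [:: IStore (tmp 0) (tmp 1)]
  | Seq c1 c2 => let l1 := compile c1 d o in l1 ++ compile c2 d (o + size l1)
  | If a c1 c2 =>
      let l0 := compile_expr a 0 in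
      let l1 := compile c1 d (o + size l0 + 1) in
      let o2 := o + size l0 + 1 + size l1 + 1 in
      let l2 := compile c2 d o2 in
      l0 ++ [:: IJz (tmp 0) o2] ++ l1 ++ [:: IJz zero_reg (o2 + size l2)] ++ l2
  | For a c =>
      let l0 := compile_expr a 0 in
      let o1 := o + size l0 + 1 in
      let l1 := compile c d.+1 (o1 + 1) in
      l0 ++ [:: IAdd (loop_reg d) (tmp 0) zero_reg]
      ++ [:: IJz (loop_reg d) (o1 + 1 + size l1 + 3)] ++ l1
      ++ [:: IConst (tmp 0) 1; ISub (loop_reg d) (loop_reg d) (tmp 0); IJz zero_reg o1]
  end.

(** [t < 9] keeps even the scratch cell [tmp t.+1] used by [address] below [nregs]. *)
Fixpoint wf_expr (a : expr) (t : nat) : bool :=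
  match a with
  | Var x => (x < 32) && (t < 9)
  | Cst _ => t < 9
  | Plus a b | Minus a b => wf_expr a t && wf_expr b t.+1
  | Get j a => (j < 16) && wf_expr a t && (t < 9)
  end.

Fixpoint wf_cmd (c : cmd) (d : nat) : bool :=
  match c with
  | Skip => true
  | Let x a => (x < 32) && wf_expr a 0
  | Put j a b => [&& j < 16, wf_expr a 0 & wf_expr b 1]
  | Seq c1 c2 => wf_cmd c1 d && wf_cmd c2 d
  | If a c1 c2 => [&& wf_expr a 0, wf_cmd c1 d & wf_cmd c2 d]
  | For a c => [&& d < 4, wf_expr a 0 & wf_cmd c d.+1]
  end.

(** * Correctness and cost of the compiled code *)

Definition straight (i : instr) :=
  match i with IJz _ _ | IHalt => false | _ => true end.

(** Each instruction runs as a one-line program at address 0, which removes the program counter from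
    reasoning about straight-line code. *)
Definition exec (l : seq instr) (M : nat -> nat) :=
  foldl (fun M i => (step [:: i] (0, M)).2) M l.

Arguments exec : simpl never.

Lemma exec_cons i l M : exec (i :: l) M = exec l (step [:: i] (0, M)).2.
Proof. by []. Qed.

Definition code_at (P : seq instr) o l :=
  forall i, i < size l -> nth IHalt P (o + i) = nth IHalt l i.

Lemma code_at_cat P o l1 l2 :
  code_at P o (l1 ++ l2) -> code_at P o l1 /\ code_at P (o + size l1) l2.
Proof.
move=> H; split=> i lt; first by rewrite H ?size_cat ?nth_cat ?lt // ltn_addr.
by rewrite -addnA H ?size_cat ?ltn_add2l // nth_cat ltnNge leq_addr addKn.
Qed.

Lemma code_at1 P o i l : code_at P o (i :: l) -> nth IHalt P o = i.
Proof. by move=> /(_ 0); rewrite addn0; exact. Qed.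

Lemma runD P j k s : run P (j + k) s = run P k (run P j s).
Proof. by rewrite /run addnC iterD. Qed.

Lemma exec_cat l1 l2 M : exec (l1 ++ l2) M = exec l2 (exec l1 M).
Proof. exact: foldl_cat. Qed.

Lemma run_straight P o l M : all straight l -> code_at P o l ->
  run P (size l) (o, M) = (o + size l, exec l M).
Proof.
elim: l o M => [|i l IH] o M; first by rewrite addn0.
case/andP=> si sl at_l; rewrite -[size (i :: l)]/((size l).+1) -add1n runD.
have -> : run P 1 (o, M) = (o.+1, (step [:: i] (0, M)).2).
  by rewrite /run /= (code_at1 at_l); case: i si {at_l}.
rewrite IH ?add1n ?addSnnS // => j lt.
by rewrite addSnnS -[RHS]/(nth IHalt (i :: l) j.+1) at_l.
Qed.

Definition represents B (s : store) (M : nat -> nat) :=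
  [/\ nregs <= B, forall x, x < 32 -> M x = vars s x, M zero_reg = 0, M base_reg = B &
      forall j i, j < 16 -> M (B + i * 16 + j) = arrs s j i].

Lemma updE M r x i : upd M r x i = if i == r then x else M i.
Proof. by []. Qed.

Lemma exec_addn k a b M : a != b ->
  forall i, exec (nseq k (IAdd a a b)) M i = if i == a then M a + k * M b else M i.
Proof.
move=> ab i; elim: k M => [|k IH] M.
  by rewrite mul0n addn0 /exec /=; case: eqP => [->|].
have -> : exec (nseq k.+1 (IAdd a a b)) M = exec (nseq k (IAdd a a b)) (upd M a (M a + M b)).
  by [].
rewrite IH !updE eqxx (eq_sym b) (negPf ab) mulSn addnA.
by case: (i == a).
Qed.

Lemma exec_address B s M j t : represents B s M -> j < 16 -> t < 9 ->
  let M' := exec (address j t) M in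
  M' (tmp t) = B + M (tmp t) * 16 + j /\
  forall i, i < tmp t \/ nregs <= i -> M' i = M i.
Proof.
case=> _ _ Mz Mb _ lj lt M'.
have tE : tmp t.+1 != tmp t by rewrite /tmp; lia.
have E i : exec (address j t) M i =
    if i == tmp t then B + M (tmp t) * 16 + j
    else if i == tmp t.+1 then B + M (tmp t) * 16 + j else M i.
  rewrite /address exec_cat exec_cat; set M1 := exec [:: _; _] M.
  have M1E i' : M1 i' = if i' == tmp t.+1 then j + B else M i'.
    rewrite /M1 /exec /= !updE !eqxx.
    have -> : base_reg == tmp t.+1 = false by rewrite /tmp /base_reg; lia.
    by rewrite Mb; case: (i' == _).
  have := exec_addn 16 M1 tE; set M2 := exec (nseq _ _) M1 => M2E.
  rewrite /exec /= !updE !M2E !M1E !eqxx.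
  have -> : zero_reg == tmp t.+1 = false by rewrite /tmp /zero_reg; lia.
  rewrite Mz (eq_sym (tmp t) (tmp t.+1)) (negPf tE).
  have -> : j + B + 16 * M (tmp t) = B + M (tmp t) * 16 + j by lia.
  by rewrite addn0; case: (i == tmp t); case: (i == tmp t.+1).
split=> [|i Hi]; first by rewrite /M' E eqxx.
rewrite /M' E; have -> : i == tmp t = false by move: Hi; rewrite /tmp /nregs; lia.
by have -> : i == tmp t.+1 = false by move: Hi; rewrite /tmp /nregs; lia.
Qed.

Lemma straight_address j t : all straight (address j t).
Proof. by rewrite /address !all_cat. Qed.

Opaque address.

Lemma straight_expr a t : all straight (compile_expr a t).
Proof.
elim: a t => //= [a IHa b IHb|a IHa b IHb|j a IHa] t;
  by rewrite !all_cat ?IHa ?IHb ?straight_address.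
Qed.

Lemma represents_frame B s M M' : represents B s M ->
  (forall i, i < loop_reg 0 \/ nregs <= i -> M' i = M i) -> represents B s M'.
Proof.
case=> HB Hv Hz Hb Ha H; split; first exact: HB.
- by move=> x lx; rewrite H ?Hv //; left; rewrite /loop_reg; lia.
- by rewrite H //; left.
- by rewrite H //; left.
- by move=> j i lj; rewrite H ?Ha //; right; lia.
Qed.

(** Cells below [tmp t] survive, so a left operand in [tmp t] is intact after the right one has been
    evaluated at level [t.+1]. *)
Lemma exec_expr B s M a t : represents B s M -> wf_expr a t ->
  let M' := exec (compile_expr a t) M in
  M' (tmp t) = eval (vars s) (arrs s) a /\ forall i, i < tmp t \/ nregs <= i -> M' i = M i.
Proof.
have keep M' t' : represents B s M' -> forall M'',
    (forall i, i < tmp t' \/ nregs <= i -> M'' i = M' i) -> represents B s M''.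
  move=> R M'' H; apply: represents_frame R _ => i Hi; apply: H.
  by move: Hi; rewrite /tmp /loop_reg; lia.
have upd_tmp M' t' x i : t' < 9 -> i < tmp t' \/ nregs <= i -> upd M' (tmp t') x i = M' i.
  by move=> lt Hi; rewrite updE; case: eqP => // E; move: Hi; rewrite E /tmp /nregs; lia.
have binop op M' t' a1 b1 : represents B s M' ->
    (forall M t, represents B s M -> wf_expr a1 t ->
      let M' := exec (compile_expr a1 t) M in
      M' (tmp t) = eval (vars s) (arrs s) a1 /\ forall i, i < tmp t \/ nregs <= i -> M' i = M i) ->
    (forall M t, represents B s M -> wf_expr b1 t ->
      let M' := exec (compile_expr b1 t) M in
      M' (tmp t) = eval (vars s) (arrs s) b1 /\ forall i, i < tmp t \/ nregs <= i -> M' i = M i) ->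
    wf_expr a1 t' && wf_expr b1 t'.+1 ->
    let M2 := exec (compile_expr b1 t'.+1) (exec (compile_expr a1 t') M') in
    let M3 := upd M2 (tmp t') (op (M2 (tmp t')) (M2 (tmp t'.+1))) in
    M3 (tmp t') = op (eval (vars s) (arrs s) a1) (eval (vars s) (arrs s) b1) /\
    forall i, i < tmp t' \/ nregs <= i -> M3 i = M' i.
  move=> R IHa IHb /andP[wa wb]; have [Ea Fa] := IHa _ _ R wa.
  have [Eb Fb] := IHb _ _ (keep _ _ R _ Fa) wb.
  set M2 := exec _ _ in Eb Fb *.
  have t9 : t' < 9.
    by elim: (b1) (t') wb => //= [x|c|a2 IH2 b2 _|a2 IH2 b2 _|j a2 _] u; 
       rewrite ?andbT; try (move=> /andP[]); try lia; move=> /IH2.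
  split=> /=; first by rewrite updE eqxx Eb Fb ?Ea //; left; rewrite /tmp; lia.
  move=> i Hi; rewrite upd_tmp // Fb ?Fa //.
  by move: Hi; rewrite /tmp; lia.
elim: a M t => [x|c|a IHa b IHb|a IHa b IHb|j a IHa] M t R.
- case/andP=> lx lt; rewrite /exec /=; case: R => _ Hv Hz _ _.
  by rewrite updE eqxx Hv // Hz addn0; split => // i; apply: upd_tmp.
- by move=> lt; rewrite /exec /= updE eqxx; split => // i; apply: upd_tmp.
- by move=> w; rewrite /= !exec_cat; apply: (binop addn).
- by move=> w; rewrite /= !exec_cat; apply: (binop subn).
- case/andP=> /andP[lj wa] lt; have [Ea Fa] := IHa _ _ R wa.
  rewrite /= exec_cat exec_cat; move: (exec (compile_expr a t) M) Ea Fa => M1 Ea Fa.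
  have R1 := keep _ _ R _ Fa; have [Ead Fad] := exec_address R1 lj lt.
  move: (exec (address j t) M1) Ead Fad => M2 Ead Fad.
  rewrite /exec /= updE eqxx; split.
    have [_ _ _ _ Harr] := keep _ _ R1 _ Fad.
    by rewrite -Harr // Ead Ea.
  by move=> i Hi; rewrite upd_tmp // Fad ?Fa.
Qed.

Lemma run1 P o i M : nth IHalt P o = i -> run P 1 (o, M) =
  match i with
  | IConst r c => (o.+1, upd M r c)
  | IAdd r a b => (o.+1, upd M r (M a + M b))
  | ISub r a b => (o.+1, upd M r (M a - M b))
  | ILoad r a => (o.+1, upd M r (M (M a)))
  | IStore a b => (o.+1, upd M (M a) (M b))
  | IJz a l => (if M a == 0 then l else o.+1, M)
  | IHalt => (o, M)
  end.
Proof. by rewrite /run /= => ->. Qed.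

Lemma run_expr P o B s M a t : represents B s M -> wf_expr a t ->
  code_at P o (compile_expr a t) ->
  exists M', [/\ run P (size (compile_expr a t)) (o, M) = (o + size (compile_expr a t), M'),
    M' (tmp t) = eval (vars s) (arrs s) a & forall i, i < tmp t \/ nregs <= i -> M' i = M i].
Proof.
move=> R w at_a; have [Ea Fa] := exec_expr R w.
exists (exec (compile_expr a t) M); split=> //.
exact/run_straight/at_a/straight_expr.
Qed.

Lemma represents_tmp B s M M' : represents B s M ->
  (forall i, i < tmp 0 \/ nregs <= i -> M' i = M i) -> represents B s M'.
Proof.
move=> R H; apply: represents_frame R _ => i Hi; apply: H.
by move: Hi; rewrite /tmp /loop_reg; lia.
Qed.

Lemma represents_tick B s M : represents B s M -> represents B (tick s) M.
Proof. by case. Qed.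

Lemma code_at_cons P o i l : code_at P o (i :: l) ->
  nth IHalt P o = i /\ code_at P o.+1 l.
Proof.
move=> at_il; split; first exact: code_at1 at_il.
by move: at_il; rewrite -cat1s => /code_at_cat[_]; rewrite addn1.
Qed.

(** For conditionals: the branch of length [n] takes [k] steps, and the tick spent on entry pays for
    the [a] steps of the test and the jumps. *)
Lemma time_bound a k n m t t' : k + n * t.+1 <= n * t' -> t < t' -> n + a <= m ->
  a + k + m * t <= m * t'.
Proof.
move=> kt tt' nam; have [u t'E] : exists u, t' = t + 1 + u by exists (t' - t - 1); lia.
have [b mE] : exists b, m = n + a + b by exists (m - n - a); lia.
by subst; nia.
Qed.

(** Each tick is worth the length of the compiled code in machine steps. The frame clause protects
    the counters of the enclosing loops. *)
Lemma run_cmd P B c d o s M : represents B s M -> wf_cmd c d ->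
  code_at P o (compile c d o) ->
  exists k M', [/\ run P k (o, M) = (o + size (compile c d o), M'),
    represents B (sem c s) M',
    forall i, loop_reg 0 <= i < loop_reg d -> i < tmp 0 -> M' i = M i &
    k + size (compile c d o) * time s <= size (compile c d o) * time (sem c s)].
Proof.
elim: c d o s M => [|x a|j a b|c1 IH1 c2 IH2|a c1 IH1 c2 IH2|a c IH] d o s M R.
- by move=> _ _; exists 0, M; rewrite /= addn0; split.
- case/andP=> lx wa /= /code_at_cat[at_a at_x].
  have [M1 [run1E E1 F1]] := run_expr R wa at_a.
  exists (size (compile_expr a 0) + 1), (upd M1 x (eval (vars s) (arrs s) a)).
  have R1 := represents_tmp R F1.
  rewrite runD run1E (run1 _ (code_at1 at_x)) size_cat; split.
  + by case: R1 => _ _ -> _ _; rewrite addn0 E1; congr (_, _); rewrite /=; lia.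
  + case: R1 => HB Hv Hz Hb Ha; split=> //=.
    * by move=> y ly; rewrite !updE Hv.
    * by rewrite updE Hz; case: eqP => // E; move: lx; rewrite -E.
    * by rewrite updE Hb; case: eqP => // E; move: lx; rewrite -E.
    * move=> j i lj; rewrite updE Ha //; case: eqP => // E.
      by move: HB lx; rewrite -E /nregs; lia.
  + move=> i; rewrite /loop_reg => Hi Hi'; rewrite updE F1; last by left.
    by case: eqP => // E; lia.
  + by rewrite /=; lia.
- case/and3P=> lj wa wb /= /code_at_cat[at_a /code_at_cat[at_j /code_at_cat[at_b at_s]]].
  have [M1 [run1E E1 F1]] := run_expr R wa at_a.
  have R1 := represents_tmp R F1.
  have [E2 F2] := exec_address R1 lj (isT : 0 < 9).
  have run2E : run P (size (address j 0)) (o + size (compile_expr a 0), M1) =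
      (o + size (compile_expr a 0) + size (address j 0), exec (address j 0) M1).
    exact/run_straight/at_j/straight_address.
  move: (exec (address j 0) M1) E2 F2 run2E => M2 E2 F2 run2E.
  have R2 := represents_tmp R1 F2.
  have [M3 [run3E E3 F3]] := run_expr R2 wb at_b.
  have R3 : represents B s M3.
    apply: represents_frame R2 _ => i Hi; apply: F3.
    by move: Hi; rewrite /tmp /loop_reg; lia.
  exists (size (compile_expr a 0) + (size (address j 0) + (size (compile_expr b 1) + 1))).
  exists (upd M3 (B + eval (vars s) (arrs s) a * 16 + j) (eval (vars s) (arrs s) b)).
  have E0 : M3 (tmp 0) = B + eval (vars s) (arrs s) a * 16 + j by rewrite F3 ?E2 ?E1 //; left.
  have HB : nregs <= B by case: R.
  have low i : i < nregs -> (i == B + eval (vars s) (arrs s) a * 16 + j) = false.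
    by move: HB; rewrite -addnA; lia.
  rewrite !runD run1E run2E run3E (run1 _ (code_at1 at_s)) E0 E3; split.
  + by congr (_, _); rewrite !size_cat /=; lia.
  + case: R3 => _ Hv Hz Hb Ha; split=> //=.
    * by move=> y ly; rewrite updE Hv // low // /nregs; lia.
    * by rewrite updE Hz low.
    * by rewrite updE Hb low.
    * move=> j' i lj'; rewrite updE Ha //; have [->|jj] := eqVneq j' j.
        rewrite updE; have [->|ii] := eqVneq i (eval (vars s) (arrs s) a); first by rewrite eqxx.
        by case: eqP => // E; move: ii => /eqP; lia.
      by case: eqP => // E; move: jj => /eqP; lia.
  + move=> i; rewrite /loop_reg => Hi Hi'.
    rewrite updE F3; last by left; rewrite /tmp in Hi' *; lia.
    rewrite F2; last by left.
    by rewrite F1 ?low //; [rewrite /tmp in Hi'; rewrite /nregs; lia | left].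
  + by rewrite !size_cat /=; lia.
- case/andP=> w1 w2 /= /code_at_cat[at1 at2].
  have [k1 [M1 [run1E R1 F1 T1]]] := IH1 _ _ _ _ R w1 at1.
  have [k2 [M2 [run2E R2 F2 T2]]] := IH2 _ _ _ _ R1 w2 at2.
  exists (k1 + k2), M2; rewrite runD run1E run2E !size_cat addnA; split=> //.
    by move=> i Hi Hi'; rewrite F2 ?F1.
  move: (time_sem c1 s) (time_sem c2 (sem c1 s)) T2 T1.
  move: (size (compile c2 _ _)) => n2; move: (size (compile c1 _ _)) => n1.
  move: (time (sem c2 _)) => t2; move: (time (sem c1 _)) (time s) => t1 t tt1 tt2 T2 T1.
  have [u tE] : exists u, t1 = t + u by exists (t1 - t); lia.
  have [w t2E] : exists w, t2 = t1 + w by exists (t2 - t1); lia.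
  by subst; nia.
- case/and3P=> wa w1 w2 /= /code_at_cat[at_a /code_at_cons[at_j]].
  rewrite -addn1 => /code_at_cat[at1 /code_at_cons[at_j']]; rewrite -addn1 => at2.
  have [M1 [run1E E1 F1]] := run_expr R wa at_a.
  have R1 := represents_tick (represents_tmp R F1).
  rewrite !size_cat /= !size_cat /=; case: eqP => /= ca.
    have [k2 [M2 [run2E R2 F2 T2]]] := IH2 _ _ _ _ R1 w2 at2.
    exists (size (compile_expr a 0) + (1 + k2)), M2; split=> //.
    + by rewrite !runD run1E (run1 _ at_j) E1 ca eqxx run2E; congr (_, _); lia.
    + by move=> i Hi Hi'; rewrite F2 ?F1 //; left.
    + by rewrite addnA; apply: time_bound T2 _ _; [exact: (time_sem c2 (tick s)) | lia].
  have [k2 [M2 [run2E R2 F2 T2]]] := IH1 _ _ _ _ R1 w1 at1.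
  exists (size (compile_expr a 0) + (1 + (k2 + 1))), M2; split=> //.
  + rewrite !runD run1E (run1 _ at_j) E1; case: eqP => // _.
    rewrite -[(o + size _).+1]addn1 run2E (run1 _ at_j'); case: R2 => _ _ -> _ _.
    by rewrite eqxx; congr (_, _); lia.
  + by move=> i Hi Hi'; rewrite F2 ?F1 //; left.
  + have -> : size (compile_expr a 0) + (1 + (k2 + 1)) = size (compile_expr a 0) + 2 + k2 by lia.
    by apply: time_bound T2 _ _; [exact: (time_sem c1 (tick s)) | lia].
- case/and3P=> ld wa wc /= /code_at_cat[at_a /code_at_cons[at_l /code_at_cons[at_j]]].
  rewrite -[(_ + _).+1]addn1 -[_.+1]addn1 => /code_at_cat[at_c].
  case/code_at_cons=> at_1 /code_at_cons[at_2 /code_at_cons[at_3 _]].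
  have [M1 [run1E E1 F1]] := run_expr R wa at_a.
  have R1 := represents_tmp R F1.
  set n0 := size (compile_expr a 0) in at_j at_c at_1 at_2 at_3 run1E at_l *.
  set o1 := o + n0 + 1 in at_j at_c at_1 at_2 at_3 *.
  set n1 := size (compile c d.+1 (o1 + 1)) in at_1 at_2 at_3 at_j *.
  have oE : (o + n0).+1 = o1 by rewrite /o1 addn1.
  (* Beyond the body, an iteration costs 4 steps: the test, two instructions for the decrement and
     the jump back. The final 1 is the failing test. *)
  have loop m s' M' : represents B s' M' -> M' (loop_reg d) = m ->
      exists k M'', [/\ run P k (o1, M') = (o1 + 1 + n1 + 3, M''),
        represents B (iter m (fun s => sem c (tick s)) s') M'',
        forall i, loop_reg 0 <= i < loop_reg d -> i < tmp 0 -> M'' i = M' i &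
        k + (n1 + 4) * time s' <=
          (n1 + 4) * time (iter m (fun s => sem c (tick s)) s') + 1].
    elim: m s' M' => [|m IHm] s' M' R' Em.
      exists 1, M'; split=> //; last by rewrite addnC.
      by rewrite -oE (run1 _ at_j) Em eqxx oE.
    have [k2 [M2 [run2E R2 F2 T2]]] := IH _ _ _ _ (represents_tick R') wc at_c.
    have E2 : M2 (loop_reg d) = m.+1.
      by rewrite F2 ?Em // /loop_reg /tmp; lia.
    pose M3 := upd (upd M2 (tmp 0) 1) (loop_reg d) m.
    have M3E i : i < loop_reg 0 \/ nregs <= i -> M3 i = M2 i.
      rewrite /M3 !updE /loop_reg /tmp /nregs => Hi.
      by case: eqP => [|_]; [lia | case: eqP => [|//]; lia].
    have ltm : loop_reg d == tmp 0 = false by rewrite /loop_reg /tmp; lia.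
    have run3E : run P 3 (o1 + 1 + n1, M2) = (o1, M3).
      rewrite -[3]/(1 + (1 + 1)) !runD (run1 _ at_1) (run1 _ at_2) (run1 _ at_3).
      have zl : zero_reg == loop_reg d = false by rewrite /loop_reg /zero_reg; lia.
      have zt : zero_reg == tmp 0 = false by [].
      by rewrite !updE eqxx ltm E2 subn1 zl zt; case: R2 => _ _ -> _ _.
    have [|k4 [M4 [run4E R4 F4 T4]]] := IHm _ _ (represents_frame R2 M3E).
      by rewrite /M3 updE eqxx.
    exists (1 + (k2 + (3 + k4))), M4; split.
    + have runJ : run P 1 (o1, M') = (o1 + 1, M') by rewrite -{1}oE (run1 _ at_j) Em oE addn1.
      by rewrite !runD runJ run2E run3E.
    + by rewrite iterSr.
    + move=> i Hi Hi'; rewrite F4 // /M3 !updE F2 //; last by rewrite /loop_reg in Hi *; lia.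
      by rewrite /loop_reg /tmp in Hi Hi' *; case: eqP => [|_]; [lia | case: eqP => [|//]; lia].
    + rewrite iterSr; move: T2 T4 (time_sem c (tick s')); rewrite -/n1 /=.
      move: (time (iter _ _ _)) => t2; move: (time (sem c _)) (time s') => t1 t T2 T4 tt1.
      have [u tE] : exists u, t1 = t + 1 + u by exists (t1 - t - 1); lia.
      by move: T2 T4; rewrite {}tE; nia.
  have R1' : represents B (tick s) (upd M1 (loop_reg d) (eval (vars s) (arrs s) a)).
    apply: represents_frame (represents_tick R1) _ => i Hi; rewrite updE.
    by case: eqP => // E; move: Hi; rewrite E /loop_reg /nregs; lia.
  have [|k2 [M2 [run2E R2 F2 T2]]] := loop (eval (vars s) (arrs s) a) _ _ R1'; first by rewrite updE eqxx.
  exists (n0 + (1 + k2)), M2; rewrite !size_cat /= !size_cat /= -/n0 -/o1 -/n1; split=> //.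
  + rewrite !runD run1E (run1 _ at_l) E1 oE.
    case: R1 => _ _ -> _ _; rewrite addn0 run2E.
    by congr (_, _); rewrite /o1; lia.
  + move=> i Hi Hi'; rewrite F2 // updE F1; last by left.
    by case: eqP => // E; move: Hi; rewrite E /loop_reg; lia.
  + move: T2; rewrite /=; move: (time (iter _ _ _)) (time s) => t1 t T2.
    have t1t : t < t1 by rewrite ltnNge; apply/negP => le; move: T2; nia.
    have [u tE] : exists u, t1 = t + 1 + u by exists (t1 - t - 1); lia.
    by move: T2; rewrite {}tE; nia.
Qed.

(** * Relocating the input *)

Arguments upd : simpl never.

Lemma exec_subn k a b M : a != b ->
  forall i, exec (nseq k (ISub a a b)) M i = if i == a then M a - k * M b else M i.
Proof.
move=> ab i; elim: k M => [|k IH] M.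
  by rewrite mul0n subn0 /exec /=; case: eqP => [->|].
have -> : exec (nseq k.+1 (ISub a a b)) M = exec (nseq k (ISub a a b)) (upd M a (M a - M b)).
  by [].
rewrite IH !updE eqxx (eq_sym b) (negPf ab) mulSn subnDA.
by case: (i == a).
Qed.

(* Cell 1 holds n + 2 and so can be recomputed; it is the only cell that is free
   at the start.  It is used to reach the area E + 48 * n, past the end E of the
   input, where cells 2..47 are saved. *)
Definition boot_address :=
  [:: IConst 1 1; IAdd 1 1 0; ILoad 1 1] ++ nseq 48 (IAdd 1 1 0).
Definition save i := [:: IConst 2 (i - 2); IAdd 2 1 2; IStore 2 i].
Definition saves k := IStore 1 2 :: flatten [seq save i | i <- iota 3 k].
Definition boot_base := [:: IConst 32 0; IAdd 33 1 32] ++ nseq 48 (IAdd 33 33 0).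
Definition boot_end := [:: IAdd 7 1 32] ++ nseq 48 (ISub 7 7 0).
(** Entries 0 and 1 were not saved: cell 0 is still intact, and the old content [n + 2] of cell 1 is
    recomputed. Cell 2 becomes the write pointer, cell 3 the read pointer. *)
Definition boot_header :=
  [:: IConst 5 1; IConst 6 16; IStore 33 0; IAdd 2 33 6; IConst 4 2; IAdd 4 4 0;
      IStore 2 4; IAdd 3 1 32].
Definition copy := [:: IAdd 2 2 6; ILoad 4 3; IStore 2 4; IAdd 3 3 5].
Definition boot_line :=
  boot_address ++ saves 45 ++ boot_base ++ boot_end ++ boot_header ++
  flatten (nseq 46 copy) ++ [:: IConst 3 48].
(** The 46 unrolled copies move cells 2 to 47 from where they were saved; the loop, seven
    instructions long, moves the rest from its original place. *)
Definition boot :=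
  let o := size boot_line in
  boot_line ++ [:: ISub 4 7 3; IJz 4 (o + 7)] ++ copy ++ [:: IJz 32 o].

(** * Correctness of the relocation *)

Section Boot.
Variables (n E : nat) (M0 : nat -> nat).
Hypotheses (n_gt0 : 0 < n) (leE : n + 2 <= E).
Hypotheses (M0_0 : M0 0 = n) (M0_1 : M0 1 = n + 2) (M0_E : M0 n.+1 = E).
Hypothesis M0_out : forall i, E <= i -> M0 i = 0.
Let A := E + 48 * n.
Let B := A + 48 * n.

Lemma exec_boot_address :
  let M := exec boot_address M0 in M 1 = A /\ forall i, i != 1 -> M i = M0 i.
Proof.
rewrite /boot_address exec_cat; set M1 := exec _ M0.
have M1E i : M1 i = if i == 1 then E else M0 i.
  rewrite /M1 /exec /= !updE /= M0_0 add1n; case: (i == 1) => //.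
  by rewrite M0_E; case: eqP => //; lia.
split=> [|i i1]; rewrite exec_addn //= !M1E //=; first by rewrite M0_0.
by rewrite (negPf i1).
Qed.

Lemma exec_saves k : k <= 45 ->
  let M := exec (saves k) (exec boot_address M0) in
  [/\ M 0 = n, M 1 = A, forall i, 2 <= i < k + 3 -> M (A + i - 2) = M0 i &
      forall i, 2 < i -> A + k + 1 <= i \/ i < A -> M i = M0 i].
Proof.
have A48 : 48 < A by rewrite /A; lia.
have [H1 Hi] := exec_boot_address; move: (exec boot_address M0) H1 Hi => M H1 Hi.
elim: k => [|k IH] lk.
  have -> : exec (saves 0) M = upd M A (M0 2) by rewrite /saves /exec /= H1 Hi.
  split.
  - by rewrite updE Hi // M0_0; case: eqP => //; lia.
  - by rewrite updE H1; case: eqP => //; lia.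
  - by move=> i i2; have -> : i = 2 by [lia]; rewrite updE addnK eqxx.
  - by move=> i i2 iA; rewrite updE Hi; [case: eqP => //|]; lia.
have -> : exec (saves k.+1) M = exec (save (k + 3)) (exec (saves k) M).
  rewrite /saves -[k.+1]addn1 iotaD map_cat flatten_cat -cat_cons exec_cat /=.
  by rewrite (addnC 3).
have [I0 I1 IA Iout] := IH (ltnW lk); move: (exec (saves k) M) I0 I1 IA Iout => N I0 I1 IA Iout.
have -> : exec (save (k + 3)) N = upd (upd (upd N 2 (k + 1)) 2 (A + (k + 1))) (A + (k + 1)) (N (k + 3)).
  rewrite /save /exec /= !updE /= I1.
  have -> : k + 3 - 2 = k + 1 by lia.
  by have -> : k + 3 == 2 = false by lia.
split; rewrite ?updE.
- by case: eqP => // E0; lia.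
- by case: eqP => // E0; lia.
- move=> i ik; rewrite !updE; case: eqP => [iA|].
    have -> : i = k + 3 by lia.
    by rewrite Iout; lia.
  move=> iA; case: eqP => [|_]; first lia.
  by apply: IA; lia.
- move=> i i2 iA; rewrite !updE; case: eqP => [|_]; first lia.
  by case: eqP => [|_]; [lia | apply: Iout; lia].
Qed.

(** [c] entries are in place and [src] is the cell read next. The two differ only during the
    unrolled copies, which read the saved area. The write pointer lags one entry because [copy]
    advances it first. *)
Definition copied c src (M : nat -> nat) :=
  [/\ [/\ M 0 = n, M 2 + 16 = B + c * 16, M 3 = src & M 5 = 1],
      [/\ M 6 = 16, M 7 = E, M 32 = 0 & M 33 = B],
      forall i, 48 <= i < E -> M i = M0 i,
      forall i, 2 <= i < 48 -> M (A + i - 2) = M0 i &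
      forall i j, j < 16 -> M (B + i * 16 + j) = if (j == 0) && (i < c) then M0 i else 0].

Lemma copied_step c src M : copied c src M -> 48 <= src < B -> M src = M0 c ->
  copied c.+1 src.+1 (exec copy M).
Proof.
case=> -[m0 m2 m3 m5] [m6 m7 m32 m33] mE mA mB src48 msrc.
have [BE AB] : E < B /\ A + 48 <= B by rewrite /B /A; lia.
have -> : exec copy M =
    upd (upd (upd (upd M 2 (B + c * 16)) 4 (M0 c)) (B + c * 16) (M0 c)) 3 src.+1.
  have m2' : M 2 + M 6 = B + c * 16 by rewrite m6.
  have [s2 s4] : src == 2 = false /\ src == 4 = false by lia.
  have [d3 d5] : 3 == B + c * 16 = false /\ 5 == B + c * 16 = false by lia.
  have lits : (3 == 2 = false) * (2 == 4 = false) * (4 == 2 = false) * (3 == 4 = false)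
    * (5 == 4 = false) * (5 == 2 = false) by [].
  by rewrite /copy /exec /= !updE !lits !eqxx m2' m3 s2 d3 d5 m5 msrc addn1.
have low a : a < 48 -> a == B + c * 16 = false by lia.
split.
- by rewrite !updE /= !low //=; split=> //; lia.
- by rewrite !updE /= !low //=.
- move=> i iE; rewrite !updE mE //.
  have -> : i == 3 = false by lia.
  have -> : i == B + c * 16 = false by lia.
  have -> : i == 4 = false by lia.
  by have -> : i == 2 = false by lia.
- move=> i iE; rewrite !updE mA //.
  have -> : A + i - 2 == 3 = false by lia.
  have -> : A + i - 2 == B + c * 16 = false by lia.
  have -> : A + i - 2 == 4 = false by lia.
  by have -> : A + i - 2 == 2 = false by lia.
- move=> i j lj; rewrite !updE mB //.
  have -> : B + i * 16 + j == 3 = false by lia.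
  have -> : B + i * 16 + j == 4 = false by lia.
  have -> : B + i * 16 + j == 2 = false by lia.
  have -> : B + i * 16 + j == B + c * 16 = (j == 0) && (i == c) by lia.
  rewrite [i < c.+1]ltnS [i <= c]leq_eqVlt; case: (j == 0) => //=.
  by case: (eqVneq i c) => [->|_] /=; rewrite ?eqxx.
Qed.

Lemma execE i l M : exec (i :: l) M = exec l
  match i with
  | IConst r c => upd M r c
  | IAdd r a b => upd M r (M a + M b)
  | ISub r a b => upd M r (M a - M b)
  | ILoad r a => upd M r (M (M a))
  | IStore a b => upd M (M a) (M b)
  | _ => M
  end.
Proof. by rewrite exec_cons; case: i. Qed.

Lemma exec_boot_header M : M 0 = n -> M 1 = A -> M 33 = B -> M 32 = 0 ->
  exec boot_header M = upd (upd (upd (upd (upd (upd (upd (upd M 5 1) 6 16) B n) 2 (B + 16)) 4 2)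
      4 (n + 2)) (B + 16) (n + 2)) 3 A.
Proof.
move=> m0 m1 m33 m32; have B33 : 48 < B by rewrite /B /A; lia.
have lits : (33 == 5 = false) * (33 == 6 = false) * (0 == 5 = false) * (0 == 6 = false)
  * (6 == 5 = false) * (0 == 4 = false) * (0 == 2 = false) * (4 == 2 = false)
  * (2 == 4 = false) * (1 == 5 = false) * (1 == 6 = false) * (1 == 4 = false)
  * (1 == 2 = false) * (32 == 5 = false) * (32 == 6 = false) * (32 == 4 = false)
  * (32 == 2 = false) by [].
have keys : (33 == B = false) * (6 == B = false) * (0 == B = false) * (1 == B = false)
  * (32 == B = false) * (1 == B + 16 = false) * (32 == B + 16 = false) by do !split; lia.
do 8! [rewrite execE ?(updE, lits, keys, eqxx, m0, m1, m33, m32)].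
by rewrite addn0 (addnC 2).
Qed.

Lemma exec_boot_base M : M 0 = n -> M 1 = A -> forall i,
  exec boot_base M i = if i == 33 then B else if i == 32 then 0 else M i.
Proof.
move=> m0 m1 i; rewrite /boot_base exec_cat; set M1 := exec _ M.
have M1E j : M1 j = if j == 33 then A else if j == 32 then 0 else M j.
  by rewrite /M1 !execE !updE /= m1 addn0.
by clearbody M1; rewrite exec_addn // !M1E m0; case: (i == 33).
Qed.

Lemma exec_boot_end M : M 0 = n -> M 1 = A -> M 32 = 0 -> forall i,
  exec boot_end M i = if i == 7 then E else M i.
Proof.
move=> m0 m1 m32 i; rewrite /boot_end exec_cat; set M1 := exec _ M.
have M1E j : M1 j = if j == 7 then A else M j by rewrite /M1 !execE /exec /= updE m1 m32 addn0.
by clearbody M1; rewrite exec_subn // !M1E m0 /A addnK; case: (i == 7).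
Qed.

Lemma copied_iter M k : copied 2 A M -> k <= 46 ->
  copied (k + 2) (A + k) (exec (flatten (nseq k copy)) M).
Proof.
move=> C2; elim: k => [|k IH] lk; first by rewrite addn0.
have Ck := IH (ltnW lk).
have -> : exec (flatten (nseq k.+1 copy)) M = exec copy (exec (flatten (nseq k copy)) M).
  by rewrite -[k.+1]addn1 nseqD flatten_cat exec_cat.
rewrite addSn (addnS A); apply: (copied_step Ck); first by rewrite /B /A; lia.
by case: (IH (ltnW lk)) => _ _ _ mAk _; rewrite -mAk; [congr (exec _ _ _)|]; lia.
Qed.

Lemma exec_boot_line : copied 48 48 (exec boot_line M0).
Proof.
rewrite /boot_line exec_cat exec_cat.
have [] := @exec_saves 45 isT; move: (exec (saves 45) _) => M m0 m1 mA mout.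
rewrite exec_cat; have := exec_boot_base m0 m1; move: (exec boot_base M) => M1 M1E.
have [m1_0 m1_1 m1_32] : [/\ M1 0 = n, M1 1 = A & M1 32 = 0] by rewrite !M1E.
rewrite exec_cat; have := exec_boot_end m1_0 m1_1 m1_32; move: (exec boot_end M1) => M2 M2E.
rewrite exec_cat; set M3 := exec boot_header M2.
have C2 : copied 2 A M3.
  have B33 : 48 < B by rewrite /B /A; lia.
  have [m2_0 m2_1] : M2 0 = n /\ M2 1 = A by rewrite !M2E !M1E.
  have [m2_33 m2_32] : M2 33 = B /\ M2 32 = 0 by rewrite !M2E !M1E.
  rewrite /M3 exec_boot_header //.
  have lB a : a < 48 -> (a == B = false) * (a == B + 16 = false) by split; lia.
  have hM2 a : 48 <= a -> M2 a = M a.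
    move=> a48; rewrite M2E M1E.
    have -> : a == 7 = false by lia.
    have -> : a == 33 = false by lia.
    by have -> : a == 32 = false by lia.
  have hupd a : 48 <= a -> a != B -> a != B + 16 ->
      upd (upd (upd (upd (upd (upd (upd (upd M2 5 1) 6 16) B n) 2 (B + 16)) 4 2)
      4 (n + 2)) (B + 16) (n + 2)) 3 A a = M a.
    move=> a48 /negPf aB /negPf aB'; rewrite !updE aB aB' -hM2 //.
    have -> : a == 3 = false by lia.
    have -> : a == 4 = false by lia.
    have -> : a == 2 = false by lia.
    have -> : a == 6 = false by lia.
    by have -> : a == 5 = false by lia.
  have [EA AB] : E < A /\ A + 48 <= B by rewrite /B /A; lia.
  split.
  - by rewrite !updE !lB //= m2_0; split=> //; lia.
  - by rewrite !updE !lB //= m2_32 m2_33 M2E.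
  - by move=> i iE; rewrite hupd ?mout //; lia.
  - by move=> i iE; rewrite hupd ?mA //; lia.
  - have kB : (B == 3 = false) * (B == B + 16 = false) * (B == 4 = false) * (B == 2 = false)
      * (B + 16 == 3 = false) by do !split; lia.
    move=> i j lj; have [/andP[/eqP -> i2]|no] := boolP ((j == 0) && (i < 2)).
      have /orP[/eqP->|/eqP->] : (i == 0) || (i == 1) by lia.
        by rewrite mul0n !addn0 !updE !kB eqxx M0_0.
      by rewrite mul1n !addn0 !updE !kB eqxx M0_1.
    by rewrite hupd ?mout ?M0_out //; lia.
clearbody M3; rewrite exec_cat.
have := copied_iter C2 (leqnn 46); move: (exec (flatten _) M3) => N.
case=> -[c0 c2 c3 c5] [c6 c7 c32 c33] cE cA cB.
have u3 i : i == 3 = false -> exec [:: IConst 3 48] N i = N i by rewrite /exec /= updE => ->.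
split.
- have e3 : exec [:: IConst 3 48] N 3 = 48 by [].
  by rewrite e3 !u3.
- by rewrite !u3.
- by move=> i iE; rewrite u3 ?cE //; lia.
- by move=> i iE; rewrite u3 ?cA //; lia.
- by move=> i j lj; rewrite u3 ?cB //; lia.
Qed.

(** The final count may exceed [E]: an input shorter than 48 cells is exhausted by the unrolled
    copies, and the surplus entries are zeros of the original memory. *)
Lemma run_copy_loop P o c M :
  code_at P o ([:: ISub 4 7 3; IJz 4 (o + 7)] ++ copy ++ [:: IJz 32 o]) ->
  48 <= c -> copied c c M ->
  exists k M', [/\ run P k (o, M) = (o + 7, M'), k <= 7 * (E - c) + 2 &
    exists2 c', E <= c' & copied c' c' M'].
Proof.
case/code_at_cons=> i1 /code_at_cons[i2 /code_at_cat[i3 /code_at_cons[i4 _]]].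
have [m mE] : exists m, m = E - c by exists (E - c).
elim: m c M mE => [|m IH] c M mE c48 C; have [[c0 c2 c3 c5] [c6 c7 c32 c33] cE cA cB] := C.
all: have C4 : copied c c (upd M 4 (E - c)).
1,3: have u4 i : i == 4 = false -> upd M 4 (E - c) i = M i by rewrite updE => ->.
1,2: have AB : 48 < A /\ 48 < B by rewrite /B /A; lia.
1,2: split; [by rewrite !u4 | by rewrite !u4 | | |].
- by move=> i iE; rewrite u4 ?cE //; lia.
- by move=> i iE; rewrite u4 ?cA //; lia.
- by move=> i j lj; rewrite u4 ?cB //; lia.
- by move=> i iE; rewrite u4 ?cE //; lia.
- by move=> i iE; rewrite u4 ?cA //; lia.
- by move=> i j lj; rewrite u4 ?cB //; lia.
- exists (1 + 1), (upd M 4 (E - c)); split; [|lia|by exists c; [lia|]].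
  by rewrite runD (run1 _ i1) (run1 _ i2) c3 c7 updE eqxx -mE.
have C' : copied c.+1 c.+1 (exec copy (upd M 4 (E - c))).
  apply: copied_step C4 _ _; first by rewrite /B /A; lia.
  by rewrite updE cE; [case: eqP => //|]; lia.
have [||k [M' [runE kle Cend]]] := IH _ _ _ _ C'; try lia.
exists (1 + (1 + (4 + (1 + k)))), M'; split=> //; last by lia.
rewrite !runD (run1 _ i1) (run1 _ i2) c3 c7 updE eqxx.
have -> : E - c == 0 = false by rewrite -mE.
rewrite [run P 4 _](run_straight (l := copy)) // (run1 _ i4).
by have [_ [_ _ -> _] _ _ _] := C'.
Qed.

(** Relocation leaves arbitrary values in the variables; they are taken over as the initial store,
    of which only variable 0 and the arrays are known. *)
Lemma run_boot P : code_at P 0 boot ->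
  exists k M B0, [/\ run P k (0, M0) = (size boot, M), k <= size boot + 7 * E + 2 &
    represents B0 (Store M (fun j i => if j == 0 then M0 i else 0) 0) M /\ M 0 = n].
Proof.
move=> /code_at_cat[at_line at_loop].
have sline : all straight boot_line by rewrite /boot_line !all_cat.
have [k [M [runE kle [c' Ec' C]]]] := run_copy_loop at_loop (leqnn _) exec_boot_line.
exists (size boot_line + k), M, B; split.
- by rewrite runD run_straight // runE /boot size_cat.
- by rewrite /boot size_cat; lia.
- case: C => -[c0 c2 c3 c5] [c6 c7 c32 c33] cE cA cB; split=> //; split=> //.
    by rewrite /nregs /B /A; lia.
  move=> j i lj; rewrite cB //=; case: (j == 0) => //=.
  by case: (ltnP i c') => // ic; rewrite M0_out //; lia.
Qed.

End Boot.

(** * Loops over vertices and adjacency lists *)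

Local Infix ";;" := Seq (at level 61, right associativity).

Fixpoint written_vars (c : cmd) : seq nat :=
  match c with
  | Skip | Put _ _ _ => [::]
  | Let x _ => [:: x]
  | Seq c1 c2 | If _ c1 c2 => written_vars c1 ++ written_vars c2
  | For _ c => written_vars c
  end.

Fixpoint written_arrs (c : cmd) : seq nat :=
  match c with
  | Skip | Let _ _ => [::]
  | Put j _ _ => [:: j]
  | Seq c1 c2 | If _ c1 c2 => written_arrs c1 ++ written_arrs c2
  | For _ c => written_arrs c
  end.

Lemma vars_frame c x s : x \notin written_vars c -> vars (sem c s) x = vars s x.
Proof.
elim: c s => //= [y a s|c1 IH1 c2 IH2 s|a c1 IH1 c2 IH2 s|a c IH s].
- by rewrite inE updE => /negPf ->.
- by rewrite mem_cat negb_or => /andP[h1 h2]; rewrite IH2 // IH1.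
- by rewrite mem_cat negb_or => /andP[h1 h2]; case: ifP => _; rewrite (IH1, IH2).
- move=> h; apply: (iter_ind (I := fun _ s' => vars s' x = vars s x)) => // i s' _ <-.
  by rewrite IH.
Qed.

Lemma arrs_frame c j s : j \notin written_arrs c -> arrs (sem c s) j = arrs s j.
Proof.
elim: c s => //= [k a b s|c1 IH1 c2 IH2 s|a c1 IH1 c2 IH2 s|a c IH s].
- by rewrite inE => /negPf ->.
- by rewrite mem_cat negb_or => /andP[h1 h2]; rewrite IH2 // IH1.
- by rewrite mem_cat negb_or => /andP[h1 h2]; case: ifP => _; rewrite (IH1, IH2).
- move=> h; apply: (iter_ind (I := fun _ s' => arrs s' j = arrs s j)) => // i s' _ <-.
  by rewrite IH.
Qed.

Fixpoint loop_free (c : cmd) : bool :=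
  match c with
  | Skip | Let _ _ | Put _ _ _ => true
  | Seq c1 c2 | If _ c1 c2 => loop_free c1 && loop_free c2
  | For _ _ => false
  end.

Fixpoint steps (c : cmd) : nat :=
  match c with
  | Skip | Let _ _ | Put _ _ _ => 1
  | Seq c1 c2 => steps c1 + steps c2
  | If _ c1 c2 => (steps c1 + steps c2).+1
  | For _ _ => 0
  end.

Lemma time_loop_free c s : loop_free c -> time (sem c s) <= time s + steps c.
Proof.
elim: c s => //= [s _|x a s _|j a b s _|c1 IH1 c2 IH2 s /andP[l1 l2]|a c1 IH1 c2 IH2 s /andP[l1 l2]];
  rewrite ?addn1 //.
- by have := IH1 s l1; have := IH2 (sem c1 s) l2; lia.
- by case: ifP => _; [have := IH1 (tick s) l1 | have := IH2 (tick s) l2]; rewrite /=; lia.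
Qed.

(** Truncated subtraction makes this conjunction on the values 0 and 1. *)
Definition And a b := Minus (Plus a b) (Cst 1).
Definition Eq a b := Minus (Cst 1) (Plus (Minus a b) (Minus b a)).

Lemma eval_Eq V A a b : eval V A (Eq a b) = (eval V A a == eval V A b).
Proof. by rewrite /=; case: eqP; lia. Qed.

Lemma eval_And V A a b (p q : bool) : eval V A a = p -> eval V A b = q ->
  eval V A (And a b) = p && q.
Proof. by move=> /= -> ->; case: p; case: q. Qed.

Arguments Eq : simpl never.
Arguments And : simpl never.

(* Variable 0 is the number of vertices, 1 the loop index, 2 the current vertex,
   3 the position in its adjacency list, 4 the current neighbour, 5 the length of
   the queue, 6 the best value so far, 7 an accumulator. *)
Definition for_vertices c := Let 1 (Cst 0) ;; For (Var 0) (c ;; Let 1 (Plus (Var 1) (Cst 1))).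

Definition for_nbrs c :=
  Let 3 (Get 0 (Plus (Var 2) (Cst 1))) ;;
  For (Minus (Get 0 (Plus (Var 2) (Cst 2))) (Var 3))
    (Let 4 (Get 0 (Var 3)) ;; c ;; Let 3 (Plus (Var 3) (Cst 1))).

Arguments for_vertices : simpl never.
Arguments for_nbrs : simpl never.

(* Array 0 is the input, 1 the queue of a search, 4 the distance to the clique [K],
   5 the indicator of [K], 6 the weights to be summed, 7 the sums over neighbours and
   8 the gates.  Arrays of distances contain distances plus 1, and 0 at the vertices
   not yet reached. *)
Definition fill j a := for_vertices (Put j (Var 1) a).

Definition argmax x a :=
  Let x (Cst 0) ;; Let 6 (Cst 0) ;;
  for_vertices (If (Minus a (Var 6)) (Let 6 a ;; Let x (Var 1)) Skip).

(** Selected vertices receive their sum plus 1 and the others 0, so that [argmax] picks a selected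
    vertex even when all sums vanish, and members of [K] get the lowest weight in [gates]. *)
Definition nbr_sum a :=
  for_vertices (Let 2 (Var 1) ;; Let 7 (Cst 0) ;;
    If a (Let 7 (Cst 1) ;; for_nbrs (Let 7 (Plus (Var 7) (Get 6 (Var 4))))) Skip ;;
    Put 7 (Var 2) (Var 7)).

(** Every vertex starts as its own gate. A vertex next to [K] stays so, its parents having weight 0;
    farther out it has weight 1 and is displaced by a parent's gate. *)
Definition gates :=
  for_vertices (Let 2 (Get 1 (Var 1)) ;; Put 8 (Var 2) (Var 2) ;;
    for_nbrs (If (Eq (Plus (Get 4 (Var 4)) (Cst 1)) (Get 4 (Var 2)))
      (If (Minus (Get 7 (Get 8 (Var 4))) (Get 7 (Get 8 (Var 2))))
        (Put 8 (Var 2) (Get 8 (Var 4))) Skip) Skip)).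

(** Array 4 is shifted by 1, so when variable [x] holds [k] this selects the vertices at distance
    [k - 1] from [K]. *)
Definition gate_weights x :=
  for_vertices (If (Eq (Get 4 (Var 1)) (Var x))
    (Put 6 (Get 8 (Var 1)) (Plus (Get 6 (Get 8 (Var 1))) (Cst 1))) Skip).

Definition enqueue w := Put 1 (Var 5) (Var w) ;; Let 5 (Plus (Var 5) (Cst 1)).

Definition bfs_init j a :=
  Let 5 (Cst 0) ;;
  for_vertices (Put j (Var 1) (Cst 0) ;;
    If a (Put j (Var 1) (Cst 1) ;; enqueue 1) Skip).

(** The loop index is the head of the queue. In a connected graph each vertex is enqueued exactly
    once, so there are exactly [n] extractions. *)
Definition bfs_loop j :=
  for_vertices (Let 2 (Get 1 (Var 1)) ;;
    for_nbrs (If (Get j (Var 4)) Skip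
      (Put j (Var 4) (Plus (Get j (Var 2)) (Cst 1)) ;; enqueue 4))).

Definition bfs j a := bfs_init j a ;; bfs_loop j.

(** * Specifications of the loops *)

Section Loops.
Variables (n : nat) (adj : 'I_n -> seq 'I_n) (M0 : nat -> nat).
Hypothesis M0_start : forall v : 'I_n, M0 (v + 2) = M0 (v + 1) + size (adj v).
Hypothesis M0_nbr : forall (v : 'I_n) l w r, adj v = l ++ w :: r ->
  M0 (M0 (v + 1) + size l) = w.

Definition input (s : store) := vars s 0 = n /\ arrs s 0 =1 M0.

Lemma input_frame c s : input s -> 0 \notin written_vars c -> 0 \notin written_arrs c ->
  input (sem c s).
Proof. by move=> [n0 M0E] wv wa; rewrite /input vars_frame // arrs_frame. Qed.

(** [s2] is the store after the tick and [s3] the one after the increment of the index, given by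
    their fields so that these updates stay out of the invariants. *)
Lemma for_vertices_ind (I : nat -> store -> Prop) c s :
  vars s 0 = n -> 0 \notin written_vars c -> 1 \notin written_vars c ->
  (forall s', (forall x, x != 1 -> vars s' x = vars s x) -> arrs s' = arrs s ->
     time s' = (time s).+2 -> I 0 s') ->
  (forall i s1 s2 s3, i < n -> vars s1 1 = i -> vars s1 0 = n -> I i s1 ->
     vars s2 = vars s1 -> arrs s2 = arrs s1 -> time s2 = (time s1).+1 ->
     (forall x, x != 1 -> vars s3 x = vars (sem c s2) x) -> arrs s3 = arrs (sem c s2) ->
     time s3 = (time (sem c s2)).+1 -> I i.+1 s3) ->
  I n (sem (for_vertices c) s).
Proof.
move=> n0 w0 w1 I0 IS; rewrite /for_vertices /= (_ : upd (vars s) 1 0 0 = n) //.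
set S := iter _ _ _; suff: [/\ vars S 1 = n, vars S 0 = n & I n S] by case.
apply: (iter_ind (I := fun i s' => [/\ vars s' 1 = i, vars s' 0 = n & I i s'])) => [|i s' lt_in].
  by split=> //; apply: I0 => //= x /negPf x1; rewrite updE x1.
case=> s1 s0 Is; split; rewrite /= ?updE /=.
- by rewrite vars_frame //= s1 addn1.
- by rewrite vars_frame.
- apply: (IS i s' (tick s')) => //= x /negPf x1; by rewrite updE x1.
Qed.

Definition inner c :=
  [&& loop_free c, all (fun x => x \notin written_vars c) [:: 0; 2; 3; 4] &
      0 \notin written_arrs c].

(** The invariant depends on the scanned prefix of the adjacency list. It ignores time, since a
    loop-free body costs at most [steps c] per neighbour. *)
Lemma for_nbrs_ind (I : seq 'I_n -> (nat -> nat) -> (nat -> nat -> nat) -> Prop) c s (v : 'I_n) :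
  input s -> vars s 2 = v -> inner c ->
  (forall V, (forall x, x != 3 -> V x = vars s x) -> I [::] V (arrs s)) ->
  (forall l w r s1 V1 V2, adj v = l ++ w :: r -> input s1 -> vars s1 2 = v -> vars s1 4 = w ->
     I l V1 (arrs s1) -> (forall x, x != 4 -> vars s1 x = V1 x) ->
     (forall x, x != 3 -> V2 x = vars (sem c s1) x) -> I (rcons l w) V2 (arrs (sem c s1))) ->
  let s' := sem (for_nbrs c) s in
  [/\ I (adj v) (vars s') (arrs s'), input s' &
      time s' <= time s + 2 + size (adj v) * (steps c + 3)].
Proof.
move=> [n0 M0E] s2 /and3P[lc /and5P[w0 w2 w3 w4 _] a0] I0 IS.
pose f s := sem (Let 4 (Get 0 (Var 3)) ;; c ;; Let 3 (Plus (Var 3) (Cst 1))) (tick s).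
pose s1 := Store (upd (vars s) 3 (M0 (v + 1))) (arrs s) (time s).+1.
have -> : sem (for_nbrs c) s = iter (size (adj v)) f (tick s1).
  have -> : size (adj v) =
      eval (vars s1) (arrs s1) (Minus (Get 0 (Plus (Var 2) (Cst 2))) (Var 3)).
    by rewrite /= !updE /= s2 M0E M0_start addKn.
  have e0 : eval (vars s) (arrs s) (Get 0 (Plus (Var 2) (Cst 1))) = M0 (v + 1).
    by rewrite /= s2 M0E.
  by rewrite /s1 -e0.
set s0 := tick s1.
suff: [/\ input (iter (size (adj v)) f s0), vars (iter (size (adj v)) f s0) 2 = v,
    vars (iter (size (adj v)) f s0) 3 = M0 (v + 1) + size (adj v),
    I (take (size (adj v)) (adj v)) (vars (iter (size (adj v)) f s0))
      (arrs (iter (size (adj v)) f s0)) &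
    time (iter (size (adj v)) f s0) <= time s + 2 + size (adj v) * (steps c + 3)].
  by rewrite take_size; case.
apply: (iter_ind (I := fun i s' => [/\ input s', vars s' 2 = v,
  vars s' 3 = M0 (v + 1) + i, I (take i (adj v)) (vars s') (arrs s') &
  time s' <= time s + 2 + i * (steps c + 3)])) => [|i s' lti [[n0' M0E'] s2' s3' Ii ti]].
  split=> //; first by rewrite addn0.
    by rewrite take0; apply: I0 => x /negPf x3; rewrite /= updE x3.
  by rewrite mul0n addn0 /= addn2.
have aE : adj v = take i (adj v) ++ nth v (adj v) i :: drop i.+1 (adj v).
  by rewrite -drop_nth // cat_take_drop.
have M0w : M0 (M0 (v + 1) + i) = nth v (adj v) i.
  by have := M0_nbr aE; rewrite size_take lti.
rewrite /f /= M0E' s3' M0w; set s4 := Store (upd _ 4 _) _ _.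
have in1 : input s4 by split; [exact: n0' | exact: M0E'].
have s1E x : x != 4 -> vars s4 x = vars s' x by move=> /negPf x4; rewrite /= updE x4.
split.
- by have [c0 cM] := input_frame in1 w0 a0; split.
- by rewrite updE /= vars_frame // s1E.
- by rewrite updE /= vars_frame // s1E // s3' -addnA [i + 1]addn1.
- rewrite (take_nth v) //; apply: (IS _ _ _ s4 (vars s') _ aE in1 _ _ Ii s1E).
  + by rewrite s1E.
  + by [].
  + by move=> x /negPf x3; rewrite /= updE x3.
- have := time_loop_free s4 lc; rewrite mulSn /=; lia.
Qed.

(** [a] is evaluated in intermediate stores, hence the quantification over all [V] and [A] that
    differ from [s] only where the loop writes. The later specifications follow this pattern. *)
Lemma fill_spec j a (g : nat -> nat) s : input s -> j != 0 ->
  (forall i V A, i < n -> V 1 = i -> (forall x, x != 1 -> V x = vars s x) ->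
     (forall k, k != j -> A k = arrs s k) -> eval V A a = g i) ->
  let s' := sem (fill j a) s in
  (forall i, i < n -> arrs s' j i = g i) /\ time s' <= time s + 2 + n * 3.
Proof.
move=> [n0 _] j0 ga s'.
suff: [/\ forall i, i < n -> arrs s' j i = g i, time s' <= time s + 2 + n * 3,
    forall x, x != 1 -> vars s' x = vars s x & forall k, k != j -> arrs s' k = arrs s k] by case.
apply: (for_vertices_ind (I := fun m s' => [/\ forall i, i < m -> arrs s' j i = g i,
    time s' <= time s + 2 + m * 3, forall x, x != 1 -> vars s' x = vars s x &
    forall k, k != j -> arrs s' k = arrs s k])) => //.
  by move=> s1 vE aE tE; split => // [|k kj]; rewrite ?tE ?aE //; lia.
move=> i s1 s2 s3 lti s1i s1n [gi ti vi ai] v2 a2 t2 v3 a3 t3; split.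
- move=> k; rewrite ltnS a3 /= eqxx updE v2 a2 s1i (ga i) //; first by case: eqP => [->|ne le] //; apply: gi; lia.
- by rewrite t3 /= t2; lia.
- by move=> x x1; rewrite v3 //= v2 vi.
- by move=> k kj; rewrite a3 /= (negPf kj) a2 ai.
Qed.

(** The initial record 0 need not be the value of [g] at vertex 0. That is harmless: if it is never
    beaten, all values are 0. *)
Lemma argmax_spec x a (g : nat -> nat) s : input s -> 0 < n -> 6 < x ->
  (forall i V A, i < n -> V 1 = i -> (forall y, y != 1 -> y != 6 -> y != x -> V y = vars s y) ->
     A = arrs s -> eval V A a = g i) ->
  let s' := sem (argmax x a) s in
  [/\ vars s' x < n, forall i, i < n -> g i <= g (vars s' x) & time s' <= time s + 4 + n * 6].
Proof.
move=> [n0 _] n_gt0 x6 ga s'.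
suff: [/\ [/\ vars s' x < n, forall i, i < n -> g i <= vars s' 6 &
           vars s' 6 = 0 \/ vars s' 6 = g (vars s' x)], time s' <= time s + 4 + n * 6,
    forall y, y != 1 -> y != 6 -> y != x -> vars s' y = vars s y & arrs s' = arrs s].
  case=> -[xn gmax best] ts _ _; split=> // i lti; have := gmax i lti.
  by case: best => -> //; rewrite leqn0 => /eqP ->.
pose s0 := Store (upd (upd (vars s) x 0) 6 0) (arrs s) (time s).+2.
rewrite {}/s' -[sem _ s]/(sem (for_vertices (If (Minus a (Var 6)) (Let 6 a ;; Let x (Var 1)) Skip)) s0).
have [x0 [x1 x6']] : (x == 0 = false) /\ (x == 1 = false) /\ (x == 6 = false) by lia.
apply: (for_vertices_ind (I := fun m s' => [/\ [/\ vars s' x < n,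
    forall i, i < m -> g i <= vars s' 6 & vars s' 6 = 0 \/ vars s' 6 = g (vars s' x)],
    time s' <= time s + 4 + m * 6,
    forall y, y != 1 -> y != 6 -> y != x -> vars s' y = vars s y & arrs s' = arrs s])).
- by rewrite -[vars s0 0]/(upd (upd (vars s) x 0) 6 0 0) !updE (eq_sym 0 x) x0.
- by rewrite !inE (eq_sym 0 x) x0.
- by rewrite !inE (eq_sym 1 x) x1.
- rewrite -[vars s0]/(upd (upd (vars s) x 0) 6 0) => s1 vE aE tE; split=> //.
  + by rewrite !vE ?x1 // !updE x6' eqxx; split=> //; left.
  + by rewrite tE /=; lia.
  + by move=> y y1 y6 yx; rewrite vE // !updE (negPf y6) (negPf yx).
move=> i s1 s2 s3 lti s1i s1n [[xn gi best] ti vi ai] v2 a2 t2 v3 a3 t3.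
have gE V : V 1 = i -> (forall y, y != 1 -> V y = vars s1 y) -> eval V (arrs s1) a = g i.
  move=> V1 VE; apply: ga => // y y1 y6 yx; by rewrite VE // vi.
have g2 : eval (vars s2) (arrs s2) a = g i by rewrite v2 a2; apply: gE.
have x16 : 6 != x by rewrite eq_sym x6'.
move: v3 a3 t3; rewrite /= g2 v2.
case: (ltnP (vars s1 6) (g i)) => cmp.
  have -> : (g i - vars s1 6 != 0) = true by rewrite -lt0n subn_gt0.
  rewrite /= ?v2 ?a2 ?t2 => v3 a3 t3.
  have e6 : vars s3 6 = g i by rewrite v3 // !updE (negPf x16) eqxx ?gE.
  have ex : vars s3 x = i by rewrite v3 ?x1 // !updE eqxx /= s1i.
  split; rewrite ?e6 ?ex ?a3 ?ai //.
  - split=> //; last by right.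
    by move=> k; rewrite ltnS leq_eqVlt => /orP[/eqP -> //|/gi]; lia.
  - by rewrite t3; lia.
  - by move=> y y1 y6 yx; rewrite v3 // !updE (negPf y6) (negPf yx) vi.
have -> : (g i - vars s1 6 != 0) = false by apply/negbTE; rewrite negbK subn_eq0.
rewrite /= ?v2 ?a2 ?t2 => v3 a3 t3.
have e6 : vars s3 6 = vars s1 6 by rewrite v3.
have ex : vars s3 x = vars s1 x by rewrite v3 ?x1.
split; rewrite ?e6 ?ex ?a3 ?ai //.
- split=> // k; rewrite ltnS leq_eqVlt => /orP[/eqP -> //|/gi]; lia.
- by rewrite t3; lia.
- by move=> y y1 y6 yx; rewrite v3 // vi.
Qed.

Lemma written_vars_nbrs c : written_vars (for_nbrs c) = 3 :: 4 :: written_vars c ++ [:: 3].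
Proof. by []. Qed.

Opaque for_nbrs for_vertices.

(** The arcs scanned by the first [m] iterations; summed over all vertices this gives the linear
    bound. *)
Definition work (q : seq 'I_n) m := \sum_(v <- take m q) size (adj v).

Lemma workS q m v : m < size q -> work q m.+1 = work q m + size (adj (nth v q m)).
Proof. by move=> lt; rewrite /work (take_nth v) // -cats1 big_cat big_seq1. Qed.

Lemma work_total q : uniq q -> size q = n -> work q n = \sum_v size (adj v).
Proof.
move=> uq sq; rewrite /work take_oversize ?sq //.
have [_ qE] : (size q = size (enum 'I_n)) * (q =i enum 'I_n).
  by apply: uniq_min_size => // [v _|]; rewrite ?mem_enum // size_enum_ord sq.
by rewrite -[RHS]big_enum; apply/perm_big/uniq_perm => //; apply: enum_uniq.
Qed.

Lemma work_enum : work (enum 'I_n) n = \sum_v size (adj v).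
Proof. by rewrite work_total ?enum_uniq ?size_enum_ord. Qed.

Lemma nbr_sum_spec a (g : nat -> nat) s : input s ->
  (forall i V A, i < n -> V 1 = i ->
     (forall x, x \notin [:: 1; 2; 3; 4; 7] -> V x = vars s x) ->
     (forall k, k != 7 -> A k = arrs s k) -> eval V A a = g i) ->
  let s' := sem (nbr_sum a) s in
  (forall v : 'I_n, arrs s' 7 v = if g v == 0 then 0 else (\sum_(w <- adj v) arrs s 6 w).+1) /\
  time s' <= time s + 2 + n * 9 + 4 * \sum_v size (adj v).
Proof.
move=> ins ga s'; pose h (v : 'I_n) := if g v == 0 then 0 else (\sum_(w <- adj v) arrs s 6 w).+1.
suff: [/\ input s', forall x, x \notin [:: 1; 2; 3; 4; 7] -> vars s' x = vars s x,
    forall k, k != 7 -> arrs s' k = arrs s k,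
    forall v : 'I_n, v < n -> arrs s' 7 v = h v &
    time s' <= time s + 2 + n * 9 + 4 * work (enum 'I_n) n].
  case=> _ _ _ h7 ts; split=> [v|]; first by rewrite h7 ?ltn_ord.
  by rewrite -work_enum.
have [n0 _] := ins.
apply: (for_vertices_ind (I := fun m s' => [/\ input s',
    forall x, x \notin [:: 1; 2; 3; 4; 7] -> vars s' x = vars s x,
    forall k, k != 7 -> arrs s' k = arrs s k,
    forall v : 'I_n, v < m -> arrs s' 7 v = h v &
    time s' <= time s + 2 + m * 9 + 4 * work (enum 'I_n) m])) => //.
  move=> s1 vE aE tE; split=> //; last by rewrite tE /work take0 big_nil; lia.
  - by case: ins => _ M0E; split; rewrite ?vE ?aE.
  - by move=> x; rewrite inE negb_or => /andP[x1 _]; apply: vE.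
  - by rewrite aE.
move=> i s1 s2 s3 lti s1i s1n [in1 vi ai hi ti] v2 a2 t2 v3 a3 t3.
pose v := Ordinal lti.
pose c := Let 7 (Plus (Var 7) (Get 6 (Var 4))).
pose s4 := Store (upd (upd (vars s2) 2 i) 7 0) (arrs s2) (time s2).+2.
pose s5 := Store (upd (vars s4) 7 1) (arrs s4) (time s4).+2.
pose s6 := if g i != 0 then sem (for_nbrs c) s5 else tick (tick s4).
have g4 : eval (vars s4) (arrs s4) a = g i.
  apply: (ga _ _ _ lti); first by rewrite -s1i -v2.
    move=> x xn; rewrite -vi // -v2; move: xn; rewrite !inE !negb_or.
    by case/and5P=> _ /negPf x2 _ _ /negPf x7; rewrite /= !updE x7 x2.
  by move=> k k7; rewrite /= a2 ai.
have semE : sem (Let 2 (Var 1) ;; Let 7 (Cst 0) ;;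
    If a (Let 7 (Cst 1) ;; for_nbrs c) Skip ;; Put 7 (Var 2) (Var 7)) s2 =
    sem (Put 7 (Var 2) (Var 7)) s6.
  pose S := Store (upd (upd (vars s2) 2 (vars s2 1)) 7 0) (arrs s2) (time s2).+2.
  transitivity (sem (Put 7 (Var 2) (Var 7)) (if eval (vars S) (arrs S) a != 0 then
    sem (for_nbrs c) (Store (upd (vars S) 7 1) (arrs S) (time S).+2) else tick (tick S))).
    by [].
  have -> : S = s4 by rewrite /S /s4 v2 s1i.
  by rewrite /s6 -g4.
have in4 : input s4.
  by case: in1 => n0' M0E; split=> [|x]; [rewrite /= v2 | rewrite /= a2].
have [in6 v6 a6 acc6 t6] : [/\ input s6,
    forall x, x \notin [:: 1; 2; 3; 4; 7] -> vars s6 x = vars s1 x, arrs s6 = arrs s1,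
    vars s6 2 = i /\ vars s6 7 = h v & time s6 <= time s1 + 7 + 4 * size (adj v)].
  have v4E x : x \notin [:: 1; 2; 3; 4; 7] -> vars s4 x = vars s1 x.
    rewrite !inE !negb_or => /and5P[x1 x2 x3 x4 x7].
    by rewrite /= !updE (negPf x2) (negPf x7) v2.
  rewrite /s6 /h /=; case: eqP => gi /=.
    by split=> //; rewrite ?t2 //; lia.
  have in5 : input s5 by case: in4.
  have := @for_nbrs_ind (fun l V A => V 7 = (\sum_(w <- l) arrs s 6 w).+1 /\
    A = arrs s1) c s5 v in5 erefl isT.
  case=> [V VE||[acc aE] [n0' M0E] ts].
  - by rewrite VE //= big_nil a2.
  - move=> l w r s7 V1 V2 _ _ _ s7w [acc aE] VE V2E.
    split=> //; rewrite V2E //= updE /= VE // acc aE ai // s7w.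
    by rewrite -cats1 big_cat big_seq1 addSn.
  split=> //.
  - move=> x xn; move: (xn); rewrite !inE !negb_or => /and5P[x1 x2 x3 x4 x7].
    rewrite vars_frame; last by rewrite written_vars_nbrs !inE !negb_or x3 x4 x7.
    by rewrite -[vars s5]/(upd (vars s4) 7 1) updE (negPf x7) v4E.
  - split; last exact: acc.
    by rewrite vars_frame ?written_vars_nbrs.
  - by move: ts; rewrite /= t2; lia.
have {}a3 : arrs s3 = fun k => if k == 7 then upd (arrs s1 7) i (h v) else arrs s1 k.
  by rewrite a3 semE /= acc6.1 acc6.2 a6.
have {}v3 x : x \notin [:: 1; 2; 3; 4; 7] -> vars s3 x = vars s x.
  move=> xn; move: (xn); rewrite !inE !negb_or => /and5P[x1 _ _ _ _].
  by rewrite v3 // semE /= v6 // vi.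
split=> //.
- case: in1 => n0' M0E; split; first by rewrite v3 // n0.
  by move=> x; rewrite a3 /= M0E.
- by move=> k k7; rewrite a3 (negPf k7) ai.
- move=> w; rewrite ltnS leq_eqVlt a3 eqxx updE => /orP[/eqP wi|wi].
    have -> : w = v by apply: val_inj.
    by rewrite eqxx.
  by rewrite ltn_eqF // hi.
- rewrite (workS v) ?size_enum_ord // t3 semE /=.
  have -> : nth v (enum 'I_n) i = v by rewrite -[i]/(val v) nth_ord_enum.
  by move: t6 ti; lia.
Qed.

Definition queue (q : seq 'I_n) s :=
  vars s 5 = size q /\ forall i v, i < size q -> arrs s 1 i = nth v q i.

Lemma bfs_init_spec j a (g : nat -> bool) s : input s -> 1 < j ->
  (forall i V A, i < n -> V 1 = i -> (forall x, x != 1 -> x != 5 -> V x = vars s x) ->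
     (forall k, k != 1 -> k != j -> A k = arrs s k) -> (eval V A a != 0) = g i) ->
  let s' := sem (bfs_init j a) s in
  [/\ input s', forall v : 'I_n, arrs s' j v = g v,
    exists q : seq 'I_n, [/\ uniq q, forall v : 'I_n, (v \in q) = g v & queue q s'] &
    time s' <= time s + 3 + n * 7].
Proof.
move=> ins j1 ga s'; have [n0 M0E] := ins.
pose qs m := [seq v <- take m (enum 'I_n) | g (val v)].
suff: [/\ input s', forall v : 'I_n, v < n -> arrs s' j v = g v & queue (qs n) s'] /\
    [/\ forall x, x != 1 -> x != 5 -> vars s' x = vars s x,
    forall k, k != 1 -> k != j -> arrs s' k = arrs s k & time s' <= time s + 3 + n * 7].
  case=> -[in' aj qn] [_ _ ts]; split=> // [v|]; first by rewrite aj.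
  exists (qs n); split=> //; first exact/filter_uniq/take_uniq/enum_uniq.
  by move=> v; rewrite mem_filter take_oversize ?size_enum_ord // mem_enum andbT.
pose s0 := Store (upd (vars s) 5 0) (arrs s) (time s).+1.
rewrite {}/s' -[sem _ s]/(sem (for_vertices (Put j (Var 1) (Cst 0) ;;
    If a (Put j (Var 1) (Cst 1) ;; enqueue 1) Skip)) s0).
have [j0 [j1' j1'']] : (j == 0 = false) /\ (j == 1 = false) /\ (1 == j = false) by lia.
apply: (for_vertices_ind (I := fun m s' => [/\ input s',
    forall v : 'I_n, v < m -> arrs s' j v = g v & queue (qs m) s'] /\
    [/\ forall x, x != 1 -> x != 5 -> vars s' x = vars s x,
    forall k, k != 1 -> k != j -> arrs s' k = arrs s k & time s' <= time s + 3 + m * 7])) => //.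
  move=> s1 vE aE tE; split; split=> //; rewrite ?aE //.
  - by split; rewrite ?vE ?aE.
  - by split; rewrite ?vE //= /qs take0.
  - by move=> x x1 /negPf x5; rewrite vE //= updE x5.
  - by rewrite tE /=; lia.
move=> i s1 s2 s3 lti s1i s1n [[in1 aj q1] [vi ai ti]] v2 a2 t2.
have qsS : qs i.+1 = if g i then rcons (qs i) (Ordinal lti) else qs i.
  rewrite /qs (take_nth (Ordinal lti)) ?size_enum_ord // filter_rcons.
  by rewrite (_ : nth _ _ _ = Ordinal lti) // -[i]/(val (Ordinal lti)) nth_ord_enum.
have gE : (eval (vars s2) (fun k => if k == j then upd (arrs s2 j) i 0 else arrs s2 k) a != 0)
    = g i.
  apply: (ga _ _ _ lti); rewrite ?v2 // => k k1 /negPf kj.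
  by rewrite kj a2 ai // kj.
case: q1 => q5 qn; case: (in1) => in10 in1M.
have ltv (v : 'I_n) : v < i.+1 -> v < i \/ v = Ordinal lti.
  by rewrite ltnS leq_eqVlt => /orP[/eqP vi'|]; [right; apply: val_inj | left].
move: gE; rewrite /= v2 s1i a2 => ->; case gi: (g i); rewrite /= => v3 a3 t3.
- have a3E k : arrs s3 k = if k == 1 then upd (arrs s1 1) (size (qs i)) i else
      if k == j then upd (upd (arrs s1 j) i 0) i 1 else arrs s1 k.
    by rewrite a3 /= ?eqxx ?j1'' ?s1i ?q5; case: (k == 1); case: (k == j).
  have v35 : vars s3 5 = (size (qs i)).+1 by rewrite v3 //= updE /= q5 addn1.
  split; split.
  + split; first by rewrite v3 //= v2.
    by move=> x; rewrite a3E (eq_sym 0 j) j0 /= in1M.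
  + move=> v; rewrite a3E j1' eqxx => /ltv[vi'|->]; last by rewrite !updE eqxx gi.
    by rewrite !updE ltn_eqF ?aj.
  + rewrite /queue v35 qsS gi size_rcons; split=> // k v.
    rewrite ltnS leq_eqVlt a3E /= updE nth_rcons => /orP[/eqP ->|lk].
      by rewrite ltnn eqxx.
    by rewrite lk ltn_eqF // (qn _ v).
  + by move=> x x1 x5; rewrite v3 //= updE (negPf x5) vi.
  + by move=> k k1 kj; rewrite a3E (negPf k1) (negPf kj) ai.
  + by rewrite t3 t2; lia.
- have a3E k : arrs s3 k = if k == j then upd (arrs s1 j) i 0 else arrs s1 k.
    by rewrite a3.
  split; split.
  + split; first by rewrite v3.
    by move=> x; rewrite a3E (eq_sym 0 j) j0 in1M.
  + move=> v; rewrite a3E eqxx => /ltv[vi'|->]; last by rewrite !updE eqxx gi.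
    by rewrite updE ltn_eqF ?aj.
  + rewrite /queue qsS gi v3 // q5; split=> // k v lk.
    by rewrite a3E j1'' (qn _ v).
  + by move=> x x1 x5; rewrite v3 //= vi.
  + by move=> k k1 kj; rewrite a3E (negPf kj) ai.
  + by rewrite t3 t2; lia.
Qed.

(** * Breadth-first search and computation of gates *)

Section Search.
Variables (e : rel 'I_n).
Hypothesis sym_e : symmetric e.
Hypothesis adjE : forall v w, (w \in adj v) = e v w.

Section Layers.
Variables (K : {set 'I_n}) (f : 'I_n -> nat).
Hypothesis lay : layering e K f.
Hypothesis K0 : K != set0.

Definition by_layers (q : seq 'I_n) :=
  forall v i k, i <= k < size q -> f (nth v q i) <= f (nth v q k).

Definition scanned (q : seq 'I_n) h :=
  forall v w i, i < h -> i < size q -> e (nth v q i) w -> w \in q.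

(** Take a predecessor of [w]. If it is queued, it is not before position [h], or [w] would be
    queued too, so its layer is at least that of the head; if not, induct. *)
Lemma unreached q h v w : {subset K <= q} -> by_layers q -> scanned q h ->
  h < size q -> w \notin q -> f (nth v q h) < f w.
Proof.
case: lay => f0 _ fpred Kq qlay qscan hq.
move: {2}(f w) (erefl (f w)) => k; elim: k w => [|k IH] w fw wq.
  by case/negP: wq; apply: Kq; rewrite -f0 fw.
have [u uw fu] := fpred w k fw; have [uq|uq] := boolP (u \in q).
  have iq : index u q < size q by rewrite index_mem.
  rewrite fw ltnS -fu -(nth_index v uq); apply: qlay; rewrite iq andbT leqNgt.
  by apply/negP => ih; case/negP: wq; apply: (qscan v _ _ ih iq); rewrite nth_index.
by apply: leq_trans (IH u fu uq) _; rewrite fu fw.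
Qed.

Lemma all_reached q : {subset K <= q} -> scanned q (size q) -> forall v, v \in q.
Proof.
case: lay => f0 _ fpred Kq qscan w; move: {2}(f w) (erefl (f w)) => k.
elim: k w => [|k IH] w fw; first by apply: Kq; rewrite -f0 fw.
have [u uw fu] := fpred w k fw; have uq := IH u fu.
by apply: (qscan w w (index u q)); rewrite ?index_mem // nth_index.
Qed.

Lemma by_layers_rcons q w : by_layers q -> (forall v, v \in q -> f v <= f w) ->
  by_layers (rcons q w).
Proof.
move=> qlay wmax v i k; rewrite size_rcons ltnS => /andP[ik kq].
rewrite !nth_rcons; case: (ltngtP k (size q)) kq => // [kq _|kE _].
  by rewrite (leq_ltn_trans ik kq); apply: qlay; rewrite ik.
case: (ltngtP i (size q)) => [iq|iq|//]; first by apply: wmax; rewrite mem_nth.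
by move: ik; rewrite kE leqNgt iq.
Qed.

Lemma uniq_full (q : seq 'I_n) : uniq q -> (forall v, v \in q) -> size q = n.
Proof.
move=> uq full; rewrite -(card_uniqP uq) -[RHS](card_ord n); apply: eq_card => v.
by rewrite full.
Qed.

Lemma uniq_size_ord (q : seq 'I_n) : uniq q -> size q <= n.
Proof. by move=> uq; rewrite -(card_uniqP uq) -[X in _ <= X](card_ord n) max_card. Qed.

Lemma bfs_loop_spec j s q0 : 1 < j -> input s -> uniq q0 -> (forall v, (v \in q0) = (v \in K)) ->
  queue q0 s -> (forall v : 'I_n, arrs s j v = (v \in K)) ->
  let s' := sem (bfs_loop j) s in
  [/\ forall v : 'I_n, arrs s' j v = (f v).+1,
    exists q : seq 'I_n, [/\ uniq q, size q = n, by_layers q & queue q s'] &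
    time s' <= time s + 2 + n * 5 + 9 * \sum_v size (adj v)].
Proof.
move=> j1 ins uq0 q0K qu0 aj0 s'; have [f0 fedge fpred] := lay; have [n0 _] := ins.
pose good q h s1 := [/\ uniq q, {subset K <= q}, by_layers q, scanned q h &
  forall v : 'I_n, arrs s1 j v = if v \in q then (f v).+1 else 0].
suff: exists q, [/\ input s', good q n s' & queue q s'] /\
    [/\ forall v w, n < size q -> w \in q -> f w <= (f (nth v q n)).+1 &
        time s' <= time s + 2 + n * 5 + 9 * work q n].
  case=> q [[_ [uq Kq qlay qscan aj] qu] [_ ts]].
  have qfull : forall v, v \in q.
    apply: all_reached => // v w i iq _; exact: (qscan v w i (leq_trans iq (uniq_size_ord uq)) iq).
  have sq := uniq_full uq qfull; split.
  - by move=> v; rewrite aj qfull.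
  - by exists q.
  - by rewrite -(work_total uq sq).
apply: (for_vertices_ind (I := fun h s' => exists q, [/\ input s', good q h s' & queue q s'] /\
    [/\ forall v w, h < size q -> w \in q -> f w <= (f (nth v q h)).+1 &
        time s' <= time s + 2 + h * 5 + 9 * work q h])) => //.
  move=> s1 vE aE tE; exists q0; split; split=> //.
  - by case: ins => _ M0E; split; rewrite ?vE ?aE.
  - have ql v : v \in q0 -> f v = 0 by rewrite q0K -f0 => /eqP.
    split.
    + exact: uq0.
    + by move=> v; rewrite q0K.
    + by move=> v i k /andP[ik kq]; rewrite !ql ?mem_nth // (leq_ltn_trans ik kq).
    + by [].
    + move=> v; rewrite aE aj0 q0K; case: (boolP (v \in K)) => //.
      by rewrite -f0 => /eqP ->.
  - by case: qu0 => q5 q1; split; rewrite ?vE ?aE.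
  - by move=> v w _; rewrite q0K -f0 => /eqP ->.
  - by rewrite tE /work take0 big_nil; lia.
move=> h s1 s2 s3 lth s1h s1n [q [[in1 [uq Kq qlay qscan aj] [q5 q1]] [qtop ti]]].
move=> v2 a2 t2 v3 a3 t3.
(* A queue exhausted before [n] extractions would already contain all [n] vertices. *)
have hq : h < size q.
  rewrite ltnNge; apply/negP => qh.
  have full : forall v, v \in q.
    apply: all_reached => // v w i iq iq'; exact: (qscan v w i (leq_trans iq qh) iq').
  by move: qh; rewrite (uniq_full uq full) leqNgt lth.
pose u := nth (Ordinal lth) q h.
have uE v : nth v q h = u by apply: set_nth_default.
pose c := If (Get j (Var 4)) Skip (Put j (Var 4) (Plus (Get j (Var 2)) (Cst 1)) ;; enqueue 4).
pose s4 := Store (upd (vars s2) 2 u) (arrs s2) (time s2).+1.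
have in4 : input s4 by case: in1 => n1 M1; split; rewrite /= ?v2 ?a2.
have semE : sem (Let 2 (Get 1 (Var 1)) ;; for_nbrs c) s2 = sem (for_nbrs c) s4.
  transitivity (sem (for_nbrs c)
    (Store (upd (vars s2) 2 (arrs s2 1 (vars s2 1))) (arrs s2) (time s2).+1)) => //.
  have -> : arrs s2 1 (vars s2 1) = u by rewrite a2 v2 s1h (q1 _ (Ordinal lth)).
  by [].
have [j0 [j1' j1'']] : (0 == j = false) /\ (j == 1 = false) /\ (1 == j = false) by lia.
have uq' : u \in q by rewrite mem_nth.
pose I (l : seq 'I_n) (V : nat -> nat) (A : nat -> nat -> nat) := exists q', [/\
  [/\ uniq q', {subset K <= q'}, by_layers q', scanned q' h &
      forall v : 'I_n, A j v = if v \in q' then (f v).+1 else 0],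
  V 5 = size q' /\ (forall i v, i < size q' -> A 1 i = nth v q' i),
  (exists r, q' = q ++ r), {subset l <= q'} & forall w, w \in q' -> f w <= (f u).+1].
have := @for_nbrs_ind I c s4 u in4 erefl.
case.
- apply/and3P; split=> //.
  by rewrite (_ : written_arrs c = [:: j; 1]) // !inE j0.
- move=> V VE; exists q; split=> //.
  + by rewrite /= a2.
  + by rewrite VE //= v2 a2.
  + by exists [::]; rewrite cats0.
  + by move=> w wq; rewrite -(uE w); apply: qtop.
- move=> l w r s5 V1 V2 uadj in5 s5u s5w [q' [[uq1 Kq1 qlay1 qscan1 aj1] [V5 A1] [r' q'E] lq' top1]] VE V2E.
  have uw : e u w by rewrite -adjE uadj mem_cat inE eqxx orbT.
  have ujE : arrs s5 j u = (f u).+1 by rewrite aj1 q'E mem_cat uq'.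
  have hq1 : h < size q' by rewrite q'E size_cat ltn_addr.
  have uE1 v : nth v q' h = u by rewrite q'E nth_cat hq uE.
  move: V2E; rewrite /c /= s5w aj1; case: (boolP (w \in q')) => wq /= V2E.
    exists q'; split=> //; first by rewrite V2E //= VE.
      by exists r'.
    by move=> x; rewrite mem_rcons inE => /orP[/eqP -> //|/lq'].
  (* The edge gives the upper bound; [unreached] gives the lower one. *)
  have fw : f w = (f u).+1.
    apply/eqP; rewrite eqn_leq fedge //=.
    by have := unreached w Kq1 qlay1 qscan1 hq1 wq; rewrite uE1.
  have V25 : V2 5 = (size q').+1 by rewrite V2E //= updE /= VE // V5 addn1.
  have S5 : vars s5 5 = size q' by rewrite VE.
  exists (rcons q' w); split.
  + split.
    * by rewrite rcons_uniq wq.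
    * by move=> x /Kq1; rewrite mem_rcons inE orbC => ->.
    * by apply: by_layers_rcons => // x /top1; rewrite fw.
    * move=> v x i ih; rewrite size_rcons nth_rcons ltnS => iq.
      have iq' := leq_trans ih (ltnW hq1).
      by rewrite iq' => /(qscan1 _ _ _ ih iq'); rewrite mem_rcons inE orbC => ->.
    * move=> x; rewrite j1' eqxx updE s5u ujE addn1 -fw mem_rcons inE.
      by rewrite -val_eqE /=; case: eqP => [/val_inj -> //|_] /=; rewrite aj1.
  + rewrite V25 size_rcons; split=> // i v; rewrite ltnS leq_eqVlt j1'' /= updE S5 nth_rcons.
    case/orP=> [/eqP ->|lti]; first by rewrite !eqxx ltnn ?s5w.
    by rewrite lti ltn_eqF // (A1 _ v).
  + by exists (rcons r' w); rewrite q'E rcons_cat.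
  + by move=> x; rewrite !mem_rcons !inE => /orP[->//|/lq' ->]; rewrite orbT.
  + by move=> x; rewrite mem_rcons inE => /orP[/eqP ->|/top1 //]; rewrite fw.
move=> [q' [[uq1 Kq1 qlay1 qscan1 aj1] [V5 A1] [r' q'E] lq' top1]] [n5 M5] ts.
have hq1 : h < size q' by rewrite q'E size_cat ltn_addr.
have uE1 v : nth v q' h = u by rewrite q'E nth_cat hq uE.
exists q'; split; split.
- by split; rewrite ?v3 ?a3 ?semE.
- split=> //; last by rewrite a3 semE.
  move=> v w i; rewrite ltnS leq_eqVlt => /orP[/eqP -> _|ih]; last exact: qscan1.
  by rewrite uE1 -adjE => /lq'.
- by split; rewrite ?v3 ?a3 ?semE.
- move=> v w hq2 /top1 /leq_trans; apply; rewrite ltnS -(uE1 v); apply: qlay1.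
  by rewrite leqnSn.
- rewrite (workS (Ordinal lth)) // uE1 t3 semE.
  have -> : work q' h = work q h by rewrite /work q'E takel_cat // ltnW.
  by move: ts ti; rewrite /= t2 /work; lia.
Qed.

Lemma bfs_spec j a (g : nat -> bool) s : 1 < j -> input s ->
  (forall i V A, i < n -> V 1 = i -> (forall x, x != 1 -> x != 5 -> V x = vars s x) ->
     (forall k, k != 1 -> k != j -> A k = arrs s k) -> (eval V A a != 0) = g i) ->
  (forall v : 'I_n, (v \in K) = g v) ->
  let s' := sem (bfs j a) s in
  [/\ forall v : 'I_n, arrs s' j v = (f v).+1,
    exists q : seq 'I_n, [/\ uniq q, size q = n, by_layers q & queue q s'] &
    time s' <= time s + 5 + n * 12 + 9 * \sum_v size (adj v)].
Proof.
move=> j1 ins ga gK s'; have [in1 aj1 [q0 [uq0 q0g qu0]] t1] := bfs_init_spec ins j1 ga.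
have [||aj' qu' t'] := bfs_loop_spec j1 in1 uq0 _ qu0 _.
- by move=> v; rewrite q0g gK.
- by move=> v; rewrite aj1 gK.
split=> //; rewrite /s' /bfs; move: t' t1.
by move=> t' t1; apply: leq_trans t' _; lia.
Qed.

(** Only what the loop ensures locally; [gated_gate] derives that the recorded vertex really is a
    gate. *)
Definition gated (G : nat -> nat) (C : nat -> nat) (v : 'I_n) :=
  [/\ forall w, e v w -> f v = (f w).+1 -> C (G w) <= C (G v),
      G v = v \/ exists w, [/\ e v w, f v = (f w).+1 & G v = G w] & C v <= C (G v)].

Lemma upd_ord A (u x : 'I_n) y : upd A u y x = if x == u then y else A x.
Proof. by rewrite updE val_eqE. Qed.

(** The queue is sorted by layers, so the gates of all parents are final when a vertex is
    processed. *)
Lemma gates_spec s q : input s -> uniq q -> size q = n -> by_layers q -> queue q s ->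
  (forall v : 'I_n, arrs s 4 v = (f v).+1) ->
  let s' := sem gates s in
  (forall v, gated (arrs s' 8) (arrs s 7) v) /\
  time s' <= time s + 2 + n * 6 + 8 * \sum_v size (adj v).
Proof.
clear lay K0; move=> ins uq sq qlay qu af s'; have [n0 _] := ins.
have qfull v : v \in q.
  have [_ ->] : (size q = size (enum 'I_n)) * (q =i enum 'I_n).
    by apply: uniq_min_size => // [w _|]; rewrite ?mem_enum // size_enum_ord sq.
  by rewrite mem_enum.
have lower m v w : v \in take m q -> f w < f v -> w \in take m q.
  rewrite !in_take // => vm fwv; apply: leq_ltn_trans vm; rewrite leqNgt; apply/negP => le.
  have := qlay v (index v q) (index w q).
  by rewrite (ltnW le) index_mem !nth_index // qfull leqNgt fwv => /(_ isT).
suff: [/\ input s', forall k, k != 8 -> arrs s' k = arrs s k,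
    forall v, v \in take n q -> gated (arrs s' 8) (arrs s 7) v &
    time s' <= time s + 2 + n * 6 + 8 * work q n].
  case=> _ _ gs ts; split; last by rewrite -(work_total uq sq).
  by move=> v; apply: gs; rewrite take_oversize ?sq.
apply: (for_vertices_ind (I := fun m s' => [/\ input s',
    forall k, k != 8 -> arrs s' k = arrs s k,
    forall v, v \in take m q -> gated (arrs s' 8) (arrs s 7) v &
    time s' <= time s + 2 + m * 6 + 8 * work q m])) => //.
  move=> s1 vE aE tE; split; rewrite ?aE ?take0 //.
  - by case: ins => _ M0E; split; rewrite ?vE ?aE.
  - by rewrite tE /work take0 big_nil; lia.
move=> i s1 s2 s3 lti s1i s1n [in1 ai gi ti] v2 a2 t2 v3 a3 t3.
pose u := nth (Ordinal lti) q i.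
have uE v : nth v q i = u by apply: set_nth_default; rewrite sq.
pose s4 := Store (upd (vars s2) 2 u)
  (fun k => if k == 8 then upd (arrs s2 8) u u else arrs s2 k) (time s2).+2.
pose c := If (Eq (Plus (Get 4 (Var 4)) (Cst 1)) (Get 4 (Var 2)))
      (If (Minus (Get 7 (Get 8 (Var 4))) (Get 7 (Get 8 (Var 2))))
        (Put 8 (Var 2) (Get 8 (Var 4))) Skip) Skip.
have semE : sem (Let 2 (Get 1 (Var 1)) ;; Put 8 (Var 2) (Var 2) ;; for_nbrs c) s2 =
    sem (for_nbrs c) s4.
  pose x := arrs s2 1 (vars s2 1).
  transitivity (sem (for_nbrs c) (Store (upd (vars s2) 2 x)
    (fun k => if k == 8 then upd (arrs s2 8) x x else arrs s2 k) (time s2).+2)) => //.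
  have -> : x = u.
    by rewrite /x a2 v2 s1i ai //; case: qu => _ q1; rewrite (q1 _ (Ordinal lti)) ?sq.
  by [].
have in4 : input s4 by case: in1 => n1 M1; split; rewrite /= ?v2 ?a2.
pose G0 := arrs s4 8; pose C := arrs s 7.
have G0E : G0 = upd (arrs s1 8) u u by rewrite /G0 /= a2.
pose I (l : seq 'I_n) (V : nat -> nat) (A : nat -> nat -> nat) :=
  [/\ forall k, k != 8 -> A k = arrs s k, forall x, x != u -> A 8 x = G0 x,
      forall w, w \in l -> f u = (f w).+1 -> C (G0 w) <= C (A 8 u),
      A 8 u = u \/ exists w, [/\ e u w, f u = (f w).+1 & A 8 u = G0 w] &
      C u <= C (A 8 u)].
have := @for_nbrs_ind I c s4 u in4 erefl isT.
case.
- move=> V VE; split=> //.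
  + by move=> k k8; rewrite /= (negPf k8) a2 ai.
  + by left; rewrite -/G0 G0E upd_ord eqxx.
  + by rewrite -/G0 G0E upd_ord eqxx.
- move=> l w r s5 V1 V2 uadj in5 s5u s5w [ak a8 wmax best Cu] VE V2E.
  have uw : e u w by rewrite -adjE uadj mem_cat inE eqxx orbT.
  have test : (eval (vars s5) (arrs s5) (Eq (Plus (Get 4 (Var 4)) (Cst 1)) (Get 4 (Var 2))) != 0)
      = (f u == (f w).+1).
    rewrite eval_Eq /= s5u s5w !ak // !af addn1 eqSS (eq_sym (f u)).
    by case: (_ == f u).
  have wu : f u = (f w).+1 -> w != u.
    by move=> fuw; apply/eqP => wE; move: fuw; rewrite wE => /n_Sn.
  have -> : sem c s5 = if f u == (f w).+1 then
      sem (If (Minus (Get 7 (Get 8 (Var 4))) (Get 7 (Get 8 (Var 2))))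
        (Put 8 (Var 2) (Get 8 (Var 4))) Skip) (tick s5) else tick (tick s5) by rewrite -test.
  case: (eqVneq (f u) (f w).+1) => fuw; last first.
    split=> // x; rewrite mem_rcons inE => /orP[/eqP -> fux|]; last exact: wmax.
    by rewrite fux eqxx in fuw.
  rewrite /= s5u s5w ak // a8 ?wu //; case: (ltnP (C (arrs s5 8 u)) (C (G0 w))) => cmp.
    have -> : (C (G0 w) - C (arrs s5 8 u) != 0) = true by rewrite -lt0n subn_gt0.
    rewrite /= ?s5u ?s5w ?a8 ?wu //; split.
    + by move=> k k8; rewrite (negPf k8) ak.
    + by move=> x xu; rewrite eqxx upd_ord (negPf xu) a8.
    + move=> x; rewrite eqxx upd_ord eqxx mem_rcons inE => /orP[/eqP -> //|xl fux].
      exact: leq_trans (wmax x xl fux) (ltnW cmp).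
    + by right; exists w; rewrite eqxx upd_ord eqxx.
    + by rewrite eqxx upd_ord eqxx (leq_trans Cu) // ltnW.
  have -> : (C (G0 w) - C (arrs s5 8 u) != 0) = false by apply/negbTE; rewrite negbK subn_eq0.
  by split=> // x; rewrite mem_rcons inE => /orP[/eqP -> //|]; apply: wmax.
move=> [ak a8 wmax best Cu] in6 t6.
have uS : u \in take i.+1 q by rewrite (take_nth (Ordinal lti)) ?sq // mem_rcons inE eqxx.
have before w : f w < f u -> w \in take i q.
  move=> fw; have := lower _ _ w uS fw; rewrite (take_nth (Ordinal lti)) ?sq // -/u.
  by rewrite mem_rcons inE => /orP[/eqP wu|//]; rewrite wu ltnn in fw.
have unew : u \notin take i q by rewrite in_take ?mem_nth ?sq // index_uniq ?sq // ltnn.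
split.
- by case: in6 => n6 M6; split; rewrite ?v3 ?a3 ?semE.
- by move=> k k8; rewrite a3 semE ak.
- have old v : v \in take i q -> arrs s3 8 v = arrs s1 8 v.
    move=> vq; have vu : v != u by apply: contraNneq unew => <-.
    by rewrite a3 semE a8 // G0E upd_ord (negPf vu).
  have oldG0 v : f v < f u -> G0 v = arrs s3 8 v.
    move=> fv; have vq := before v fv; rewrite old // G0E upd_ord.
    by have /negPf -> : v != u by apply: contraNneq unew => <-.
  move=> v; rewrite (take_nth (Ordinal lti)) ?sq // -/u mem_rcons inE => /orP[/eqP ->|vq].
    rewrite /gated a3 semE -/C; split=> //.
    + move=> w uw fw; rewrite -[sem _ s4]/(sem _ _) -semE -a3 -oldG0 ?fw // a3 semE.
      by apply: wmax => //; rewrite adjE.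
    + case: best => [|[w [uw fw best]]]; [by left | right; exists w; split=> //].
      by rewrite best -semE -a3 oldG0 ?fw.
  have [g1 g2 g3] := gi v vq; split.
  + move=> w vw fv; have wq : w \in take i q by apply: lower vq _; rewrite fv.
    by rewrite !old //; apply: g1.
  + case: g2 => [g2|[w [vw fv g2]]]; first by left; rewrite old.
    by right; exists w; split; rewrite ?old //; apply: lower vq _; rewrite fv.
  + by rewrite old.
- rewrite (workS (Ordinal lti)) ?sq // -/u t3 semE.
  by move: t6 ti; rewrite /= t2; lia.
Qed.

End Layers.

Lemma gate_weights_spec x s : input s -> x != 1 -> (forall w : 'I_n, arrs s 6 w = 0) ->
  let s' := sem (gate_weights x) s in
  (forall w : 'I_n, arrs s' 6 w =
     #|[set v : 'I_n | (arrs s 4 v == vars s x) && (arrs s 8 v == w)]|) /\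
  time s' <= time s + 2 + n * 5.
Proof.
move=> ins x1 W0 s'; have [n0 _] := ins.
pose p (w v : 'I_n) := (arrs s 4 v == vars s x) && (arrs s 8 v == w).
suff: [/\ forall w : 'I_n, arrs s' 6 w = count (p w) (take n (enum 'I_n)),
    forall k, k != 6 -> arrs s' k = arrs s k, forall y, y != 1 -> vars s' y = vars s y &
    time s' <= time s + 2 + n * 5].
  case=> aw _ _ ts; split=> // w; rewrite aw take_oversize ?size_enum_ord //.
  rewrite -sum1_count big_enum_cond sum1dep_card; apply: eq_card => v; by rewrite !inE.
apply: (for_vertices_ind (I := fun m s' =>
    [/\ forall w : 'I_n, arrs s' 6 w = count (p w) (take m (enum 'I_n)),
    forall k, k != 6 -> arrs s' k = arrs s k, forall y, y != 1 -> vars s' y = vars s y &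
    time s' <= time s + 2 + m * 5])) => //.
  by move=> s1 vE aE tE; split; rewrite ?aE ?tE //; [move=> w; rewrite take0 W0 | lia].
move=> i s1 s2 s3 lti s1i s1n [aw ak vk ti] v2 a2 t2.
have test : (eval (vars s2) (arrs s2) (Eq (Get 4 (Var 1)) (Var x)) != 0) =
    (arrs s 4 i == vars s x).
  by rewrite eval_Eq /= v2 a2 s1i vk // ak //; case: (arrs s 4 i == _).
have -> : sem (If (Eq (Get 4 (Var 1)) (Var x))
    (Put 6 (Get 8 (Var 1)) (Plus (Get 6 (Get 8 (Var 1))) (Cst 1))) Skip) s2 =
  if arrs s 4 i == vars s x then
    sem (Put 6 (Get 8 (Var 1)) (Plus (Get 6 (Get 8 (Var 1))) (Cst 1))) (tick s2)
  else tick (tick s2) by rewrite -test.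
have cS w : count (p w) (take i.+1 (enum 'I_n)) =
    count (p w) (take i (enum 'I_n)) + ((arrs s 4 i == vars s x) && (arrs s 8 i == w)).
  rewrite (take_nth (Ordinal lti)) ?size_enum_ord // -cats1 count_cat /= addn0.
  by rewrite (_ : nth _ _ _ = Ordinal lti) // -[i]/(val (Ordinal lti)) nth_ord_enum.
case: (arrs s 4 i == vars s x) cS => /= cS; rewrite ?v2 ?a2 ?s1i ?t2 => v3 a3 t3.
  split.
  - by move=> w; rewrite a3 /= updE cS eq_sym ak //; case: eqP => [->|_]; rewrite ?addn0 -?aw.
  - by move=> k k6; rewrite a3 (negPf k6) ak.
  - by move=> y y1; rewrite v3 // vk.
  - by rewrite t3; lia.
split.
- by move=> w; rewrite a3 cS addn0 aw.
- by move=> k k6; rewrite a3 ak.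
- by move=> y y1; rewrite v3 // vk.
- by rewrite t3; lia.
Qed.

Hypothesis irr_e : irreflexive e.
Hypothesis conn_e : forall u v, connect e u v.
Hypothesis alpha1 : alpha1_metric e.
Hypothesis triangle : triangle_condition e.
Hypothesis uniq_adj : forall v, uniq (adj v).
Local Notation d := (dist e).

(** Induction on the distance to [K]. At distance 1 an inherited gate would be a member of [K], of
    weight 0. Beyond, [z] has no neighbour in [K] and weight 1, while its parents' gates weigh more;
    so the gate is inherited with maximal weight, as [parent_gate] requires. *)
Lemma gated_gate (K : {set 'I_n}) (G C : nat -> nat) : clique e K -> K != set0 ->
  (forall w : 'I_n, C w = if w \in K then 0 else #|[set u in K | e w u]|.+1) ->
  (forall v, gated (setdist e K) G C v) -> forall z, z \notin K ->
  exists g : 'I_n, [/\ G z = g, g \notin K &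
    forall u, u \in K -> e u g = (d u z == setdist e K z)].
Proof.
move=> clK K0 CE gG z; have [f0 _ fpred] := setdist_layering irr_e conn_e K0.
move: {2}(setdist e K z) (leqnn (setdist e K z)) => k; elim: k z => [|k IH] z zk zK.
  by move: zK; rewrite -f0 -leqn0 zk.
have [gmax gsrc gC] := gG z.
have [z1|z1] := leqP (setdist e K z) 1.
  have z1E : setdist e K z = 1.
    by apply/eqP; rewrite eqn_leq z1 lt0n f0.
  case: gsrc => [->|[w [zw fw gw]]].
    by exists z; split=> // u uK; rewrite z1E (edge_dist irr_e conn_e).
  have wK : w \in K by rewrite -f0; move: fw; rewrite z1E => -[<-].
  have [_ [gww|[x [_ fx _]]] _] := gG w.
    by move: gC; rewrite gw gww !CE wK (negPf zK).
  by move: (wK); rewrite -f0 fx.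
have Cz : C z = 1.
  rewrite CE (negPf zK); congr _.+1; apply/eqP; rewrite cards_eq0; apply/eqP/setP => u.
  rewrite !inE; apply/negbTE/negP => /andP[uK zu].
  have [_ min] := setdistP e z K0; have := min u uK.
  move: zu; rewrite sym_e (edge_dist irr_e conn_e) => /eqP ->.
  by rewrite leqNgt z1.
have parent w : setdist e K z = (setdist e K w).+1 -> exists g : 'I_n, [/\ G w = g, g \notin K &
    forall u, u \in K -> e u g = (d u w == setdist e K w)].
  by move=> fw; apply: IH; rewrite -?f0; lia.
have gt1 w : e w z -> setdist e K z = (setdist e K w).+1 -> 1 < C (G w).
  move=> wz fw; have [g [-> gK gE]] := parent w fw.
  rewrite CE (negPf gK) ltnS card_gt0; apply/set0Pn.
  have [[u uK uw] _] := setdistP e w K0.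
  by exists u; rewrite inE uK sym_e gE // uw eqxx.
case: gsrc => [gz|[p [zp fp gp]]].
  have [w wz fw] : exists2 w, e w z & setdist e K z = (setdist e K w).+1.
    have [w wz fw] := fpred z (setdist e K z).-1 ltac:(lia).
    by exists w => //; rewrite fw; lia.
  have := gmax w; rewrite sym_e => /(_ wz fw); rewrite gz Cz leqNgt.
  by rewrite (gt1 w wz fw).
have pz : e p z by rewrite sym_e.
pose F (w : 'I_n) : 'I_n := insubd w (G w).
have Fg (w g : 'I_n) : G w = g -> F w = g.
  by move=> Gg; apply: val_inj; rewrite val_insubd Gg ltn_ord.
have FE w : setdist e K z = (setdist e K w).+1 -> G w = F w /\ F w \notin K.
  by move=> fw; have [g [Gg gK _]] := parent w fw; rewrite (Fg _ _ Gg).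
have Fadj w : e w z -> setdist e K z = (setdist e K w).+1 ->
    forall u, u \in K -> e u (F w) = (d u w == setdist e K w).
  move=> wz fw u uK; have [g [Gg gK gE]] := parent w fw.
  by rewrite (Fg _ _ Gg) gE.
have [GpF FpK] := FE p fp.
exists (F p); split=> //; first by rewrite gp.
apply: (parent_gate sym_e irr_e conn_e alpha1 triangle clK K0 z1 Fadj pz fp) => w wz fw.
have [GwF FwK] := FE w fw.
have := gmax w; rewrite sym_e => /(_ wz fw).
by rewrite gp GwF GpF !CE (negPf FwK) (negPf FpK).
Qed.

(** * One descent as a program *)

Definition single_bfs j x := bfs j (Eq (Var 1) (Var x)).

(** Because of the shift in stored distances, [Cst 2] tests distance 1 from [v], and variable 16,
    equal to [k], tests distance [k - 1] from [f]. The first [nbr_sum] counts neighbours in [K]; the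
    second computes coverages from the gate weights. *)
Definition improve v u :=
  single_bfs 2 v ;; argmax 15 (Get 2 (Var 1)) ;; Let 16 (Minus (Get 2 (Var 15)) (Cst 1)) ;;
  single_bfs 3 15 ;;
  fill 5 (And (Eq (Get 2 (Var 1)) (Cst 2)) (Eq (Get 3 (Var 1)) (Var 16))) ;;
  bfs 4 (Get 5 (Var 1)) ;; fill 6 (Get 5 (Var 1)) ;;
  nbr_sum (Minus (Cst 1) (Get 5 (Var 1))) ;; gates ;;
  fill 6 (Cst 0) ;; gate_weights 16 ;;
  nbr_sum (Get 5 (Var 1)) ;; argmax u (Get 7 (Var 1)).

Let S := \sum_v size (adj v).
Let N := (n + S).+1.

Lemma singleton_layering x : layering e [set x] (d x).
Proof.
split=> [w|u w uw|w k xw].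
- by rewrite (dist_eq0 conn_e) inE eq_sym.
- have := dist_triangle conn_e u x w.
  by move: uw; rewrite (edge_dist irr_e conn_e) => /eqP ->; rewrite addn1.
- by have [u xu uw] := dist_pred irr_e conn_e xw; exists u.
Qed.

Lemma single_bfs_spec j x s (v : 'I_n) : 1 < j -> 5 < x -> input s -> vars s x = v ->
  let s' := sem (single_bfs j x) s in
  (forall w : 'I_n, arrs s' j w = (d v w).+1) /\ time s' <= time s + 12 * N.
Proof.
move=> j1 x5 ins sv s'.
have v0 : [set v] != set0 by apply/set0Pn; exists v; rewrite inE.
have [||aj _ ts] := bfs_spec (singleton_layering v) v0 (a := Eq (Var 1) (Var x))
  (g := fun i => i == v) j1 ins.
- move=> i V A lti V1 VE AE; have Vx : V x = v by rewrite VE //; lia.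
  by rewrite eval_Eq /= V1 Vx; case: (i == v).
- by move=> w; rewrite inE.
- by split=> //; apply: leq_trans ts _; rewrite /N /S; lia.
Qed.

(** Exchanging the sums, each [z] at distance [k - 1] from [K] is counted at its gate only, which is
    adjacent to [u] exactly when [d u z = k - 1]. *)
Lemma weight_coverage (K : {set 'I_n}) (G : nat -> nat) k u : 1 < k -> u \in K ->
  (forall z, z \notin K -> exists g : 'I_n, [/\ G z = g, g \notin K &
    forall u, u \in K -> e u g = (d u z == setdist e K z)]) -> K != set0 ->
  \sum_(w <- adj u) #|[set z : 'I_n | ((setdist e K z).+1 == k) && (G z == w)]| =
  #|[set z | (setdist e K z == k.-1) && (d u z == k.-1)]|.
Proof.
move=> k1 uK gate K0; have [f0 _ _] := setdist_layering irr_e conn_e K0.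
under eq_bigr do rewrite -sum1dep_card big_mkcondr /=.
rewrite exchange_big /= -sum1dep_card [RHS]big_mkcondr /=.
apply: eq_big => [z|z /eqP zk]; first by lia.
have zK : z \notin K by rewrite -f0; lia.
have [g [-> _ gE]] := gate z zK.
have -> : k.-1 = setdist e K z by rewrite -zk.
rewrite -gE // -adjE -big_mkcond /= sum1_count.
under eq_count do rewrite eq_sym val_eqE.
by rewrite count_uniq_mem //; case: (g \in adj u).
Qed.

Transparent for_nbrs for_vertices.

Lemma sem_seq c1 c2 s : sem (c1 ;; c2) s = sem c2 (sem c1 s).
Proof. by []. Qed.

Lemma improve_spec xv xu s (v : 'I_n) : 1 < n -> input s -> 7 < xv -> 6 < xu ->
  xv != 15 -> vars s xv = v ->
  exists u : 'I_n, let s' := sem (improve xv xu) s in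
  [/\ vars s' xu = u, improver e v u & time s' <= time s + 156 * N].
Proof.
move=> n1 ins xv7 xu6 xv15 sv; have n0 : 0 < n by lia.
have [] := single_bfs_spec (isT : 1 < 2) (ltnW (ltnW xv7)) ins sv.
move E1: (sem _ s) => s1 a1 t1.
have in1 : input s1 by rewrite -E1; apply: input_frame.
have [] := @argmax_spec 15 (Get 2 (Var 1)) (arrs s1 2) s1 in1 n0 isT
  ltac:(by move=> i V A _ V1 _ ->; rewrite /= V1).
move E2: (sem _ s1) => s2 f2 max2 t2.
have in2 : input s2 by rewrite -E2; apply: input_frame.
have a2 : arrs s2 2 = arrs s1 2 by rewrite -E2 arrs_frame.
pose f := Ordinal f2.
have s2f : vars s2 15 = f by [].
have far w : d v w <= d v f.
  by have := max2 w (ltn_ord w); rewrite s2f !a1 ltnS.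
move E3: (sem (Let 16 (Minus (Get 2 (Var 15)) (Cst 1))) s2) => s3.
have in3 : input s3 by rewrite -E3; apply: input_frame.
have s3f : vars s3 15 = f by rewrite -E3 vars_frame.
have s3k : vars s3 16 = d v f by rewrite -E3 /= updE /= a2 s2f a1 subn1.
have a3 : arrs s3 2 = arrs s1 2 by rewrite -E3.
have t3 : time s3 = (time s2).+1 by rewrite -E3.
have [] := single_bfs_spec (isT : 1 < 3) (isT : 5 < 15) in3 s3f.
move E4: (sem _ s3) => s4 a4 t4.
have in4 : input s4 by rewrite -E4; apply: input_frame.
have a42 (w : 'I_n) : arrs s4 2 w = (d v w).+1 by rewrite -E4 arrs_frame // a3 a1.
have s4k : vars s4 16 = d v f by rewrite -E4 vars_frame.
have ek : ecc e v = d v f.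
  apply/eqP; rewrite eqn_leq; apply/andP; split.
    by apply/ecc_leP => w; rewrite (dist_sym sym_e irr_e conn_e).
  by rewrite (dist_sym sym_e irr_e conn_e) leq_ecc.
set k := d v f in ek s3k s4k far.
pose K := closer e v f.
have KE w : (w \in K) = (d v w == 1) && ((d w f).+1 == k).
  by rewrite inE (edge_dist irr_e conn_e) ek.
have k0 : 0 < k.
  have [w wv] : exists w : 'I_n, w != v.
    have : 0 < #|[set~ v]| by rewrite cardsC1 card_ord -subn1 subn_gt0.
    by rewrite card_gt0 => /set0Pn[w]; rewrite !inE => wv; exists w.
  by apply: leq_trans (far w); rewrite lt0n (dist_eq0 conn_e) eq_sym.
have K0 : K != set0.
  have := dist_sym sym_e irr_e conn_e f v.
  rewrite -/k -(prednK k0) => /(dist_pred irr_e conn_e)[w fw wv].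
  apply/set0Pn; exists w; rewrite KE -(edge_dist irr_e conn_e) sym_e wv.
  by rewrite (dist_sym sym_e irr_e conn_e) fw prednK ?eqxx.
have [] := @fill_spec 5 (And (Eq (Get 2 (Var 1)) (Cst 2)) (Eq (Get 3 (Var 1)) (Var 16)))
  (fun i => (arrs s4 2 i == 2) && (arrs s4 3 i == k)) s4 in4 isT
  ltac:(move=> i V A _ V1 VE AE; apply: eval_And;
    [by rewrite eval_Eq /= V1 AE | by rewrite eval_Eq /= V1 AE // VE // s4k]).
move E5: (sem _ s4) => s5 a5 t5.
have in5 : input s5 by rewrite -E5; apply: input_frame.
have s5k : vars s5 16 = k by rewrite -E5 vars_frame.
have a5K (w : 'I_n) : arrs s5 5 w = (w \in K).
  by rewrite a5 ?ltn_ord // a42 a4 eqSS KE (dist_sym sym_e irr_e conn_e w).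
have [||] := bfs_spec (setdist_layering irr_e conn_e K0) K0
  (j := 4) (a := Get 5 (Var 1)) (g := fun i => arrs s5 5 i != 0) isT in5.
- by move=> i V A _ V1 _ AE; rewrite /= V1 AE.
- by move=> w; rewrite a5K; case: (w \in K).
move E6: (sem _ s5) => s6 a6 [q [uq sq qlay qu]] t6.
have in6 : input s6 by rewrite -E6; apply: input_frame.
have s6k : vars s6 16 = k by rewrite -E6 vars_frame.
have a65 (w : 'I_n) : arrs s6 5 w = (w \in K) by rewrite -E6 arrs_frame.
have [] := @fill_spec 6 (Get 5 (Var 1)) (arrs s6 5) s6 in6 isT
  ltac:(by move=> i V A _ V1 _ AE; rewrite /= V1 AE).
move E7: (sem _ s6) => s7 a7 t7.
have in7 : input s7 by rewrite -E7; apply: input_frame.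
have s7k : vars s7 16 = k by rewrite -E7 vars_frame.
have a75 : arrs s7 5 = arrs s6 5 by rewrite -E7 arrs_frame.
have a74 : arrs s7 4 = arrs s6 4 by rewrite -E7 arrs_frame.
have qu7 : queue q s7 by case: qu => q5 q1; split; rewrite -E7 ?vars_frame ?arrs_frame.
have [] := @nbr_sum_spec (Minus (Cst 1) (Get 5 (Var 1))) (fun i => 1 - arrs s7 5 i) s7 in7
  ltac:(by move=> i V A _ V1 _ AE; rewrite /= V1 AE).
move E8: (sem _ s7) => s8 a8 t8.
have in8 : input s8 by rewrite -E8; apply: input_frame.
have s8k : vars s8 16 = k by rewrite -E8 vars_frame.
have a85 : arrs s8 5 = arrs s6 5 by rewrite -E8 arrs_frame.
have a84 (w : 'I_n) : arrs s8 4 w = (setdist e K w).+1 by rewrite -E8 arrs_frame // a74 a6.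
have qu8 : queue q s8 by case: qu7 => q5 q1; split; rewrite -E8 ?vars_frame ?arrs_frame.
have a8E (w : 'I_n) : arrs s8 7 w = if w \in K then 0 else #|[set u in K | e w u]|.+1.
  rewrite a8 a75 a65; case: (w \in K) => //=; congr _.+1.
  under eq_bigr do rewrite a7 ?ltn_ord // a65.
  rewrite -big_mkcond /= sum1_count -size_filter -(card_uniqP (filter_uniq _ (uniq_adj w))).
  by apply: eq_card => u; rewrite mem_filter adjE [RHS]inE.
have [] := gates_spec in8 uq sq qlay qu8 a84.
move E9: (sem _ s8) => s9 a9 t9.
have in9 : input s9 by rewrite -E9; apply: input_frame.
have s9k : vars s9 16 = k by rewrite -E9 vars_frame.
have a95 : arrs s9 5 = arrs s6 5 by rewrite -E9 arrs_frame.
have a94 : arrs s9 4 = arrs s8 4 by rewrite -E9 arrs_frame.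
have [] := @fill_spec 6 (Cst 0) (fun=> 0) s9 in9 isT ltac:(by []).
move E10: (sem _ s9) => s10 a10 t10.
have in10 : input s10 by rewrite -E10; apply: input_frame.
have s10k : vars s10 16 = k by rewrite -E10 vars_frame.
have a105 : arrs s10 5 = arrs s6 5 by rewrite -E10 arrs_frame.
have a104 : arrs s10 4 = arrs s8 4 by rewrite -E10 arrs_frame.
have a108 : arrs s10 8 = arrs s9 8 by rewrite -E10 arrs_frame.
have [|] := @gate_weights_spec 16 s10 in10 isT; first by move=> w; rewrite a10 ?ltn_ord.
move E11: (sem _ s10) => s11 a11 t11.
have in11 : input s11 by rewrite -E11; apply: input_frame.
have a115 : arrs s11 5 = arrs s6 5 by rewrite -E11 arrs_frame.
have [] := @nbr_sum_spec (Get 5 (Var 1)) (arrs s11 5) s11 in11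
  ltac:(by move=> i V A _ V1 _ AE; rewrite /= V1 AE).
move E12: (sem _ s11) => s12 a12 t12.
have in12 : input s12 by rewrite -E12; apply: input_frame.
have [] := @argmax_spec xu (Get 7 (Var 1)) (arrs s12 7) s12 in12 n0 xu6
  ltac:(by move=> i V A _ V1 _ ->; rewrite /= V1).
move E13: (sem _ s12) => s13 u13 max13 t13.
have -> : sem (improve xv xu) s = s13.
  rewrite /improve sem_seq E1 sem_seq E2 sem_seq E3 sem_seq E4 sem_seq E5 sem_seq E6.
  by rewrite sem_seq E7 sem_seq E8 sem_seq E9 sem_seq E10 sem_seq E11 sem_seq E12; exact: E13.
exists (Ordinal u13); split; [by [] | | ]; last first.
  move: t1 t2 t3 t4 t5 t6 t7 t8 t9 t10 t11 t12 t13; rewrite /N -/S.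
  move: (time s1) (time s2) (time s3) (time s4) (time s5) (time s6) (time s7) (time s8).
  by move: S (time s9) (time s10) (time s11) (time s12) (time s13) (time s); clear; lia.
rewrite /improver ek => k1; exists f; rewrite -/k -/K.
have clK : clique e K.
  have := closer_clique sym_e irr_e conn_e alpha1 (erefl : d v f = k) ek k1.
  by rewrite -{1}ek.
have gate := gated_gate clK K0 a8E a9.
have a12E (w : 'I_n) : arrs s12 7 w = if w \in K then (coverage e v f k w).+1 else 0.
  rewrite a12 a115 a65; case: ifP => [|wK]; first by case: (w \in K).
  have {}wK : w \in K by case: (w \in K) wK.
  rewrite wK; congr _.+1.
  under eq_bigr do rewrite a11 s10k a104 a108.
  transitivity (\sum_(w0 <- adj w) #|[set z : 'I_n |
    ((setdist e K z).+1 == k) && (arrs s9 8 z == w0)]|).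
    by apply: eq_bigr => x _; apply: eq_card => z; rewrite !inE a84.
  rewrite (weight_coverage k1 wK gate K0) /coverage.
  by have -> : [set u | e v u & (d u f).+1 == k] = K by rewrite /K /closer ek.
have uK : Ordinal u13 \in K.
  have [w wK] := set0Pn _ K0; have := max13 w (ltn_ord w).
  by rewrite -[vars s13 xu]/(val (Ordinal u13)) !a12E wK; case: ifP.
split=> // w wK; have := max13 w (ltn_ord w).
by rewrite -[vars s13 xu]/(val (Ordinal u13)) !a12E wK uK ltnS.
Qed.

(** * The algorithm *)

Definition farthest j x y := single_bfs j x ;; argmax y (Get j (Var 1)).

Definition keep_better v u :=
  farthest 9 v 12 ;; Let 17 (Get 9 (Var 12)) ;; farthest 9 u 12 ;;
  If (Minus (Var 17) (Get 9 (Var 12))) (Let v (Var u)) Skip.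

(** The last [argmax] searches for a vertex passing a 0/1 test. Each stored distance is shifted by
    1, whence the [Cst 1] next to the total; the second factor is 1 when the two distances differ by
    at most 1. *)
Definition sweep :=
  Let 10 (Cst 0) ;; farthest 9 10 11 ;; farthest 10 11 13 ;; single_bfs 11 13 ;;
  argmax 10 (And
    (Eq (Plus (Get 10 (Var 1)) (Get 11 (Var 1))) (Plus (Get 10 (Var 13)) (Cst 1)))
    (Minus (Cst 1) (Plus
      (Minus (Minus (Get 10 (Var 1)) (Get 11 (Var 1))) (Cst 1))
      (Minus (Minus (Get 11 (Var 1)) (Get 10 (Var 1))) (Cst 1))))).

(** Variable 18 holds the eccentricity, which as a stored value means a distance one smaller. With
    the slice's indicator as weights, the neighbour sums are degrees inside the slice. *)
Definition middle_slice :=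
  farthest 9 10 12 ;; Let 18 (Minus (Get 9 (Var 12)) (Cst 1)) ;;
  farthest 9 11 12 ;; farthest 10 12 13 ;; single_bfs 11 13 ;;
  fill 5 (And (Eq (Get 10 (Var 1)) (Var 18)) (Eq (Get 11 (Var 1)) (Var 18))) ;;
  fill 6 (Get 5 (Var 1)) ;; nbr_sum (Get 5 (Var 1)) ;; argmax 14 (Get 7 (Var 1)).

(** A single vertex is treated apart because a descent needs a farthest vertex other than [v]. The
    answer replaces [n] in variable 0, which is cell 0. *)
Definition central_vertex :=
  If (Minus (Var 0) (Cst 1))
    (sweep ;; For (Cst 13) (improve 10 11 ;; keep_better 10 11) ;;
     improve 10 11 ;; middle_slice ;; improve 14 19 ;;
     keep_better 10 14 ;; keep_better 10 19 ;; Let 0 (Var 10))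
    (Let 0 (Cst 0)).

Lemma farthest_spec j x y s (v : 'I_n) : 1 < j -> 5 < x -> 6 < y -> input s ->
  0 < n -> vars s x = v ->
  exists z : 'I_n, let s' := sem (farthest j x y) s in
  [/\ vars s' y = z, forall w : 'I_n, arrs s' j w = (d v w).+1,
      forall w, d v w <= d v z & time s' <= time s + 22 * N].
Proof.
move=> j1 x5 y6 ins n0 sv; rewrite /farthest sem_seq.
have [] := single_bfs_spec j1 x5 ins sv; move E1: (sem _ s) => s1 a1 t1.
have in1 : input s1.
  by rewrite -E1; apply: input_frame => //=; rewrite !inE /=; lia.
have [] := @argmax_spec y (Get j (Var 1)) (arrs s1 j) s1 in1 n0 y6
  ltac:(by move=> i V A _ V1 _ ->; rewrite /= V1).
have : arrs (sem (argmax y (Get j (Var 1))) s1) j = arrs s1 j by rewrite arrs_frame.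
move E2: (sem _ s1) => s2 a2 z2 max2 t2; exists (Ordinal z2); split=> //.
- by move=> w; rewrite a2 a1.
- by move=> w; have := max2 w (ltn_ord w); rewrite -[vars s2 y]/(val (Ordinal z2)) !a1 ltnS.
- move: t1 t2; rewrite /N; move: (time s1) (time s2) (time s) S; clear; lia.
Qed.

Lemma ecc_farthest v z : (forall w, d v w <= d v z) -> ecc e v = d v z.
Proof.
move=> far; apply/eqP; rewrite eqn_leq (dist_sym sym_e irr_e conn_e v z) leq_ecc andbT.
by apply/ecc_leP => w; rewrite !(dist_sym sym_e irr_e conn_e _ v).
Qed.

Lemma keep_better_spec x y s (v u : 'I_n) : 5 < x -> 5 < y ->
  x != 6 -> y != 6 -> x != 12 -> y != 12 -> x != 17 -> y != 17 -> input s ->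
  0 < n -> vars s x = v -> vars s y = u ->
  let s' := sem (keep_better x y) s in
  vars s' x = (if ecc e u < ecc e v then u else v) /\ time s' <= time s + 48 * N.
Proof.
move=> x5 y5 x6 y6 x12 y12 x17 y17 ins n0 sx sy; rewrite /keep_better sem_seq.
have wf1 p : 5 < p -> p != 6 -> p != 12 -> forall q, p \notin written_vars (farthest 9 q 12).
  by move=> p5 p6 p12 q; rewrite (_ : written_vars _ = [:: 5; 1; 5; 1; 1; 2; 3; 4; 5; 3; 1; 12; 6; 1; 6; 12; 1]) // !inE; lia.
have [z1 []] := @farthest_spec 9 x 12 s v isT x5 isT ins n0 sx.
have : vars (sem (farthest 9 x 12) s) x = v by rewrite vars_frame ?wf1.
have : vars (sem (farthest 9 x 12) s) y = u by rewrite vars_frame ?wf1.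
move E1: (sem _ s) => s1 s1y s1x s1z a1 far1 t1.
have in1 : input s1 by rewrite -E1; apply: input_frame.
rewrite sem_seq; move E2: (sem _ s1) => s2.
have in2 : input s2 by rewrite -E2; apply: input_frame.
have s2x : vars s2 x = v by rewrite -E2 /= updE (negPf x17).
have s2y : vars s2 y = u by rewrite -E2 /= updE (negPf y17).
have s2k : vars s2 17 = (d v z1).+1 by rewrite -E2 /= updE /= s1z a1.
have t2 : time s2 = (time s1).+1 by rewrite -E2.
rewrite sem_seq; have [z3 []] := @farthest_spec 9 y 12 s2 u isT y5 isT in2 n0 s2y.
have : vars (sem (farthest 9 y 12) s2) x = v by rewrite vars_frame ?wf1.
have : vars (sem (farthest 9 y 12) s2) y = u by rewrite vars_frame ?wf1.
have : vars (sem (farthest 9 y 12) s2) 17 = (d v z1).+1 by rewrite vars_frame.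
move E3: (sem _ s2) => s3 s3k s3y s3x s3z a3 far3 t3.
have test : (eval (vars s3) (arrs s3) (Minus (Var 17) (Get 9 (Var 12))) != 0) =
    (ecc e u < ecc e v).
  by rewrite /= s3z a3 s3k (ecc_farthest far1) (ecc_farthest far3) subSS subn_eq0 -ltnNge.
have -> : sem (If (Minus (Var 17) (Get 9 (Var 12))) (Let x (Var y)) Skip) s3 =
  if ecc e u < ecc e v then sem (Let x (Var y)) (tick s3) else tick (tick s3).
  by rewrite -test.
have T : (time s3).+2 <= time s + 48 * N.
  move: t1 t2 t3; rewrite /N; move: (time s1) (time s2) (time s3) (time s) S; clear; lia.
by case: ifP => _; split; rewrite //= ?updE ?eqxx.
Qed.

Lemma sweep_spec s : 0 < n -> input s ->
  exists m : 'I_n, let s' := sem sweep s in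
  [/\ vars s' 10 = m, forall c, ecc e m <= ecc e c + 13 & time s' <= time s + 80 * N].
Proof.
move=> n0 ins; rewrite /sweep sem_seq; move E0: (sem _ s) => s0.
have in0 : input s0 by rewrite -E0; apply: input_frame.
have s0a : vars s0 10 = Ordinal n0 by rewrite -E0 /= updE.
have t0 : time s0 = (time s).+1 by rewrite -E0.
rewrite sem_seq; have [b []] := @farthest_spec 9 10 11 s0 _ isT isT isT in0 n0 s0a.
move E1: (sem _ s0) => s1 s1b _ farb t1.
have in1 : input s1 by rewrite -E1; apply: input_frame.
rewrite sem_seq; have [y []] := @farthest_spec 10 11 13 s1 _ isT isT isT in1 n0 s1b.
move E2: (sem _ s1) => s2 s2y a2 fary t2.
have in2 : input s2 by rewrite -E2; apply: input_frame.
rewrite sem_seq; have [] := @single_bfs_spec 11 13 s2 y isT isT in2 s2y.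
have : vars (sem (single_bfs 11 13) s2) 13 = y by rewrite vars_frame.
have : arrs (sem (single_bfs 11 13) s2) 10 = arrs s2 10 by rewrite arrs_frame.
move E3: (sem _ s2) => s3 a3' s3y a3 t3.
have in3 : input s3 by rewrite -E3; apply: input_frame.
set mid := And _ _.
pose p i := (arrs s3 10 i + arrs s3 11 i == arrs s3 10 y + 1) &&
  ((arrs s3 10 i <= (arrs s3 11 i).+1) && (arrs s3 11 i <= (arrs s3 10 i).+1)).
have [] := @argmax_spec 10 mid p s3 in3 n0 isT.
  move=> i V A _ V1 VE AE; apply: eval_And; first by rewrite eval_Eq /= V1 AE VE // s3y.
  by rewrite /= V1 AE; lia.
move E4: (sem _ s3) => s4 ltm mmax t4.
have pE (w : 'I_n) : p w = [&& d b w + d w y == d b y, d b w <= (d w y).+1 & d w y <= (d b w).+1].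
  by rewrite /p a3' a3 !a2 (dist_sym sym_e irr_e conn_e y w); lia.
have le_half : (d b y)./2 <= d b y by lia.
have [w bw wy] := geodesic irr_e conn_e le_half.
have pw : p w by rewrite pE bw; lia.
have pm : p (Ordinal ltm).
  by have := mmax w (ltn_ord w); rewrite pw -[vars s4 10]/(val (Ordinal ltm)); case: (p _).
exists (Ordinal ltm); split=> // [c|].
  move: pm; rewrite pE => /and3P[/eqP bmy bm my].
  exact: (double_sweep sym_e irr_e conn_e alpha1 triangle c farb fary bmy bm my).
move: t0 t1 t2 t3 t4; rewrite /N.
by move: (time s0) (time s1) (time s2) (time s3) (time s4) (time s) S; clear; lia.
Qed.

Lemma middle_slice_spec s (v u : 'I_n) : 0 < n -> input s -> vars s 10 = v -> vars s 11 = u ->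
  exists z y w : 'I_n, let s' := sem middle_slice s in
  [/\ vars s' 14 = w, forall x, d u x <= d u z, forall x, d z x <= d z y,
      let A := slice e z y (ecc e v).-1 (ecc e v).-1 in
      forall t, t \in A -> w \in A /\
        #|[set x in A | e t x]| <= #|[set x in A | e w x]| &
      time s' <= time s + 150 * N].
Proof.
move=> n0 ins sv su; rewrite /middle_slice sem_seq.
have [c []] := @farthest_spec 9 10 12 s _ isT isT isT ins n0 sv.
have : vars (sem (farthest 9 10 12) s) 11 = u by rewrite vars_frame.
move E0: (sem _ s) => s0 s0u s0c a0 farc t0.
have in0 : input s0 by rewrite -E0; apply: input_frame.
rewrite sem_seq; move E1: (sem _ s0) => s1.
have in1 : input s1 by rewrite -E1; apply: input_frame.
have s1u : vars s1 11 = u by rewrite -E1 vars_frame.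
have s1k : vars s1 18 = ecc e v.
  by rewrite -E1 /= updE /= s0c a0 subn1 (ecc_farthest farc).
have t1 : time s1 = (time s0).+1 by rewrite -E1.
rewrite sem_seq; have [z []] := @farthest_spec 9 11 12 s1 _ isT isT isT in1 n0 s1u.
have : vars (sem (farthest 9 11 12) s1) 18 = ecc e v by rewrite vars_frame.
move E2: (sem _ s1) => s2 s2k s2z _ farz t2.
have in2 : input s2 by rewrite -E2; apply: input_frame.
rewrite sem_seq; have [y []] := @farthest_spec 10 12 13 s2 _ isT isT isT in2 n0 s2z.
have : vars (sem (farthest 10 12 13) s2) 18 = ecc e v by rewrite vars_frame.
move E3: (sem _ s2) => s3 s3k s3y a3 fary t3.
have in3 : input s3 by rewrite -E3; apply: input_frame.
rewrite sem_seq; have [] := @single_bfs_spec 11 13 s3 y isT isT in3 s3y.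
have : vars (sem (single_bfs 11 13) s3) 18 = ecc e v by rewrite vars_frame.
have : arrs (sem (single_bfs 11 13) s3) 10 = arrs s3 10 by rewrite arrs_frame.
move E4: (sem _ s3) => s4 a4' s4k a4 t4.
have in4 : input s4 by rewrite -E4; apply: input_frame.
rewrite sem_seq; set inS := And _ _.
have [] := @fill_spec 5 inS (fun i => (arrs s4 10 i == ecc e v) && (arrs s4 11 i == ecc e v))
  s4 in4 isT.
  move=> i V A _ V1 VE AE; apply: eval_And; rewrite eval_Eq /= V1 !AE // VE // s4k //.
move E5: (sem _ s4) => s5 a5 t5.
have in5 : input s5 by rewrite -E5; apply: input_frame.
rewrite sem_seq; have [] := @fill_spec 6 (Get 5 (Var 1)) (arrs s5 5) s5 in5 isT
  ltac:(by move=> i V A _ V1 _ AE; rewrite /= V1 AE).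
have : arrs (sem (fill 6 (Get 5 (Var 1))) s5) 5 = arrs s5 5 by rewrite arrs_frame.
move E6: (sem _ s5) => s6 a65 a6 t6.
have in6 : input s6 by rewrite -E6; apply: input_frame.
rewrite sem_seq; have [] := @nbr_sum_spec (Get 5 (Var 1)) (arrs s6 5) s6 in6
  ltac:(by move=> i V A _ V1 _ AE; rewrite /= V1 AE).
move E7: (sem _ s6) => s7 a7 t7.
have in7 : input s7 by rewrite -E7; apply: input_frame.
have [] := @argmax_spec 14 (Get 7 (Var 1)) (arrs s7 7) s7 in7 n0 isT
  ltac:(by move=> i V A _ V1 _ ->; rewrite /= V1).
move E8: (sem _ s7) => s8 ltw wmax t8.
exists z, y, (Ordinal ltw); split=> //; last first.
  move: t0 t1 t2 t3 t4 t5 t6 t7 t8; rewrite /N -/S.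
  move: (time s0) (time s1) (time s2) (time s3) (time s4) (time s5) (time s6) (time s7).
  by move: (time s8) (time s) S; clear; lia.
move=> t; set A := slice _ _ _ _ _ => tA.
(* At eccentricity 0 the truncated predecessor makes the stored test differ from membership in the
   slice, but then the graph has a single vertex. *)
have k0 : 0 < ecc e v \/ ecc e v = 0 by lia.
have A5 (x : 'I_n) : arrs s5 5 x = (x \in A) && (0 < ecc e v).
  by rewrite a5 ?ltn_ord // a4' a3 a4 inE; lia.
case: k0 => [k0|k0]; last first.
  have all_eq (x x' : 'I_n) : x = x'.
    have eq_v x0 : x0 = v.
      by apply/eqP; rewrite -(dist_eq0 conn_e) -leqn0 -k0 leq_ecc.
    by rewrite (eq_v x) (eq_v x').
  by rewrite (all_eq (Ordinal ltw) t).
have A7 (x : 'I_n) : arrs s7 7 x = if x \in A then #|[set w in A | e x w]|.+1 else 0.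
  rewrite a7 a65 A5 k0 andbT; case: (x \in A) => //=; congr _.+1.
  under eq_bigr do rewrite a6 ?ltn_ord // A5 k0 andbT.
  rewrite -big_mkcond /= sum1_count -size_filter -(card_uniqP (filter_uniq _ (uniq_adj x))).
  by apply: eq_card => w; rewrite mem_filter adjE [RHS]inE.
have := wmax t (ltn_ord t); rewrite -[vars s8 14]/(val (Ordinal ltw)) !A7 tA.
by case: (Ordinal ltw \in A).
Qed.

Lemma stuck_improver v u : stuck e v -> improver e v u -> ecc e v <= ecc e u.
Proof.
move=> vstuck vu; have [v1|v1] := leqP (ecc e v) 1.
  exact: central_of_ecc_le1.
have [f [_ uK _]] := vu v1; apply: vstuck.
by move: uK; rewrite inE => /andP[].
Qed.

Lemma sem_For a c s :
  sem (For a c) s = iter (eval (vars s) (arrs s) a) (fun s => sem c (tick s)) (tick s).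
Proof. by []. Qed.

Lemma central_vertex_spec s : input s -> 0 < n ->
  exists v : 'I_n, let s' := sem central_vertex s in
  [/\ vars s' 0 = v, central e v & time s' <= time s + 4000 * N].
Proof.
move=> ins n0; have [sn _] := ins.
have [n1|n1] := leqP n 1.
  have -> : sem central_vertex s = sem (Let 0 (Cst 0)) (tick s).
    rewrite -[LHS]/(if vars s 0 - 1 != 0 then _ else _) sn.
    by have -> : n - 1 = 0 by lia.
  exists (Ordinal n0); split=> //; last first.
    by rewrite -[time _]/((time s).+2) /N; move: (time s) (n + S); clear; lia.
  move=> w; apply/ecc_leP => x.
  have all_eq (y z : 'I_n) : y = z.
    by apply: val_inj => /=; have := ltn_ord y; have := ltn_ord z; lia.
  by rewrite (all_eq x (Ordinal n0)) (distxx conn_e).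
have -> : sem central_vertex s =
    sem (sweep ;; For (Cst 13) (improve 10 11 ;; keep_better 10 11) ;;
     improve 10 11 ;; middle_slice ;; improve 14 19 ;;
     keep_better 10 14 ;; keep_better 10 19 ;; Let 0 (Var 10)) (tick s).
  rewrite -[LHS]/(if vars s 0 - 1 != 0 then _ else _) sn.
  by have -> : n - 1 != 0 by rewrite -lt0n subn_gt0.
have int : input (tick s) by [].
rewrite sem_seq; have [m []] := sweep_spec n0 int.
have : input (sem sweep (tick s)) by apply: input_frame.
move E0: (sem _ (tick s)) => s0 in0 s0m radm t0.
rewrite sem_seq; set body := improve 10 11 ;; keep_better 10 11.
have [s1 [E1 in1 [v s1v vstuck] t1]] : exists s1, [/\ sem (For (Cst 13) body) s0 = s1, input s1,
    exists2 v : 'I_n, vars s1 10 = v & stuck e v & time s1 <= time s0 + 1 + 13 * (206 * N)].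
  exists (sem (For (Cst 13) body) s0).
  rewrite sem_For (_ : eval _ _ _ = 13) //.
  set s1 := iter _ _ _.
  suff [in1 t1 [v s1v v13]] : [/\ input s1, time s1 <= time s0 + 1 + 13 * (206 * N) &
      exists2 v : 'I_n, vars s1 10 = v &
        stuck e v \/ forall c, ecc e v <= ecc e c + (13 - 13)].
    split=> //; exists v => //; case: v13 => // vcentral w _.
    by have := vcentral w; rewrite subnn addn0.
  (* Each round lowers the eccentricity by at least 1 or finds [v] stuck, and a stuck vertex is kept
     by all later rounds. *)
  apply: (iter_ind (I := fun i s' => [/\ input s', time s' <= time s0 + 1 + i * (206 * N) &
      exists2 v : 'I_n, vars s' 10 = v &
        stuck e v \/ forall c, ecc e v <= ecc e c + (13 - i)])) => [|i s' lti [in' t' [v s'v vi]]].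
    by split; [by [] | rewrite mul0n addn0 /= addn1 | exists m => //; right].
  have int' : input (tick s') by [].
  have [u []] := improve_spec (xv := 10) (xu := 11) n1 int' isT isT isT s'v.
  have : input (sem (improve 10 11) (tick s')) by apply: input_frame.
  have : vars (sem (improve 10 11) (tick s')) 10 = v by rewrite vars_frame.
  rewrite /body sem_seq; move: (sem (improve 10 11) _) => s2 s2v in2 s2u vu t2.
  have [] := @keep_better_spec 10 11 s2 v u isT isT isT isT isT isT isT isT in2 n0 s2v s2u.
  have : input (sem (keep_better 10 11) s2) by apply: input_frame.
  move: (sem (keep_better 10 11) s2) => s3 in3 s3v t3; split=> //.
    move: t' t2 t3; rewrite /= mulSn /N; move: (time s') (time s2) (time s3) (time s0) S.
    by clear; lia.
  case: ifP s3v => [ltu s3v|/negbT]; last first.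
    rewrite -leqNgt => leu s3v; exists v => //; left.
    exact: improver_stuck vu leu.
  exists u => //; case: vi => [vstuck|vi]; last first.
    by right=> c; have := vi c; lia.
  by have := stuck_improver vstuck vu; rewrite leqNgt ltu.
rewrite sem_seq E1.
have [u []] := improve_spec (xv := 10) (xu := 11) n1 in1 isT isT isT s1v.
have : input (sem (improve 10 11) s1) by apply: input_frame.
have : vars (sem (improve 10 11) s1) 10 = v by rewrite vars_frame.
rewrite sem_seq; move: (sem (improve 10 11) _) => s2 s2v in2 s2u vu t2.
have [z [y [w []]]] := middle_slice_spec n0 in2 s2v s2u.
have : input (sem middle_slice s2) by apply: input_frame.
have : vars (sem middle_slice s2) 10 = v by rewrite vars_frame.
rewrite sem_seq; move: (sem middle_slice _) => s3 s3v in3 s3w uz zy wmax t3.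
have [u2 []] := improve_spec (xv := 14) (xu := 19) n1 in3 isT isT isT s3w.
have : input (sem (improve 14 19) s3) by apply: input_frame.
have : vars (sem (improve 14 19) s3) 10 = v by rewrite vars_frame.
have : vars (sem (improve 14 19) s3) 14 = w by rewrite vars_frame.
rewrite sem_seq; move: (sem (improve 14 19) _) => s4 s4w s4v in4 s4u wu2 t4.
pose x1 := if ecc e w < ecc e v then w else v.
have [] := @keep_better_spec 10 14 s4 v w isT isT isT isT isT isT isT isT in4 n0 s4v s4w.
have : input (sem (keep_better 10 14) s4) by apply: input_frame.
have : vars (sem (keep_better 10 14) s4) 19 = u2 by rewrite vars_frame.
rewrite sem_seq; move: (sem (keep_better 10 14) _) => s5 s5u in5 s5x t5.
pose x2 := if ecc e u2 < ecc e x1 then u2 else x1.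
have s5v : vars s5 10 = x1 by rewrite s5x /x1; case: ifP.
have [] := @keep_better_spec 10 19 s5 x1 u2 isT isT isT isT isT isT isT isT in5 n0 s5v s5u.
move: (sem (keep_better 10 19) _) => s6 s6x t6.
have min1 : ecc e x1 <= ecc e v /\ ecc e x1 <= ecc e w by rewrite /x1; case: ltnP; lia.
have min2 : ecc e x2 <= ecc e x1 /\ ecc e x2 <= ecc e u2 by rewrite /x2; case: ltnP; lia.
exists x2; split.
- by rewrite /= updE /= s6x /x2; case: ifP.
- have [] := final_stage sym_e irr_e conn_e alpha1 triangle vstuck vu uz zy wmax wu2;
    move=> opt c; have := opt c; lia.
- move: t0 t1 t2 t3 t4 t5 t6; rewrite /= /N.
  move: (time s0) (time s1) (time s2) (time s3) (time s4) (time s5) (time s6) (time s) S.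
  by clear; lia.
Qed.

End Search.
End Loops.

(** * The input *)

Section Layout.
Variables (n : nat) (adj : 'I_n -> seq 'I_n).
Let sizes := [seq size (adj v) | v <- enum 'I_n].
Let nbrs := [seq map val (adj v) | v <- enum 'I_n].

Lemma nth_sizes (v : 'I_n) : nth 0 sizes v = size (adj v).
Proof. by rewrite (nth_map v) ?nth_ord_enum // size_enum_ord. Qed.

Lemma shape_nbrs : shape nbrs = sizes.
Proof. by rewrite /shape -map_comp; apply: eq_map => v /=; rewrite size_map. Qed.

Lemma sumn_sizes : sumn sizes = \sum_v size (adj v).
Proof. by rewrite sumnE big_map big_enum. Qed.

Lemma layoutS i : nth 0 (layout adj) i.+1 =
  nth 0 ([seq (n + 2) + sumn (take k sizes) | k <- iota 0 n.+1] ++ flatten nbrs) i.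
Proof. by []. Qed.

Lemma layout_start k : k <= n -> nth 0 (layout adj) (k + 1) = n + 2 + sumn (take k sizes).
Proof.
move=> le_kn; rewrite addn1 layoutS nth_cat size_map size_iota ltnS le_kn.
by rewrite (nth_map 0) ?size_iota // nth_iota.
Qed.

Lemma layout_succ (v : 'I_n) :
  nth 0 (layout adj) (v + 2) = nth 0 (layout adj) (v + 1) + size (adj v).
Proof.
have ltv : v < size sizes by rewrite size_map size_enum_ord.
have -> : v + 2 = v.+1 + 1 by lia.
rewrite !layout_start ?(ltnW (ltn_ord v)) //.
by rewrite (take_nth 0 ltv) -cats1 sumn_cat /= addn0 nth_sizes addnA.
Qed.

Lemma layout_nbr (v : 'I_n) l w r : adj v = l ++ w :: r ->
  nth 0 (layout adj) (nth 0 (layout adj) (v + 1) + size l) = w.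
Proof.
move=> Ev; rewrite layout_start ?(ltnW (ltn_ord v)) //.
set a := sumn _; have -> : n + 2 + a + size l = (n.+1 + (a + size l)).+1 by lia.
rewrite layoutS nth_cat size_map size_iota ltnNge leq_addr /= addKn.
have lt_l : size l < nth 0 (shape nbrs) v.
  by rewrite shape_nbrs nth_sizes Ev size_cat /= -addSnnS leq_addr.
have -> : a + size l = flatten_index (shape nbrs) v (size l).
  by rewrite /flatten_index shape_nbrs.
rewrite nth_flatten flatten_indexKl // flatten_indexKr // (nth_map v) ?size_enum_ord //.
by rewrite nth_ord_enum Ev map_cat nth_cat size_map ltnn subnn.
Qed.

Lemma layout_end i : n + 2 + \sum_v size (adj v) <= i -> nth 0 (layout adj) i = 0.
Proof.
move=> le_i; apply: nth_default; apply: leq_trans le_i.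
rewrite /layout -cat1s !size_cat size_map size_iota size_flatten shape_nbrs sumn_sizes.
by rewrite addnA addn2.
Qed.

Lemma layout_last : nth 0 (layout adj) n.+1 = n + 2 + \sum_v size (adj v).
Proof.
by rewrite -addn1 layout_start // take_oversize ?sumn_sizes // size_map size_enum_ord.
Qed.

Lemma sum_degrees (e : rel 'I_n) : (forall v, uniq (adj v)) ->
  (forall v w, (w \in adj v) = e v w) -> \sum_v size (adj v) = #|[set p | e p.1 p.2]|.
Proof.
move=> uniq_adj adjE; rewrite -sum1_card (eq_bigl (fun p => xpredT p.1 && e p.1 p.2)); last first.
  by move=> p; rewrite inE.
rewrite -(pair_big_dep xpredT (fun v w => e v w) (fun _ _ => 1)) /=; apply: eq_bigr => v _.
by rewrite sum1_card -(card_uniqP (uniq_adj v)); apply: eq_card => w; rewrite adjE.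
Qed.

End Layout.

(** * The complete program *)

Definition solver := boot ++ compile central_vertex 0 (size boot) ++ [:: IHalt].

Lemma code_atT (P l r : seq instr) : code_at (P ++ l ++ r) (size P) l.
Proof. by move=> i lti; rewrite nth_cat ltnNge leq_addr /= addKn nth_cat lti. Qed.

Lemma nth_halt l1 l2 : nth IHalt (l1 ++ l2 ++ [:: IHalt]) (size l1 + size l2) = IHalt.
Proof. by rewrite catA nth_cat size_cat ltnn subnn. Qed.

Lemma wf_central_vertex : wf_cmd central_vertex 0.
Proof. by vm_compute. Qed.

(* There is a fixed RAM program and a constant c such that on every
   (alpha1,Delta)-metric graph with m edges, given by adjacency lists,
   the program halts within c*(m+1) steps with a central vertex in M[0]. *)
Theorem theorem9 :
  exists (P : seq instr) (c : nat),
    forall (n : nat) (e : rel 'I_n),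
      0 < n -> symmetric e -> irreflexive e ->
      (forall u v, connect e u v) ->
      alpha1_Delta_metric e ->
      forall M : nat -> nat, encodes e M ->
        exists k : nat,
          k <= c * (nedges e).+1 /\
          halted P (run P k (0, M)) /\
          exists v : 'I_n, central e v /\ (run P k (0, M)).2 0 = nat_of_ord v.
Proof.
set L := size (compile central_vertex 0 (size boot)).
(* With [n <= m + 1] and [S <= 2 m], relocating an input of [n + 2 + S] cells at 7 steps each fits
   into [size boot + 30] per unit of [m + 1], and [n + S + 1 <= 3 (m + 1)] gives the factor 3. *)
exists solver, (size boot + 30 + L * (4000 * 3)).
move=> n e n_gt0 sym_e irr_e conn_e [alpha1 triangle] M0 [adj [adjP M0E]].
have uniq_adj v : uniq (adj v) by have [] := adjP v.
have adjE v w : (w \in adj v) = e v w by have [_] := adjP v.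
set S := \sum_v size (adj v).
have leS : S <= 2 * nedges e by rewrite /S (sum_degrees uniq_adj adjE); apply: card_arcs.
have len : n <= (nedges e).+1 by have := card_leq_nedges irr_e conn_e; rewrite card_ord.
have code_boot : code_at solver 0 boot.
  by move=> i lti; rewrite nth_cat add0n lti.
have [||||i le_i|k [M1 [B [runk lek [repM1 M1n]]]]] :=
  @run_boot n (n + 2 + S) M0 n_gt0 _ _ _ _ _ _ code_boot.
- exact: leq_addr.
- by rewrite M0E.
- by rewrite M0E (@layout_start n adj 0) // take0 addn0.
- by rewrite M0E layout_last.
- by rewrite M0E layout_end.
have M0_start (v : 'I_n) : M0 (v + 2) = M0 (v + 1) + size (adj v) by rewrite !M0E layout_succ.
have M0_nbr (v : 'I_n) l w r : adj v = l ++ w :: r -> M0 (M0 (v + 1) + size l) = w.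
  by rewrite !M0E; apply: layout_nbr.
set s := Store M1 _ 0 in repM1.
have ins : input n M0 s by [].
have [v [sv vcentral ts]] := central_vertex_spec M0_start M0_nbr sym_e adjE irr_e conn_e
  alpha1 triangle uniq_adj ins n_gt0.
have [k' [M2 [runk' [_ repM2 _ _ _] _ lek']]] :=
  run_cmd repM1 wf_central_vertex (@code_atT boot (compile central_vertex 0 (size boot)) [:: IHalt]).
have runE : run solver (k + k') (0, M0) = (size boot + L, M2) by rewrite runD runk runk'.
exists (k + k'); rewrite runE; split; last split.
- have ltk' : k' <= L * (4000 * (n + S).+1).
    have time0 : time s = 0 by [].
    move: lek' ts; rewrite time0 muln0 addn0 add0n => lek' ts.
    by apply: leq_trans lek' _; rewrite leq_mul2l ts orbT.
  have N3 : 4000 * (n + S).+1 <= 4000 * 3 * (nedges e).+1 by rewrite -mulnA leq_mul2l; lia.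
  have LN : L * (4000 * (n + S).+1) <= L * (4000 * 3) * (nedges e).+1.
    by rewrite -mulnA leq_mul2l N3 orbT.
  rewrite mulnDl; apply: leq_add; last exact: leq_trans ltk' LN.
  apply: leq_trans lek _; move: (size boot) (nedges e) leS len => b m; clear; nia.
- by rewrite /halted nth_halt.
- by exists v; split=> //; rewrite -sv; apply: repM2.
Qed.
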